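(* Let $k$ be one of $\mathbb C$, $\mathbb R$ or $\mathbb R_+=[0,\infty)$, let $\Sigma$ be a rational fan (not necessarily complete) in $N_{\mathbb R}$, and let $X_\Sigma(k)$ be the associated toric variety over $k$ with its action of $T(k)$. If $\Sigma$ is complete, then $X_\Sigma(k)$ is a finite $T(k)$-CW complex. In general, $X_\Sigma(k)$ has the $T(k)$-equivariant homotopy type of a finite $T(k)$-CW complex.
   Context: $N$ is a free $\mathbb Z$-module of rank $n$ with dual $M=N^\vee$; $N_{\mathbb R}=N\otimes\mathbb R$, $M_{\mathbb R}=M\otimes\mathbb R$. A rational fan $\Sigma$ in $N_{\mathbb R}$ is a finite non-empty collection of strongly convex rational polyhedral cones, closed under taking faces and such that any two cones meet in a common face; it is complete if its cones cover $N_{\mathbb R}$. Regard $k$ as a multiplicative submonoid of $\mathbb C$. Set $T(k)=\mathrm{Hom}(M,k\cap S^1)$; thus $T(\mathbb C)\cong(S^1)^n$, $T(\mathbb R)\cong(\mathbb Z_2)^n$, $T(\mathbb R_+)=1$. For a cone $\sigma\in\Sigma$ with dual cone $\sigma^\vee\subset M_{\mathbb R}$ let $X_\sigma(k)=\mathrm{Hom}(\sigma^\vee\cap M,k)$ be the set of monoid homomorphisms, topologized (metric topology) by embedding it into some $k^L$ via finitely many generators of $\sigma^\vee\cap M$. $T(k)$ acts by pointwise multiplication. The toric variety $X_\Sigma(k)$ is obtained by gluing the $X_\sigma(k)$, $\sigma\in\Sigma$, as prescribed by the fan ($X_\tau(k)$ is open in $X_\sigma(k)$ for $\tau$ a face of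 $\sigma$). So $X_\Sigma(\mathbb C)$ is the usual complex toric variety, $X_\Sigma(\mathbb R)$ its real part and $X_\Sigma(\mathbb R_+)$ its non-negative part. A $G$-CW complex is an equivariant CW complex in the usual sense, built from equivariant cells $(G/H)\times D^m$ with $H\subset G$ a closed subgroup; it is finite if it has finitely many equivariant cells. *)

(* Defs.v *)
From Stdlib Require Relations.
From HB Require Import structures.
From mathcomp Require Import all_boot generic_quotient all_order all_algebra.
From mathcomp Require Import complex.
From mathcomp Require Import all_classical all_reals all_analysis.

Set Implicit Arguments.
Unset Strict Implicit.
Unset Printing Implicit Defensive.

Import Order.TTheory GRing.Theory Num.Theory.
Import numFieldNormedType.Exports.

Local Open Scope classical_set_scope.
Local Open Scope ring_scope.
Local Open Scope quotient_scope.

HB.mixin Record isTopologicalGroup G of Group G & Topological G := {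
  mulg_continuous : continuous (fun p : G * G => (p.1 * p.2)%g) ;
  invg_continuous : continuous (fun x : G => (x^-1)%g)
}.

#[short(type="topGroupType")]
HB.structure Definition TopologicalGroup :=
  {G of isTopologicalGroup G & Group G & Topological G}.

Record closed_subgroup (G : topGroupType) := ClosedSubgroup {
  subgroup_set : set G ;
  subgroup1 : subgroup_set 1%g ;
  subgroupM : forall x y,
    subgroup_set x -> subgroup_set y -> subgroup_set (x * y)%g ;
  subgroupV : forall x, subgroup_set x -> subgroup_set (x^-1)%g ;
  subgroup_closed : closed subgroup_set
}.

Section Cosets.
Context {G : topGroupType} (H : closed_subgroup G).

Definition coset_rel : rel G := fun x y => `[< subgroup_set H (x^-1 * y)%g >].

Lemma coset_rel_refl : reflexive coset_rel.
Proof. by move=> x; apply/asboolP; rewrite mulVg; exact: subgroup1. Qed.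

Lemma coset_rel_sym : symmetric coset_rel.
Proof.
have imp x y : coset_rel x y -> coset_rel y x.
  move=> /asboolP/subgroupV; rewrite invgM invgK => ?; exact/asboolP.
by move=> x y; apply/idP/idP; exact: imp.
Qed.

Lemma coset_rel_trans : transitive coset_rel.
Proof.
move=> y x z /asboolP Hxy /asboolP Hyz; apply/asboolP.
by have := subgroupM Hxy Hyz; rewrite mulgA -(mulgA _ y) mulgV mulg1.
Qed.

Definition coset_equiv :=
  EquivRel coset_rel coset_rel_refl coset_rel_sym coset_rel_trans.

Definition coset_space : topologicalType :=
  quotient_topology {eq_quot coset_equiv}.

Definition lcoset (g : G) : coset_space := \pi_({eq_quot coset_equiv})%qT g.

End Cosets.

Section GSpaces.
Context {G : topGroupType}.

Definition continuous_action {X : topologicalType} (act : G -> X -> X) : Prop :=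
  [/\ forall x, act 1%g x = x,
      forall g h x, act (g * h)%g x = act g (act h x) &
      continuous (fun p : G * X => act p.1 p.2)].

Definition equivariant {X Y : Type} (actX : G -> X -> X) (actY : G -> Y -> Y)
  (f : X -> Y) : Prop := forall g x, f (actX g x) = actY g (f x).

Section Homotopy.
Variable R : realType.

Definition equivariantly_homotopic {X Y : topologicalType}
    (actX : G -> X -> X) (actY : G -> Y -> Y) (f0 f1 : X -> Y) : Prop :=
  exists h : X * R -> Y,
  [/\ {within [set: X] `*` `[0, 1], continuous h},
      forall t, t \in `[0, 1] -> equivariant actX actY (fun x => h (x, t)),
      forall x, h (x, 0) = f0 x &
      forall x, h (x, 1) = f1 x].

Definition equivariantly_homotopy_equivalent {X Y : topologicalType}
    (actX : G -> X -> X) (actY : G -> Y -> Y) : Prop :=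
  [/\ continuous_action actX, continuous_action actY &
  exists (f : X -> Y) (f' : Y -> X),
  [/\ continuous f /\ equivariant actX actY f,
      continuous f' /\ equivariant actY actX f',
      equivariantly_homotopic actX actX (f' \o f) id &
      equivariantly_homotopic actY actY (f \o f') id]].

End Homotopy.

Section CW.
Variable R : realType.

Definition disk m : set 'rV[R]_m := [set x | \sum_i x 0 i ^+ 2 <= 1].
Definition open_disk m : set 'rV[R]_m := [set x | \sum_i x 0 i ^+ 2 < 1].
Definition unit_sphere m : set 'rV[R]_m := [set x | \sum_i x 0 i ^+ 2 = 1].

Definition closed_in {X : topologicalType} (Y B : set X) : Prop :=
  exists2 F, closed F & B = F `&` Y.

(* The subspace [Y] of [X] is obtained from [A] by attaching finitely many
   equivariant cells [G/H_j x D^m] along equivariant maps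
   [G/H_j x S^(m-1) -> A]: the characteristic maps [Phi j] exhibit [Y] as the
   pushout, i.e. they are a bijection from the disjoint union of the open cells
   to [Y \ A], and [Y] has the final topology with respect to the inclusion of
   [A] and the [Phi j]. Only the values of [Phi j] on [G/H_j x D^m] matter. *)
Definition attach_equivariant_cells {X : topologicalType} (act : G -> X -> X)
    (m : nat) (A Y : set X) : Prop :=
  exists (J : finType) (H : J -> closed_subgroup G)
         (Phi : forall j, coset_space (H j) * 'rV[R]_m -> X),
  [/\ forall j,
        [/\ {within [set: coset_space (H j)] `*` disk (m := m),
               continuous (Phi j)},
            forall g g' x, disk x ->
              Phi j (lcoset (H j) (g * g')%g, x) =
              act g (Phi j (lcoset (H j) g', x)) &
            forall c x, unit_sphere x -> A (Phi j (c, x))],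
      A `<=` Y,
      set_bij [set p : {j & (coset_space (H j) * 'rV[R]_m)%type} |
                 open_disk (projT2 p).2]
              (Y `\` A)
              (fun p => Phi (projT1 p) (projT2 p)) &
      forall B, B `<=` Y ->
        (closed_in Y B <->
         closed_in A (B `&` A) /\
         forall j, closed [set p | disk p.2 /\ B (Phi j p)])].

(* [F m.+1] is the [m]-skeleton. *)
Definition finite_GCW {X : topologicalType} (act : G -> X -> X) : Prop :=
  continuous_action act /\
  exists (d : nat) (F : nat -> set X),
  [/\ F 0%N = set0,
      forall m, (m < d)%N -> attach_equivariant_cells act m (F m) (F m.+1) &
      F d = [set: X]].

End CW.
End GSpaces.

(* A basis of N identifies N with Z^n, and M = Hom(N, Z) with Z^n via the
   standard pairing; N_R and M_R become R^n. *)
Section Fans.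
Variables (R : realType) (n : nat).

Definition pairing (u v : 'rV[R]_n) : R := \sum_i u 0 i * v 0 i.

Definition lattice_vec (m : 'rV[int]_n) : 'rV[R]_n := map_mx intr m.

Definition rational_polyhedral_cone (sigma : set 'rV[R]_n) : Prop :=
  exists (L : nat) (v : 'I_L -> 'rV[int]_n),
    sigma = [set x | exists2 a : 'I_L -> R, forall i, 0 <= a i &
                       x = \sum_i a i *: lattice_vec (v i)].

Definition strongly_convex (sigma : set 'rV[R]_n) : Prop :=
  forall x, sigma x -> sigma (- x) -> x = 0.

Definition dual_cone (sigma : set 'rV[R]_n) : set 'rV[R]_n :=
  [set u | forall v, sigma v -> 0 <= pairing u v].

Definition is_face (tau sigma : set 'rV[R]_n) : Prop :=
  exists2 u, dual_cone sigma u & tau = sigma `&` [set v | pairing u v = 0].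

Record rational_fan (Sigma : set (set 'rV[R]_n)) : Prop := {
  fan_finite : finite_set Sigma ;
  fan_nonempty : Sigma !=set0 ;
  fan_cone : forall sigma, Sigma sigma ->
    rational_polyhedral_cone sigma /\ strongly_convex sigma ;
  fan_face : forall sigma tau, Sigma sigma -> is_face tau sigma -> Sigma tau ;
  fan_meet : forall sigma sigma', Sigma sigma -> Sigma sigma' ->
    is_face (sigma `&` sigma') sigma /\ is_face (sigma `&` sigma') sigma'
}.

Definition complete_fan (Sigma : set (set 'rV[R]_n)) : Prop :=
  \bigcup_(sigma in Sigma) sigma = [set: 'rV[R]_n].

(* the monoid sigma^\vee \cap M *)
Definition dual_monoid (sigma : set 'rV[R]_n) : set 'rV[int]_n :=
  [set m | dual_cone sigma (lattice_vec m)].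

End Fans.

Variant base := BaseC | BaseR | BaseRplus.

(* In [R[i]], [0 <= z] means that z is real and non-negative. *)
Definition base_set (R : realType) (k : base) : set R[i] :=
  match k with
  | BaseC => setT
  | BaseR => [set z | z \is Num.real]
  | BaseRplus => [set z | 0 <= z]
  end.

Section PointwiseLemmas.
Variables (X : topologicalType) (S : eqType) (C : topologicalType).

Lemma continuous_to_ptws (f : X -> {ptws S -> C}) :
  (forall s, continuous (fun x => f x s)) -> continuous f.
Proof.
move=> cf x; apply/cvg_sup => s; apply: continuous_comp_initial.
exact: cf.
Qed.

Lemma continuous_to_ptws_sub (A : set {ptws S -> C}) (f : X -> A) :
  (forall s, continuous (fun x => set_val (f x) s)) -> continuous f.
Proof.
by move=> cf; apply: continuous_comp_initial; exact: continuous_to_ptws.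
Qed.

End PointwiseLemmas.

Lemma ptws_eval_continuous (S : eqType) (C : topologicalType)
  (A : set {ptws S -> C}) (s : S) : continuous (fun f : A => set_val f s).
Proof.
move=> f; apply: (@continuous_comp _ _ _ (set_val : A -> {ptws S -> C})
  (fun g : {ptws S -> C} => g s)).
  exact: initial_continuous.
exact: (@proj_continuous S (fun=> C) s).
Qed.

Lemma base_setM (R : realType) k (x y : R[i]) :
  base_set k x -> base_set k y -> base_set k (x * y).
Proof. by case: k => //=; [exact: realM|exact: mulr_ge0]. Qed.

Section Torus.
Variables (R : realType) (k : base) (n : nat).

(* [{ptws _ -> _}] is the topology of pointwise convergence. *)
Definition torus_pred : set {ptws 'rV[int]_n -> R[i]^o} :=
  [set t | (forall m, base_set k (t m) /\ `|t m| = 1) /\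
           forall a b, t (a + b) = t a * t b].

Definition torus : Type := torus_pred.

HB.instance Definition _ := Topological.on torus.

Definition torus_fun (t : torus) : 'rV[int]_n -> R[i] := set_val t.
Local Coercion torus_fun : torus >-> Funclass.

Lemma torusP (t : torus) : torus_pred (torus_fun t).
Proof. exact: set_valP. Qed.

Lemma torus_ext (s t : torus) : (forall m, s m = t m) -> s = t.
Proof. by move=> st; apply: val_inj; apply/funext. Qed.

Lemma torus_fun0 (t : torus) : t 0 = 1.
Proof.
have [/(_ 0)[_ n1] /(_ 0 0)] := torusP t; rewrite addr0 => /esym t0.
have t0N : t 0 != 0 by rewrite -normr_eq0 n1 oner_eq0.
by apply: (mulfI t0N); rewrite t0 mulr1.
Qed.

Lemma torus_one_subproof : torus_pred (fun _ => 1).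
Proof.
split=> [m|a b]; last by rewrite mulr1.
by rewrite normr1; split=> //; case: k => //=; exact: ler01.
Qed.

Lemma torus_mul_subproof (s t : torus) : torus_pred (fun m => s m * t m).
Proof.
have [s1 sD] := torusP s; have [t1 tD] := torusP t; split=> [m|a b].
  have [ks ns] := s1 m; have [kt nt] := t1 m.
  by split; [exact: base_setM|rewrite normrM ns nt mulr1].
by rewrite sD tD mulrACA.
Qed.

Lemma torus_inv_subproof (t : torus) : torus_pred (fun m => t (- m)).
Proof.
by have [t1 tD] := torusP t; split=> [m|a b]; [exact: t1|rewrite opprD tD].
Qed.

Definition torus_one : torus := SigSub (mem_set torus_one_subproof).
Definition torus_mul (s t : torus) : torus :=
  SigSub (mem_set (torus_mul_subproof s t)).
(* [t (- m) = (t m)^-1] *)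
Definition torus_inv (t : torus) : torus :=
  SigSub (mem_set (torus_inv_subproof t)).

Lemma torus_mulA : associative torus_mul.
Proof. by move=> r s t; apply: torus_ext => m; exact: mulrA. Qed.
Lemma torus_mul1 : left_id torus_one torus_mul.
Proof. by move=> t; apply: torus_ext => m; exact: mul1r. Qed.
Lemma torus_mulr1 : right_id torus_one torus_mul.
Proof. by move=> t; apply: torus_ext => m; exact: mulr1. Qed.
Lemma torus_mulV : left_inverse torus_one torus_inv torus_mul.
Proof.
move=> t; apply: torus_ext => m; have [_ tD] := torusP t.
by rewrite -[LHS]/(t (- m) * t m) -tD addNr torus_fun0.
Qed.
Lemma torus_mulrV : right_inverse torus_one torus_inv torus_mul.
Proof.
move=> t; apply: torus_ext => m; have [_ tD] := torusP t.
by rewrite -[LHS]/(t m * t (- m)) -tD addrN torus_fun0.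
Qed.

HB.instance Definition _ := isGroup.Build torus
  torus_mulA torus_mul1 torus_mulr1 torus_mulV torus_mulrV.

Lemma torus_mul_continuous :
  continuous (fun p : torus * torus => (p.1 * p.2)%g).
Proof.
apply: (@continuous_to_ptws_sub _ _ _ torus_pred) => m p.
have c1 : {for p, continuous (fun p : torus * torus => torus_fun p.1 m : R[i]^o)}.
  apply: (@continuous_comp _ _ _ fst (fun t : torus => torus_fun t m : R[i]^o)).
    exact: cvg_fst.
  exact: (@ptws_eval_continuous _ _ torus_pred m).
have c2 : {for p, continuous (fun p : torus * torus => torus_fun p.2 m : R[i]^o)}.
  apply: (@continuous_comp _ _ _ snd (fun t : torus => torus_fun t m : R[i]^o)).
    exact: cvg_snd.
  exact: (@ptws_eval_continuous _ _ torus_pred m).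
exact: (cvgM c1 c2).
Qed.

Lemma torus_inv_continuous : continuous (fun t : torus => (t^-1)%g).
Proof.
apply: (@continuous_to_ptws_sub _ _ _ torus_pred) => m.
exact: (@ptws_eval_continuous _ _ torus_pred (- m)).
Qed.

HB.instance Definition _ := isTopologicalGroup.Build torus
  torus_mul_continuous torus_inv_continuous.

End Torus.

Section Chart.
Variables (R : realType) (k : base) (n : nat) (sigma : set 'rV[R]_n).

(* monoid homomorphisms from [sigma^\vee \cap M] to the multiplicative monoid k *)
Definition chart_pred : set {ptws dual_monoid sigma -> R[i]^o} :=
  [set phi | [/\ forall a, base_set k (phi a),
    forall a, set_val a = 0 -> phi a = 1 &
    forall a b c, set_val c = set_val a + set_val b -> phi c = phi a * phi b]].

Definition chart : Type := chart_pred.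

HB.instance Definition _ := Topological.on chart.

Definition chart_fun (phi : chart) : dual_monoid sigma -> R[i] := set_val phi.
Local Coercion chart_fun : chart >-> Funclass.

Lemma chartP (phi : chart) : chart_pred (chart_fun phi).
Proof. exact: set_valP. Qed.

Lemma chart_act_subproof (t : torus R k n) (phi : chart) :
  chart_pred (fun a => torus_fun t (set_val a) * phi a).
Proof.
have [t1 tD] := torusP t; have [p1 p0 pD] := chartP phi; split=> [a|a a0|a b c cab].
- by apply: base_setM; [have [] := t1 (set_val a)|exact: p1].
- by rewrite p0// mulr1 a0 torus_fun0.
- by rewrite cab tD (pD _ _ _ cab) mulrACA.
Qed.

Definition chart_act (t : torus R k n) (phi : chart) : chart :=
  SigSub (mem_set (chart_act_subproof t phi)).

Lemma dual_monoid0 : dual_monoid sigma 0.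
Proof.
move=> v _; rewrite /pairing big1// => i _.
by rewrite /lattice_vec !mxE mulr0z mul0r.
Qed.

Lemma dual_monoidD a b :
  dual_monoid sigma a -> dual_monoid sigma b -> dual_monoid sigma (a + b).
Proof.
move=> Sa Sb v sv; suff -> : pairing (lattice_vec R (a + b)) v =
    pairing (lattice_vec R a) v + pairing (lattice_vec R b) v.
  by apply: addr_ge0; [exact: Sa|exact: Sb].
rewrite /pairing -big_split/=; apply: eq_bigr => i _.
by rewrite /lattice_vec !mxE intrD mulrDl.
Qed.

Definition generates (L : nat) (g : 'I_L -> dual_monoid sigma) : Prop :=
  forall a : dual_monoid sigma,
    exists c : 'I_L -> nat, set_val a = \sum_i set_val (g i) *+ c i.

(* The topology of pointwise convergence on [chart] is the metric topology
   induced by the embedding into k^L given by any finite system of generators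
   (which exists for a rational polyhedral cone by Gordan's lemma). *)
Lemma chart_open_generators (L : nat) (g : 'I_L -> dual_monoid sigma)
    (U : set chart) : generates g ->
  open U <-> exists2 V : set {ptws 'I_L -> R[i]^o}, open V &
               U = (fun phi : chart => fun i => phi (g i)) @^-1` V.
Proof.
move=> gen; pose ev (phi : chart) : {ptws 'I_L -> R[i]^o} := fun i => phi (g i).
pose W := initial_topology ev.
have evc : continuous (ev : chart -> {ptws 'I_L -> R[i]^o}).
  apply: continuous_to_ptws => i.
  exact: (@ptws_eval_continuous _ _ chart_pred (g i)).
split=> [oU|[V oV ->]]; last by move/continuousP : evc; apply.
pose P m := exists2 b : dual_monoid sigma, set_val b = m &
  continuous (fun phi : W => (phi : chart) b : R[i]^o).
have P0 : P 0.
  exists (SigSub (mem_set dual_monoid0)) => //.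
  rewrite (_ : (fun _ => _) = cst 1); first exact: cst_continuous.
  by apply/funext => phi; have [_ p0 _] := chartP phi; exact: p0.
have PD a b : P a -> P b -> P (a + b).
  move=> [a' a'a ca] [b' b'b cb].
  have Sab : dual_monoid sigma (a + b).
    by rewrite -a'a -b'b; apply: dual_monoidD; exact: set_valP.
  pose ab : dual_monoid sigma := SigSub (mem_set Sab).
  exists ab; first by [].
  move=> phi; rewrite (_ : (fun _ => _) =
      (fun phi : W => (phi : chart) a' * (phi : chart) b' : R[i]^o)).
    exact: (cvgM (ca phi) (cb phi)).
  apply/funext => psi; have [_ _ /(_ a' b' ab) pD] := chartP psi; apply: pD.
  by rewrite a'a b'b.
have Pg i : P (set_val (g i)).
  exists (g i) => // phi.
  apply: (@continuous_comp _ _ _ (ev : W -> {ptws 'I_L -> R[i]^o})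
    (fun f : {ptws 'I_L -> R[i]^o} => f i)).
    exact: initial_continuous.
  exact: (@proj_continuous 'I_L (fun=> R[i]^o) i).
have PS (a : dual_monoid sigma) : P (set_val a).
  have [c ->] := gen a; apply: big_ind => // i _.
  by elim: (c i) => [|m IH]; rewrite ?mulr0n// mulrS; exact: PD.
have cid : continuous (id : W -> chart).
  apply: (@continuous_to_ptws_sub _ _ _ chart_pred) => a.
  by have [b /val_inj <-] := PS a.
have /continuousP/(_ _ oU) := cid; rewrite preimage_id => -[V oV VU].
by exists V.
Qed.

End Chart.

(* The gluing of the charts: the quotient of their disjoint union by the
   equivalence relation generated by identifying, for a face [tau] of [sigma], a
   point of [X_tau] with its restriction to [sigma^\vee \cap M]. *)
Section ToricVariety.
Variables (R : realType) (k : base) (n : nat) (Sigma : set (set 'rV[R]_n)).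

Definition chart_sum : topologicalType :=
  {sigma : Sigma & chart k (set_val sigma)}.

Definition glue_step (x y : chart_sum) : Prop :=
  is_face (set_val (projT1 x)) (set_val (projT1 y)) /\
  forall a b, set_val a = set_val b ->
    chart_fun (projT2 x) a = chart_fun (projT2 y) b.

Definition glue : rel chart_sum :=
  fun x y => `[< Relation_Operators.clos_refl_sym_trans _ glue_step x y >].

Lemma glue_refl : reflexive glue.
Proof. by move=> x; apply/asboolP; exact: Relation_Operators.rst_refl. Qed.

Lemma glue_sym : symmetric glue.
Proof.
by move=> x y; apply/asboolP/asboolP; exact: Relation_Operators.rst_sym.
Qed.

Lemma glue_trans : transitive glue.
Proof.
move=> y x z /asboolP xy /asboolP yz; apply/asboolP.
exact: Relation_Operators.rst_trans xy yz.
Qed.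

Definition glue_equiv := EquivRel glue glue_refl glue_sym glue_trans.

Definition toric_variety : topologicalType :=
  quotient_topology {eq_quot glue_equiv}.

Definition toric_point (x : chart_sum) : toric_variety :=
  \pi_({eq_quot glue_equiv}) x.

Lemma toric_pointP (x y : chart_sum) :
  toric_point x = toric_point y <-> glue x y.
Proof. by split=> [/eqquotP|xy]; [|apply/eqquotP]. Qed.

Definition chart_sum_act (t : torus R k n) (x : chart_sum) : chart_sum :=
  existT _ (projT1 x) (chart_act t (projT2 x)).

Definition toric_act (t : torus R k n) (x : toric_variety) : toric_variety :=
  toric_point (chart_sum_act t (repr (x : {eq_quot glue_equiv}))).

Lemma toric_act_point (t : torus R k n) (x : chart_sum) :
  toric_act t (toric_point x) = toric_point (chart_sum_act t x).
Proof.
apply/toric_pointP/asboolP.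
have : glue (repr (toric_point x : {eq_quot glue_equiv})) x.
  by apply/toric_pointP; exact: reprK.
move: (repr _) => y /asboolP.
elim=> {x y} [x y [xy E]|x|x y _ IH|x y z _ IH1 _ IH2].
- apply: Relation_Operators.rst_step; split=> // a b ab.
  by rewrite -[LHS]/(_ * _) -[RHS]/(_ * _) (E _ _ ab) /= ab.
- exact: Relation_Operators.rst_refl.
- exact: Relation_Operators.rst_sym.
- exact: Relation_Operators.rst_trans IH1 IH2.
Qed.

End ToricVariety.

(* Main.v *)
Require Import Defs.
From mathcomp Require Import all_boot all_order all_algebra.
From mathcomp Require Import complex.
From mathcomp Require Import all_classical all_reals all_analysis.
From mathcomp Require Import ring lra zify.

(* A point x of the toric variety is a family of values x(u) for the characters
   u defined at x. Let v_i be the sum of chosen generators of the i-th cone and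
   let K_i be the set of the points x of the chart of that cone such that
   |x(u)| <= 1 for all u in the dual monoid. Splitting off phases and then
   stripping homomorphisms with values in [0, 1] of barycenters v_i one after
   the other, every point of K_i is x(u) = t(u) prod_l s_l^<u,v_l> with t in the
   torus and 0 <= s_l <= 1, where the cones with s_l < 1 form a chain of cones
   below i whose least element a is the only one with s_a = 0. The weights s are
   unique, and t is unique up to the stabilizer of the orbit of the cone a. Hence
   each chain of m + 1 cones contributes one equivariant m-cell, a cube in the
   weights s_l with l <> a, to the union of the blocks K_i. If the fan is
   complete, the blocks cover the variety: -log|x| lies in the image of some
   cone modulo the span of the cone of the orbit of x.

   In general X is deformed, preserving each block, into the union of the blocks:
   at time p the modulus of x(u) is raised to the power 1 - p and multiplied by
   prod_l (1 - p + p s_l(x))^<u,v_l>, where s_l(x) depends continuously on x,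
   vanishes on the orbit closure of the cone l and is 1 away from it; the latter
   factor restores continuity where a modulus vanishes and p = 1. *)

Set Implicit Arguments.
Unset Strict Implicit.
Unset Printing Implicit Defensive.

Import Order.TTheory GRing.Theory Num.Theory.
Import numFieldNormedType.Exports.

Local Open Scope classical_set_scope.
Local Open Scope ring_scope.
Local Open Scope complex_scope.
Local Open Scope quotient_scope.

(** * Rational cones *)

(** The variety is the quotient by a generated equivalence relation, which gives no direct hold on
    its points. The tool that replaces an explicit description is the separation lemma for fans: two
    cones have a character u such that u and -u expose their intersection. Wherever two charts
    overlap, u is invertible; this governs the intersections of charts, the continuity of values and
    the Hausdorff property. The final topology of a cell attachment comes from compactness: T(k) and
    the disks are compact and the variety is Hausdorff, so images of closed sets under the
    characteristic maps are closed. In the deformation, the exponents |<u,v_l>| are additive in u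
    only on a chart whose cone contains the cone l. Hence near every point the cones l with s_l < 1
    must lie below one common cone. Orbit closures of cones without a common upper bound do not
    meet, so the sum of their distances is positive everywhere; comparing distances with such sums
    is the origin of [gap] and of the constant in [push]. *)

Section Dot.
Variables (F : comNzRingType) (n : nat).
Implicit Types u v w : 'rV[F]_n.

(** Same formula as [pairing], but over any commutative ring: it serves over the integers, the
    rationals and [R], and over [R] it is convertible to [pairing]. *)
Definition dot u v : F := \sum_i u 0 i * v 0 i.

Lemma dotC u v : dot u v = dot v u.
Proof. by apply: eq_bigr => i _; rewrite mulrC. Qed.

Lemma dotDl u v w : dot (u + v) w = dot u w + dot v w.
Proof. by rewrite /dot -big_split; apply: eq_bigr => i _; rewrite mxE mulrDl. Qed.

Lemma dotZl c u v : dot (c *: u) v = c * dot u v.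
Proof. by rewrite /dot mulr_sumr; apply: eq_bigr => i _; rewrite mxE mulrA. Qed.

Lemma dotDr u v w : dot u (v + w) = dot u v + dot u w.
Proof. by rewrite dotC dotDl !(dotC u). Qed.

Lemma dotZr c u v : dot u (c *: v) = c * dot u v.
Proof. by rewrite dotC dotZl dotC. Qed.

Lemma dot0l v : dot 0 v = 0.
Proof. by rewrite -(scale0r 0) dotZl mul0r. Qed.

Lemma dot0r v : dot v 0 = 0.
Proof. by rewrite dotC dot0l. Qed.

Lemma dotNl u v : dot (- u) v = - dot u v.
Proof. by rewrite -scaleN1r dotZl mulN1r. Qed.

Lemma dotNr u v : dot u (- v) = - dot u v.
Proof. by rewrite dotC dotNl dotC. Qed.

Lemma dotMnl u v m : dot (u *+ m) v = dot u v *+ m.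
Proof. by rewrite -scaler_nat dotZl mulr_natl. Qed.

Lemma dot_sumr (I : Type) (s : seq I) (f : I -> 'rV_n) u :
  dot u (\sum_(i <- s) f i) = \sum_(i <- s) dot u (f i).
Proof.
by elim/big_rec2: _ => [|i x y _ <-]; [exact: dot0r|exact: dotDr].
Qed.

Lemma dot_delta u i : dot u (delta_mx 0 i) = u 0 i.
Proof.
rewrite /dot (bigD1 i)//= mxE !eqxx mulr1 big1 ?addr0// => j ji.
by rewrite mxE eqxx (negPf ji) mulr0.
Qed.

Lemma dot_eq0 u : (forall x, dot u x = 0) -> u = 0.
Proof. by move=> u0; apply/rowP => i; rewrite mxE -dot_delta u0. Qed.

End Dot.

Section Farkas.
Variables (F : realFieldType) (n : nat).
Implicit Types (s : seq 'rV[F]_n) (g : 'rV[F]_n).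

Definition conic s g := exists2 l : nat -> F, forall i, 0 <= l i &
  g = \sum_(i < size s) l i *: s`_i.

Lemma conic_cons b s g c : 0 <= c -> conic s (g - c *: b) -> conic (b :: s) g.
Proof.
move=> c0 [l l0 gE]; exists (fun i => if i is j.+1 then l j else c) => [[|i]//|].
by rewrite big_ord_recl /= -gE addrC subrK.
Qed.

(* Bartl's induction on the number of generators: if the last functional b is
   needed, some x0 has b x0 = -1, a x0 >= 0 for the other generators a and
   g x0 < 0; the shear x |-> x + (b x) x0 then removes b. *)
Lemma farkas s g :
  (forall x, (forall a, a \in s -> 0 <= dot a x) -> 0 <= dot g x) -> conic s g.
Proof.
move: {2}(size s) (erefl (size s)) => m.
elim: m s g => [|m IH] [|b s] g //= sm hg.
  exists (fun=> 0) => //; rewrite big_ord0; apply: dot_eq0 => x.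
  apply/eqP; rewrite eq_le; apply/andP; split; last exact: hg.
  by rewrite -oppr_ge0 -dotNr; apply: hg.
have [hs|] := pselect (forall x, (forall a, a \in s -> 0 <= dot a x) ->
                         0 <= dot g x).
  apply: (@conic_cons _ _ _ 0) => //; rewrite scale0r subr0.
  by apply: IH => //; case: sm.
move=> /existsNP[x0' /not_implyP[sx0' /negP]]; rewrite -ltNge => gx0'.
have bx0' : dot b x0' < 0.
  rewrite ltNge; apply/negP => bx0; move: gx0'; rewrite ltNge hg// => a.
  by rewrite inE => /orP[/eqP->//|]; exact: sx0'.
pose x0 := (- dot b x0')^-1 *: x0'.
have i0 : 0 < (- dot b x0')^-1 by rewrite invr_gt0 oppr_gt0.
have bx0 : dot b x0 = -1.
  by rewrite /x0 dotZr invrN mulNr mulVf// ltr0_neq0.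
have sx0 a : a \in s -> 0 <= dot a x0.
  by move=> sa; rewrite dotZr mulr_ge0 ?sx0'// ltW.
have gx0 : dot g x0 < 0 by rewrite dotZr pmulr_rlt0.
pose sh (a : 'rV[F]_n) := a + dot a x0 *: b.
have : conic (map sh s) (sh g).
  apply: IH => [|x hx]; first by rewrite size_map; case: sm.
  have sh_shear a : dot (sh a) x = dot a (x + dot b x *: x0).
    by rewrite dotDl dotZl dotDr (dotZr (dot b x)) mulrC.
  rewrite sh_shear; apply: hg => a; rewrite inE => /orP[/eqP->|sa].
    by rewrite dotDr dotZr bx0 mulrN1 subrr.
  by rewrite -sh_shear; apply: hx; exact: map_f.
move=> [l l0]; rewrite size_map => gE.
(* This is the coefficient of [b] once every [sh] in [gE] is expanded; it is nonnegative since [x0]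
   is nonnegative on [s] and negative on [g]. *)
apply: (@conic_cons _ _ _ (\sum_(i < size s) l i * dot s`_i x0 - dot g x0)).
  rewrite subr_ge0 (le_trans (ltW gx0))// sumr_ge0// => i _.
  by rewrite mulr_ge0// sx0// mem_nth.
exists l => //.
have gE' : g = sh g - dot g x0 *: b by rewrite /sh addrK.
rewrite [in LHS]scalerBl {1}gE' gE.
under eq_bigr => i _ do rewrite (nth_map 0)// /sh scalerDr scalerA.
by rewrite big_split/= -scaler_suml opprB addrA subrK addrK.
Qed.

End Farkas.

Section IntegralSeparation.
Variables (R : realType) (n : nat).
Implicit Types (s : seq 'rV[int]_n) (u v w : 'rV[int]_n).

Lemma clear_denominators (x : 'rV[rat]_n) :
  exists2 d : int, 0 < d & exists u, d%:~R *: x = map_mx intr u.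
Proof.
exists (\prod_i denq (x 0 i)); first by apply: prodr_gt0 => i _; exact: denq_gt0.
exists (\row_i (numq (x 0 i) * \prod_(j | j != i) denq (x 0 j))).
apply/rowP => i; rewrite !mxE (bigD1 i)//= !intrM mulrAC; congr (_ * _).
by rewrite mulrC -{1}(divq_num_den (x 0 i)) divfK// intr_eq0 denq_neq0.
Qed.

Lemma dot_map_intr (K : comNzRingType) u v :
  dot (map_mx intr u : 'rV[K]_n) (map_mx intr v) = (dot u v)%:~R.
Proof.
rewrite /dot rmorph_sum; apply: eq_bigr => i _.
by rewrite !mxE rmorphM.
Qed.

Lemma pairing_lattice u v :
  pairing (lattice_vec R u) (lattice_vec R v) = (dot u v)%:~R.
Proof. exact: dot_map_intr. Qed.

Lemma pairingE (u v : 'rV[R]_n) : pairing u v = dot u v.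
Proof. by []. Qed.

Lemma lattice_vecN u : lattice_vec R (- u) = - lattice_vec R u.
Proof. by apply/rowP => i; rewrite !mxE rmorphN. Qed.

Lemma lattice_vecD u v : lattice_vec R (u + v) = lattice_vec R u + lattice_vec R v.
Proof. by apply/rowP => i; rewrite !mxE rmorphD. Qed.

(** Farkas is applied over the rationals, where a test vector becomes integral after clearing
    denominators; the rational coefficients are then carried into [R]. *)
Lemma integral_farkas s w :
  (forall u, (forall v, v \in s -> 0 <= dot u v) -> 0 <= dot u w) ->
  conic (map (@lattice_vec R n) s) (lattice_vec R w).
Proof.
move=> hw.
have : conic (map (map_mx intr) s) (map_mx intr w : 'rV[rat]_n).
  apply: farkas => x hx; have [d d0 [u xu]] := clear_denominators x.
  have d0' : 0 < d%:~R :> rat by rewrite ltr0z.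
  have H v : (0 <= dot (map_mx intr v) x) = (0 <= dot u v).
    by rewrite -(pmulr_rge0 _ d0') -dotZr xu dotC dot_map_intr ler0z.
  rewrite H; apply: hw => v sv; rewrite -H; apply: hx; exact: map_f.
move=> [l l0]; rewrite size_map => wE.
exists (fun i => ratr (l i)) => [i|]; first by rewrite ler0q.
rewrite size_map; apply/rowP => j; move/rowP/(_ j)/(congr1 (@ratr R)) : wE.
rewrite !mxE ratr_int => ->; rewrite !summxE rmorph_sum; apply: eq_bigr => i _.
by rewrite !(nth_map 0)// !mxE rmorphM/= ratr_int.
Qed.

Lemma conic_nonneg (t : seq 'rV[R]_n) (g x : 'rV[R]_n) : conic t g ->
  (forall a, a \in t -> 0 <= dot x a) -> 0 <= dot x g.
Proof.
move=> [l l0 ->] hx; rewrite dot_sumr sumr_ge0// => i _.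
by rewrite dotZr mulr_ge0// hx// mem_nth.
Qed.

(* A relative interior point of the dual cone of [s] vanishes only on the
   lineality space of the cone spanned by [s]. *)
Lemma strict_separation s : exists2 u, (forall v, v \in s -> 0 <= dot u v) &
  forall v, v \in s -> dot u v = 0 ->
    conic (map (@lattice_vec R n) s) (- lattice_vec R v).
Proof.
suff H (t : seq 'rV[int]_n) : {subset t <= s} -> exists2 u, (forall v, v \in s -> 0 <= dot u v) &
  forall v, v \in t -> dot u v = 0 ->
    conic (map (@lattice_vec R n) s) (- lattice_vec R v).
  by apply: H.
elim: t => [_|b t IH bts]; first by exists 0 => // v _; rewrite dot0l.
have [v vt|u us ut] := IH; first by apply: bts; rewrite inE vt orbT.
have [cb|ncb] := pselect (conic (map (@lattice_vec R n) s) (- lattice_vec R b)).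
  exists u => // v; rewrite inE => /orP[/eqP->//|]; exact: ut.
have [w [ws wb]] : exists w, (forall v, v \in s -> 0 <= dot w v) /\ 0 < dot w b.
  apply: contrapT => nw; apply: ncb; rewrite -lattice_vecN.
  apply: integral_farkas => w ws; rewrite dotNr oppr_ge0 leNgt.
  by apply/negP => wb; apply: nw; exists w.
exists (u + w) => [v sv|v vt]; first by rewrite dotDl addr_ge0 ?us ?ws.
have sv := bts _ vt.
rewrite dotDl => /eqP; rewrite paddr_eq0 ?us ?ws// => /andP[/eqP uv /eqP wv].
move: vt; rewrite inE => /orP[/eqP vb|vt]; last exact: ut.
by move: wb; rewrite -vb wv ltxx.
Qed.

End IntegralSeparation.

(** * Finite generation of dual monoids up to multiples *)

Section DoubleDescription.
Variable n : nat.
Implicit Types (G : set 'rV[int]_n) (u v : 'rV[int]_n).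

Inductive nspan G : 'rV[int]_n -> Prop :=
| nspan0 : nspan G 0
| nspan_add g x : G g -> nspan G x -> nspan G (g + x).

Lemma nspanD G x y : nspan G x -> nspan G y -> nspan G (x + y).
Proof.
elim=> [|g {}x Gg _ IH] Gy; first by rewrite add0r.
by rewrite -addrA; apply: nspan_add => //; exact: IH.
Qed.

Lemma nspanMn G x m : nspan G x -> nspan G (x *+ m).
Proof.
move=> Gx; elim: m => [|m IH]; first by rewrite mulr0n; exact: nspan0.
by rewrite mulrS; exact: nspanD.
Qed.

Lemma nspan_sub G G' x : G `<=` G' -> nspan G x -> nspan G' x.
Proof.
move=> GG'; elim=> [|g y Gg _ IH]; first exact: nspan0.
by apply: nspan_add => //; exact: GG'.
Qed.

Lemma nspan_mem G g : G g -> nspan G g.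
Proof. by move=> Gg; rewrite -[g]addr0; apply: nspan_add => //; exact: nspan0. Qed.

(** One step of Fourier-Motzkin elimination: a generator positive on [v] and one negative on [v] are
    combined with the weights that put the result on the hyperplane orthogonal to [v]. *)
Definition dd_step (v : 'rV[int]_n) (G : seq 'rV[int]_n) :=
  [seq g <- G | 0 <= dot g v] ++
  [seq g' *+ `|dot g v|%N + g *+ `|dot g' v|%N |
     g <- [seq g <- G | 0 < dot g v], g' <- [seq g <- G | dot g v < 0]].

Lemma nspan_dd_step (v : 'rV[int]_n) (G : seq 'rV[int]_n) x :
  nspan [set` G] x -> 0 <= dot x v ->
  exists2 N, (0 < N)%N & nspan [set` dd_step v G] (x *+ N).
Proof.
pose Gp := [set` [seq g <- G | 0 < dot g v]].
pose Gn := [set` [seq g <- G | dot g v < 0]].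
pose G' := [set` dd_step v G].
have GpG' : Gp `<=` G'.
  move=> g; rewrite /Gp /G' /= /dd_step mem_cat !mem_filter.
  by move=> /andP[/ltW -> ->].
move=> Gx; have [x0 [p [q [Gx0 x0v [Gpp Gnq] ->]]]] : exists x0 p q,
    [/\ nspan G' x0, dot x0 v = 0, nspan Gp p /\ nspan Gn q & x = x0 + (p + q)].
  elim: Gx => [|g y Gg _ [x0 [p [q [Gx0 x0v [Gpp Gnq] ->]]]]].
    exists 0, 0, 0; split; rewrite ?dot0l ?addr0//; last split; exact: nspan0.
  case: (ltrgtP (dot g v) 0) => gv.
  - exists x0, p, (g + q); split => //; last by rewrite addrCA (addrCA g).
    by split => //; apply: nspan_add => //; rewrite /Gn /= mem_filter gv.
  - exists x0, (g + p), q; split => //; last by rewrite addrCA -(addrA g).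
    by split => //; apply: nspan_add => //; rewrite /Gp /= mem_filter gv.
  - exists (g + x0), p, q; split => //; rewrite ?addrA ?dotDl ?gv ?x0v//.
    by apply: nspan_add => //; rewrite /G' /= mem_cat mem_filter gv lexx Gg.
rewrite !dotDl x0v add0r => pqv.
have pv0 y : nspan Gp y -> 0 <= dot y v /\ (dot y v = 0 -> y = 0).
  elim=> [|g z]; first by rewrite dot0l.
  rewrite /Gp /= mem_filter => /andP[gv _] _ [zv _]; rewrite dotDl; split.
    by rewrite addr_ge0// ltW.
  by move=> gz; have := ltr_wpDr zv gv; rewrite gz ltxx.
have qv0 y : nspan Gn y -> dot y v <= 0 /\ (dot y v = 0 -> y = 0).
  elim=> [|g z]; first by rewrite dot0l.
  rewrite /Gn /= mem_filter => /andP[gv _] _ [zv _]; rewrite dotDl; split.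
    by move: zv gv; lia.
  by move: zv gv; lia.
have [pv p0] := pv0 _ Gpp; have [qv q0] := qv0 _ Gnq.
have [pv00|pvn0] := eqVneq (dot p v) 0.
  have qv00 : dot q v = 0 by move: qv pqv pv00; lia.
  by exists 1%N => //; rewrite mulr1n p0// q0// !addr0.
exists `|dot p v|%N; first by rewrite absz_gt0.
(* With P = <p,v> and Q = -<q,v> <= P, write P(p + q) = (P - Q) p + (Q p + P q);
   the last term is bilinear in (p, q), hence a sum of combined generators. *)
have -> : (x0 + (p + q)) *+ `|dot p v|%N = x0 *+ `|dot p v|%N +
    (p *+ (`|dot p v| - `|dot q v|)%N +
     (q *+ `|dot p v|%N + p *+ `|dot q v|%N)).
  rewrite !mulrnDl; congr (_ + _).
  rewrite [in RHS]addrA [RHS]addrAC -mulrnDr subnK//.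
  by move: pv qv pqv; lia.
have GB y z : nspan Gp y -> nspan Gn z ->
    nspan G' (z *+ `|dot y v|%N + y *+ `|dot z v|%N).
  move=> Gy Gz; elim: Gy => [|g y' Gg Gy' IH].
    by rewrite dot0l mul0rn addr0 mulr0n; exact: nspan0.
  have -> : `|dot (g + y') v|%N = (`|dot g v| + `|dot y' v|)%N.
    move: Gg; rewrite /Gp /= mem_filter => /andP[gv _].
    by rewrite dotDl; have [] := pv0 _ Gy'; lia.
  rewrite mulrnDr mulrnDl addrACA; apply: nspanD => //.
  elim: Gz {IH} => [|h z' Gh Gz' IH].
    by rewrite dot0l mul0rn add0r mulr0n; exact: nspan0.
  have -> : `|dot (h + z') v|%N = (`|dot h v| + `|dot z' v|)%N.
    move: Gh; rewrite /Gn /= mem_filter => /andP[hv _].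
    by rewrite dotDl; have [] := qv0 _ Gz'; lia.
  rewrite mulrnDl mulrnDr addrACA; apply: nspanD => //; apply: nspan_mem.
  rewrite /G' /= mem_cat; apply/orP; right.
  by apply/allpairsP; exists (g, h).
apply: nspanD; first exact: nspanMn.
apply: nspanD; last exact: GB.
by apply: nspanMn; exact: nspan_sub Gpp.
Qed.

(** Gordan's lemma up to a positive multiple [N]: each elimination step costs a factor. The multiple
    is harmless for [monoidal_strip], where inequalities between nonnegative numbers may be checked
    on [N]-th powers. *)
Lemma double_description (s : seq 'rV[int]_n) : exists G : seq 'rV[int]_n,
  (forall g, g \in G -> forall v, v \in s -> 0 <= dot g v) /\
  forall u, (forall v, v \in s -> 0 <= dot u v) ->
    exists2 N, (0 < N)%N & nspan [set` G] (u *+ N).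
Proof.
elim: s => [|v s [G [Gs sG]]].
  exists ([seq delta_mx 0 i | i <- enum 'I_n] ++
          [seq - delta_mx 0 i | i <- enum 'I_n]); split=> // u _.
  exists 1%N => //; rewrite mulr1n (row_sum_delta u).
  apply: (big_ind (nspan _)) => [|x y|i _]; [exact: nspan0|exact: nspanD|].
  have [k [->|->]] : exists k : nat, u 0 i = k%:Z \/ u 0 i = - k%:Z.
  - by case: (u 0 i) => k; [exists k; left|exists k.+1; right; rewrite NegzE].
  - rewrite -[k%:Z]natz scaler_nat; apply: nspanMn.
    apply: nspan_mem => /=; rewrite mem_cat map_f ?mem_enum//.
  - rewrite scaleNr -scalerN -[k%:Z]natz scaler_nat; apply: nspanMn.
    by apply: nspan_mem => /=; rewrite mem_cat (map_f (fun i => - delta_mx 0 i)) ?mem_enum ?orbT.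
exists (dd_step v G); split.
  move=> g; rewrite mem_cat => /orP[|/allpairsP[[g1 g2]/= []]].
    rewrite mem_filter => /andP[gv Gg] w; rewrite inE => /orP[/eqP->//|].
    exact: Gs.
  rewrite !mem_filter => /andP[g1v Gg1] /andP[g2v Gg2] -> w.
  rewrite inE => /orP[/eqP->|sw]; last first.
    by rewrite dotDl !dotMnl addr_ge0// mulrn_wge0// Gs.
  by rewrite dotDl !dotMnl -(mulr_natl (dot g2 v)) -(mulr_natl (dot g1 v)) !natz
    gtz0_abs// ltz0_abs// mulNr mulrC addrN.
move=> u uvs; have [v' sv'|N N0 GN] := sG u.
  by apply: uvs; rewrite inE sv' orbT.
have uNv : 0 <= dot (u *+ N) v by rewrite dotMnl mulrn_wge0// uvs// mem_head.
have [N' N'0 GN'] := nspan_dd_step GN uNv.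
by exists (N * N')%N; rewrite ?muln_gt0 ?N0// mulrnA.
Qed.

End DoubleDescription.

(** * Fans *)

Section Conic.
Variables (F : realFieldType) (n : nat).
Implicit Types (s t : seq 'rV[F]_n) (x y : 'rV[F]_n).

Lemma conic0 s : conic s 0.
Proof. by exists (fun=> 0) => //; rewrite big1// => i _; rewrite scale0r. Qed.

Lemma conicD s x y : conic s x -> conic s y -> conic s (x + y).
Proof.
move=> [l l0 ->] [m m0 ->]; exists (fun i => l i + m i) => [i|].
  exact: addr_ge0.
by rewrite -big_split; apply: eq_bigr => i _; rewrite scalerDl.
Qed.

Lemma conicZ s x c : 0 <= c -> conic s x -> conic s (c *: x).
Proof.
move=> c0 [l l0 ->]; exists (fun i => c * l i) => [i|]; first exact: mulr_ge0.
by rewrite scaler_sumr; apply: eq_bigr => i _; rewrite scalerA.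
Qed.

Lemma conic_mem s x : x \in s -> conic s x.
Proof.
move=> sx; exists (fun i => (i == index x s)%:R) => //.
have xs : (index x s < size s)%N by rewrite index_mem.
rewrite (bigD1 (Ordinal xs))//= eqxx scale1r nth_index// big1 ?addr0// => i.
by rewrite -val_eqE /= => /negPf ->; rewrite scale0r.
Qed.

Lemma conic_cat s t x : conic (s ++ t) x ->
  exists y z, [/\ conic s y, conic t z & x = y + z].
Proof.
move=> [l l0 ->]; exists (\sum_(i < size s) l i *: s`_i),
  (\sum_(i < size t) l (size s + i)%N *: t`_i); split.
- by exists l.
- by exists (fun i => l (size s + i)%N).
rewrite size_cat big_split_ord/=; congr (_ + _); apply: eq_bigr => i _.
  by rewrite nth_cat ltn_ord.
by rewrite nth_cat ltnNge leq_addr/= addKn.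
Qed.

Lemma conic_opp s x : conic (map -%R s) x -> conic s (- x).
Proof.
move=> [l l0 ->]; exists l => //; rewrite size_map -sumrN.
by apply: eq_bigr => i _; rewrite (nth_map 0)// scalerN opprK.
Qed.

End Conic.

Section FanCombinatorics.
Variables (R : realType) (n : nat) (Sigma : set (set 'rV[R]_n)).
Hypothesis hSigma : rational_fan Sigma.

(** An enumeration without repetition makes the cones a finite type, over which products, maxima and
    ranks can be taken. *)
Definition cone_list : seq (set 'rV[R]_n) :=
  undup (projT1 (cid (iffLR (finite_seqP _) (fan_finite hSigma)))).

Definition ncones := size cone_list.

Definition cone (i : 'I_ncones) : set 'rV[R]_n := nth set0 cone_list i.

Lemma cone_listE : Sigma = [set` cone_list].
Proof.
rewrite /cone_list; case: cid => s /= ->.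
by apply/seteqP; split=> x /=; rewrite mem_undup.
Qed.

Lemma coneP i : Sigma (cone i).
Proof. by rewrite [X in X _]cone_listE /=; apply: mem_nth. Qed.

Lemma cone_inj : injective cone.
Proof.
move=> i j /eqP; rewrite nth_uniq ?undup_uniq// => /eqP ij; exact: val_inj.
Qed.

Lemma cone_surj sigma : Sigma sigma -> exists i, sigma = cone i.
Proof.
rewrite [X in X _ -> _]cone_listE /= => ss.
have si : (index sigma cone_list < ncones)%N by rewrite index_mem.
by exists (Ordinal si); rewrite /cone nth_index.
Qed.

Definition cone_le (i j : 'I_ncones) := `[< cone i `<=` cone j >].
Definition dmon (i : 'I_ncones) := dual_monoid (cone i).
Local Notation lv := (@lattice_vec R n).
Local Notation dotr := (@dot R n).

Lemma cone_leP i j : reflect (cone i `<=` cone j) (cone_le i j).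
Proof. exact: asboolP. Qed.

Lemma cone_le_refl i : cone_le i i.
Proof. by apply/cone_leP. Qed.

Lemma cone_le_trans j i k : cone_le i j -> cone_le j k -> cone_le i k.
Proof. by move=> /cone_leP ij /cone_leP jk; apply/cone_leP => x /ij /jk. Qed.

Lemma cone_le_anti i j : cone_le i j -> cone_le j i -> i = j.
Proof.
by move=> /cone_leP ij /cone_leP ji; apply: cone_inj; apply/seteqP.
Qed.

Lemma gens_exist i : exists g : seq 'rV[int]_n,
  forall x, cone i x <-> conic (map lv g) x.
Proof.
have [[L [v ->]] _] := fan_cone hSigma (coneP i); exists (codom v) => x.
have sumE (l : nat -> R) : \sum_(i < size (map lv (codom v))) l i *: (map lv (codom v))`_i =
    \sum_(i < L) l i *: lv (v i).
  rewrite -(big_mkord xpredT (fun i => l i *: (map lv (codom v))`_i)).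
  rewrite size_map size_codom card_ord big_mkord; apply: eq_bigr => k _.
  rewrite (nth_map 0) ?size_codom ?card_ord//; congr (_ *: lv _).
  by rewrite (nth_map k) ?size_enum_ord// nth_ord_enum.
split=> [[a a0 ->]|[l l0 ->]].
  exists (fun k => if insub k is Some j then a j else 0) => [k|].
    by case: insubP.
  rewrite (sumE (fun k => if insub k is Some j then a j else 0)).
  by apply: eq_bigr => k _; rewrite valK.
by rewrite sumE; exists (fun k => l k).
Qed.

Definition gens i := projT1 (cid (gens_exist i)).

Lemma gensP i x : cone i x <-> conic (map lv (gens i)) x.
Proof. by rewrite /gens; case: cid. Qed.

Lemma coneD i x y : cone i x -> cone i y -> cone i (x + y).
Proof. by rewrite !gensP; exact: conicD. Qed.

Lemma coneZ i c x : 0 <= c -> cone i x -> cone i (c *: x).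
Proof. by rewrite !gensP; exact: conicZ. Qed.

Lemma cone0 i : cone i 0.
Proof. by rewrite gensP; exact: conic0. Qed.

Lemma cone_gen i g : g \in gens i -> cone i (lv g).
Proof. by move=> ig; rewrite gensP; apply: conic_mem; exact: map_f. Qed.

Lemma dmonP i u : dmon i u <-> forall g, g \in gens i -> 0 <= dot u g.
Proof.
split=> [iu g /cone_gen/iu|iu x].
  by rewrite pairing_lattice ler0z.
rewrite gensP pairingE => /conic_nonneg; apply => a /mapP[g ig ->].
by rewrite -pairingE pairing_lattice ler0z iu.
Qed.

Lemma dmon0 i : dmon i 0.
Proof. exact: dual_monoid0. Qed.

Lemma dmonD i u v : dmon i u -> dmon i v -> dmon i (u + v).
Proof. exact: dual_monoidD. Qed.

Lemma dmonMn i u m : dmon i u -> dmon i (u *+ m).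
Proof.
move=> iu; elim: m => [|m IH]; first by rewrite mulr0n; exact: dmon0.
by rewrite mulrS; exact: dmonD.
Qed.

Lemma dmon_le i j u : cone_le i j -> dmon j u -> dmon i u.
Proof. by move=> /cone_leP ij ju x /ij; exact: ju. Qed.

Definition bary i := \sum_(g <- gens i) g.

Lemma bary_cone i : cone i (lv (bary i)).
Proof.
rewrite /bary; have: {subset gens i <= gens i} by [].
elim: {1 3}(gens i) => [_|g s IH sg].
  rewrite big_nil (_ : lv 0 = 0); first exact: cone0.
  by apply/rowP => k; rewrite !mxE.
rewrite big_cons lattice_vecD; apply: coneD.
  by apply: cone_gen; apply: sg; rewrite mem_head.
by apply: IH => h hs; apply: sg; rewrite inE hs orbT.
Qed.

Lemma bary_le_cone k i : cone_le k i -> cone i (lv (bary k)).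
Proof. by move=> /cone_leP; apply; exact: bary_cone. Qed.

Lemma bary_ge0 k i u : cone_le k i -> dmon i u -> 0 <= dot u (bary k).
Proof. by move=> /bary_le_cone ki iu; rewrite -(ler0z R) -pairing_lattice iu. Qed.

(** The pairing with [bary i] is a sum of nonnegative pairings with generators, so all of them
    vanish. This is how [bary i] plays the role of a relative interior point. *)
Lemma bary_eq0 i u : dmon i u -> dot u (bary i) = 0 ->
  forall x, cone i x -> dotr (lv u) x = 0.
Proof.
move=> iu; rewrite dot_sumr => /eqP.
rewrite big_seq psumr_eq0 => [|g ig]; last by move/dmonP : iu; apply.
move=> /allP u0 x; rewrite gensP => -[l l0 ->]; rewrite dot_sumr big1// => k _.
have kg : (k < size (gens i))%N by rewrite -(size_map lv).
rewrite dotZr (nth_map 0)// -pairingE pairing_lattice.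
have /u0 := mem_nth 0 kg; rewrite mem_nth//= => /eqP ->.
by rewrite mulr0.
Qed.

Lemma bary_eq0N i u : dmon i u -> dot u (bary i) = 0 -> dmon i (- u).
Proof.
by move=> iu u0 x /(bary_eq0 iu u0) ux; rewrite lattice_vecN pairingE dotNl ux oppr0.
Qed.

Lemma bary_eq0_le k i u : cone_le k i -> dmon i u -> dot u (bary i) = 0 ->
  dot u (bary k) = 0.
Proof.
move=> ki iu /(bary_eq0 iu) /(_ _ (bary_le_cone ki)).
by rewrite -pairingE pairing_lattice => /eqP; rewrite intr_eq0 => /eqP.
Qed.

Lemma dmonN_bary i u : dmon i u -> dmon i (- u) -> dot u (bary i) = 0.
Proof.
move=> iu iNu; apply/eqP; rewrite eq_le (bary_ge0 (cone_le_refl i) iu) andbT.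
by rewrite -oppr_ge0 -dotNl (bary_ge0 (cone_le_refl i) iNu).
Qed.

Definition exposes u (i j : 'I_ncones) :=
  dmon j u /\ forall x, cone i x <-> cone j x /\ dotr (lv u) x = 0.

Lemma exposes_le u i j : exposes u i j -> cone_le i j.
Proof. by move=> [_ uij]; apply/cone_leP => x /uij[]. Qed.

Lemma exposes_opp u i j : exposes u i j -> dmon i (- u).
Proof.
by move=> [_ uij] x /uij[_ ux]; rewrite lattice_vecN pairingE dotNl ux oppr0.
Qed.

Lemma exposes_bary u i j k : exposes u i j -> cone_le k j ->
  dot u (bary k) = 0 <-> cone_le k i.
Proof.
move=> [ju uij] kj; split=> [u0|ki].
  apply/cone_leP => x kx; apply/uij; split; first by move/cone_leP: kj; apply.
  exact: (bary_eq0 (dmon_le kj ju)).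
have /uij[_] := bary_le_cone ki.
by rewrite -pairingE pairing_lattice => /eqP; rewrite intr_eq0 => /eqP.
Qed.

(** The dual monoid of a face is the localization at the exposing character: [u] is at least 1 on
    every generator outside of the face, so a multiple of it dominates all negative pairings of [a].
    The chosen [N] is the sum of all |<a,g>|. *)
Lemma exposes_shift u i j a : exposes u i j -> dmon i a ->
  exists N, dmon j (a + u *+ N).
Proof.
move=> [/dmonP ju uij] /dmonP ia; exists (\sum_(g <- gens j) `|dot a g|)%N.
apply/dmonP => g jg; rewrite dotDl dotMnl.
have [ug|ug] := eqVneq (dot u g) 0.
  rewrite ug mul0rn addr0.
  have : cone i (lv g).
    apply/uij; split; first exact: cone_gen.
    by rewrite -pairingE pairing_lattice ug.
  rewrite -(ler0z R) -pairing_lattice; exact: (dmonP i a).2.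
have u1 : 1 <= dot u g by have := ju _ jg; lia.
rewrite (big_rem g)//= mulrnDr.
have : 0 <= dot u g *+ \sum_(y <- rem g (gens j)) `|dot a y| by rewrite mulrn_wge0// ju.
have : `|dot a g|%:Z <= dot u g *+ `|dot a g|%N.
  by rewrite -mulr_natl natz -[leLHS]mulr1 ler_wpM2l.
lia.
Qed.

Lemma face_exposed u j : dmon j u -> exists i, exposes u i j.
Proof.
move=> ju; have : is_face (cone j `&` [set v | pairing (lv u) v = 0]) (cone j).
  by exists (lv u).
move=> /(fan_face hSigma (coneP j))/cone_surj[i iE]; exists i; split => // x.
by rewrite -iE.
Qed.

Lemma meet_exist i j : exists k, cone k = cone i `&` cone j.
Proof.
have [fi _] := fan_meet hSigma (coneP i) (coneP j).
by have /cone_surj[k ->] := fan_face hSigma (coneP i) fi; exists k.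
Qed.

Definition meet i j := projT1 (cid (meet_exist i j)).

Lemma meetE i j : cone (meet i j) = cone i `&` cone j.
Proof. by rewrite /meet; case: cid. Qed.

Lemma meet_lel i j : cone_le (meet i j) i.
Proof. by apply/cone_leP; rewrite meetE => x []. Qed.

Lemma meet_ler i j : cone_le (meet i j) j.
Proof. by apply/cone_leP; rewrite meetE => x []. Qed.

Lemma le_meet k i j : cone_le k i -> cone_le k j -> cone_le k (meet i j).
Proof.
move=> /cone_leP ki /cone_leP kj; apply/cone_leP; rewrite meetE => x kx.
by split; [exact: ki|exact: kj].
Qed.

(** The intersection is a face of the cone [i], and [g + a] lies in it with both summands in the
    cone [i]; a face contains the summands of its elements, so [g] lies in the cone [j]. *)
Lemma half_separation i j u : dmon i u ->
  (forall g, g \in gens i -> dot u g = 0 ->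
     exists2 a, cone i a & cone j (lv g + a)) ->
  forall x, cone i x -> dotr (lv u) x = 0 -> cone j x.
Proof.
move=> /dmonP iu ug x; rewrite gensP => -[l l0 ->]; rewrite dot_sumr => /eqP.
have ls k : (k < size (map lv (gens i)))%N -> (map lv (gens i))`_k = lv (gens i)`_k.
  by move=> ks; rewrite (nth_map 0)// -(size_map lv).
have gk k : (k < size (map lv (gens i)))%N -> (gens i)`_k \in gens i.
  by rewrite size_map => ks; exact: mem_nth.
rewrite psumr_eq0 => [|k _]; last first.
  rewrite dotZr mulr_ge0// ls// -pairingE pairing_lattice ler0z iu//.
  by apply: gk.
move=> /allP u0; apply: big_ind => [|y z|k _]; [exact: cone0|exact: coneD|].
have /u0/= := mem_index_enum k; rewrite dotZr mulf_eq0 => /orP[/eqP->|].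
  by rewrite scale0r; exact: cone0.
rewrite ls// -pairingE pairing_lattice intr_eq0 => /eqP ugk.
apply: coneZ => //.
have [a ia jga] := ug _ (gk _ (ltn_ord k)) ugk.
have [w wi wE] : is_face (cone i `&` cone j) (cone i).
  by have [] := fan_meet hSigma (coneP i) (coneP j).
have ig : cone i (lv (gens i)`_k) by apply: cone_gen; exact: gk.
have : (cone i `&` cone j) (lv (gens i)`_k + a) by split => //; exact: coneD.
rewrite wE => -[_ /=]; rewrite pairingE dotDr => /eqP.
rewrite paddr_eq0 ?wi//.
move=> /andP[/eqP wg _].
have : (cone i `&` cone j) (lv (gens i)`_k) by rewrite wE.
by case.
Qed.

(** Separation lemma: [u] is a relative interior point of the dual of the difference of the two
    cones. If it kills a generator g of the cone [i], then -g = y - z with y, z in the cones [i],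
    [j], so g + y = z is in the cone [j] and [half_separation] applies; symmetrically for [j]. *)
Lemma separation i j :
  exists u, exposes u (meet i j) i /\ exposes (- u) (meet i j) j.
Proof.
have [u us u0] := strict_separation R (gens i ++ map -%R (gens j)).
have iu : dmon i u by apply/dmonP => g ig; rewrite us// mem_cat ig.
have ju : dmon j (- u).
  apply/dmonP => g jg; rewrite dotNl -dotNr us// mem_cat map_f ?orbT//.
have lvN (s : seq 'rV[int]_n) : map lv (map -%R s) = map -%R (map lv s).
  by rewrite -!map_comp; apply: eq_map => g /=; rewrite lattice_vecN.
have dec x : conic (map lv (gens i ++ map -%R (gens j))) x ->
    exists y z, [/\ cone i y, cone j z & x = y - z].
  rewrite map_cat lvN => /conic_cat[y [z [iy jz ->]]]; exists y, (- z).
  by rewrite opprK; split => //; rewrite gensP//; exact: conic_opp.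
have ij : forall x, cone i x -> dotr (lv u) x = 0 -> cone j x.
  apply: half_separation => // g ig /u0; rewrite mem_cat ig => /(_ isT).
  move=> /dec[y [z [iy jz /eqP]]]; rewrite eq_sym subr_eq => /eqP yE.
  by exists y => //; rewrite yE addNKr.
have ji : forall x, cone j x -> dotr (lv (- u)) x = 0 -> cone i x.
  apply: half_separation => // g jg; rewrite dotNl -dotNr => /u0.
  rewrite mem_cat map_f ?orbT// => /(_ isT) /dec[y [z [iy jz]]].
  rewrite lattice_vecN opprK => ->; exists z => //; by rewrite subrK.
exists u; split; split => // x; rewrite meetE; split.
- move=> [ix jx]; split => //; apply/eqP; rewrite eq_le (iu _ ix) andbT.
  by rewrite -oppr_ge0 -dotNl -lattice_vecN (ju _ jx).
- by move=> [ix ux]; split => //; exact: ij.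
- move=> [ix jx]; split => //; apply/eqP; rewrite eq_le (ju _ jx) andbT.
  by rewrite lattice_vecN dotNl oppr_le0 (iu _ ix).
- by move=> [jx ux]; split => //; exact: ji.
Qed.

Definition sep i j := projT1 (cid (separation i j)).

Lemma sepl i j : exposes (sep i j) (meet i j) i.
Proof. by rewrite /sep; case: cid => u []. Qed.

Lemma sepr i j : exposes (- sep i j) (meet i j) j.
Proof. by rewrite /sep; case: cid => u []. Qed.

Lemma le_exposed i j : cone_le i j -> exists u, exposes u i j.
Proof.
move=> ij; exists (sep j i); have := sepl j i; suff -> : meet j i = i by [].
by apply: cone_le_anti; [exact: meet_ler|apply: le_meet => //; exact: cone_le_refl].
Qed.

(** By Farkas [bary k] lies in the cone [i], hence in the face of the cone [k] cut out by [i]; a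
    face through the barycenter is the whole cone. *)
Lemma bary_le k i : (forall u, dmon i u -> 0 <= dot u (bary k)) -> cone_le k i.
Proof.
move=> ki; have : conic (map lv (gens i)) (lv (bary k)).
  by apply: integral_farkas => u /dmonP/ki.
rewrite -gensP => ib.
have [u ue] := le_exposed (meet_lel k i).
suff : cone_le k (meet k i) by move/cone_le_trans; apply; exact: meet_ler.
apply/(exposes_bary ue (cone_le_refl k)).
have /ue.2[_] : cone (meet k i) (lv (bary k)).
  by rewrite meetE; split => //; exact: bary_cone.
by rewrite -pairingE pairing_lattice => /eqP; rewrite intr_eq0 => /eqP.
Qed.

Lemma dmon_fingen i : exists G : seq 'rV[int]_n,
  (forall g, g \in G -> dmon i g) /\
  forall u, dmon i u -> exists2 N, (0 < N)%N & nspan [set` G] (u *+ N).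
Proof.
have [G [Gi iG]] := double_description (gens i); exists G; split.
  by move=> g /Gi gi; apply/dmonP.
by move=> u /dmonP; exact: iG.
Qed.

(* The lattice orthogonal to a cone is saturated, hence a direct summand: the
   projection is read off the Smith normal form of the matrix of generators. *)
Lemma perp_projection i : exists p : 'rV[int]_n -> 'rV[int]_n,
  [/\ forall u v, p (u + v) = p u + p v,
      forall u, dmon i (p u) /\ dmon i (- p u) &
      forall u, dmon i u -> dmon i (- u) -> p u = u].
Proof.
pose A := \matrix_(k < n, l < size (gens i)) (gens i)`_l 0 k.
have AE u : (dmon i u /\ dmon i (- u)) <-> u *m A = 0.
  have uA l : (u *m A) 0 l = dot u (gens i)`_l.
    by rewrite !mxE; apply: eq_bigr => k _; rewrite mxE.
  split=> [[/dmonP iu /dmonP iNu]|uA0].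
    apply/rowP => l; rewrite uA mxE; apply/eqP; rewrite eq_le iu ?mem_nth// andbT.
    by rewrite -oppr_ge0 -dotNl iNu ?mem_nth.
  have u0 g : g \in gens i -> dot u g = 0.
    move=> ig; have gs : (index g (gens i) < size (gens i))%N by rewrite index_mem.
    by have := uA (Ordinal gs); rewrite uA0 mxE /= nth_index.
  by split; apply/dmonP => g /u0 ug; rewrite ?dotNl ug ?oppr0.
have [L Lu [Q Qu [d _ AD]]] := int_Smith_normal_form A.
(* [D] is the diagonal Smith form, and [E] below selects the coordinates whose row in [D] vanishes:
   it projects onto the left kernel of [D]. *)
pose D : 'M[int]_(n, size (gens i)) := \matrix_(k, l) (d`_k *+ (k == l :> nat)).
pose E : 'M[int]_n := \matrix_(k, l) ((k == l) && [forall m, D k m == 0])%:R.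
have ED : E *m D = 0.
  apply/matrixP => k m; rewrite !mxE big1// => l _; rewrite [E _ _]mxE.
  case: andP => [[/eqP <- /forallP/(_ m)/eqP ->]|_]; first by rewrite mulr0.
  by rewrite mul0r.
have EK (w : 'rV[int]_n) : w *m D = 0 -> w *m E = w.
  move=> wD; apply/rowP => l; rewrite !mxE (bigD1 l)//= [E _ _]mxE eqxx /=.
  rewrite big1 => [|k kl]; last by rewrite mxE (negPf kl) mulr0.
  rewrite addr0; case: forallP => [_|nz]; first by rewrite mulr1.
  rewrite mulr0; apply/esym/eqP/negP => /negP wl; apply: nz => m.
  have [lm|lm] := eqVneq (l : nat) m; last by rewrite mxE (negPf lm) mulr0n.
  move/rowP/(_ m) : wD; rewrite [LHS]mxE [RHS]mxE (bigD1 l)//= big1 => [|k kl].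
    by rewrite addr0 => /eqP; rewrite mulf_eq0 (negPf wl).
  by rewrite [D _ _]mxE -lm val_eqE (negPf kl) mulr0n mulr0.
exists (fun u => u *m L *m E *m invmx L); split=> [u v|u|u iu iNu].
- by rewrite !mulmxDl.
- by apply/AE; rewrite AD -!mulmxA mulKmx// (mulmxA E) ED mul0mx !mulmx0.
have /AE uA : dmon i u /\ dmon i (- u) by [].
rewrite EK ?mulmxK//; apply: (can_inj (mulmxK Qu)).
by rewrite mul0mx -uA AD !mulmxA.
Qed.

End FanCombinatorics.

Arguments dmon0 {R n Sigma hSigma} i.

(** * Points and their values at characters *)

Lemma initial_topology_cvg (S : choiceType) (T : topologicalType) (f : S -> T)
    (F : set_system (initial_topology f)) (s : initial_topology f) :
  Filter F -> f @ F --> f s -> F --> s.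
Proof.
move=> FF Ffs A; rewrite nbhsE => -[B [[C oC <-] Cs] BA].
by apply: filterS BA _; apply: Ffs; exact: open_nbhs_nbhs.
Qed.

Lemma cvg_expr (K : numFieldType) (T : Type) (F : set_system T) (f : T -> K^o)
    {FF : Filter F} (a : K^o) m :
  f @ F --> a -> (fun x => f x ^+ m : K^o) @ F --> a ^+ m.
Proof.
move=> fa; elim: m => [|m IH]; first exact: cvg_cst.
rewrite exprS (_ : (fun x => _) = (fun x => f x * f x ^+ m)).
  exact: (cvgM fa IH).
by apply/funext => x; rewrite exprS.
Qed.

Section ToricPoints.
Variables (R : realType) (k : base) (n : nat) (Sigma : set (set 'rV[R]_n)).
Hypothesis hSigma : rational_fan Sigma.

Local Notation cone := (@cone R n Sigma hSigma).
Local Notation I := 'I_(ncones hSigma).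
Local Notation dmon := (@dmon R n Sigma hSigma).
Local Notation cone_le := (@cone_le R n Sigma hSigma).
Local Notation meet := (@meet R n Sigma hSigma).
Local Notation sep := (@sep R n Sigma hSigma).
Local Notation exposes := (@exposes R n Sigma hSigma).
Local Notation X := (toric_variety k Sigma).
Local Notation C := (R[i]^o).

(** Made total by the value 0 outside of the dual monoid, so that values in different charts are
    compared at the same [u] without transporting membership proofs. *)
Definition cval (s : set 'rV[R]_n) (phi : chart k s) (u : 'rV[int]_n) : C :=
  if pselect (dual_monoid s u) is left su
  then chart_fun phi (SigSub (mem_set su)) else 0.

Section Cval.
Variables (s : set 'rV[R]_n) (phi : chart k s).

Lemma cval_val a : cval phi (set_val a) = chart_fun phi a.
Proof.
rewrite /cval; case: pselect => [sa|[]]; last exact: set_valP.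
by congr (chart_fun phi); exact: val_inj.
Qed.

Lemma cvalE u (su : dual_monoid s u) :
  cval phi u = chart_fun phi (SigSub (mem_set su)).
Proof. by rewrite -cval_val. Qed.

Lemma cvalD u v : dual_monoid s u -> dual_monoid s v ->
  cval phi (u + v) = cval phi u * cval phi v.
Proof.
move=> su sv; have [_ _ pD] := chartP phi.
rewrite (cvalE su) (cvalE sv) (cvalE (dual_monoidD su sv)); exact: pD.
Qed.

Lemma cval0 : cval phi 0 = 1.
Proof.
by rewrite (cvalE (@dual_monoid0 R n s)); have [_ p0 _] := chartP phi; exact: p0.
Qed.

Lemma cval_base u : dual_monoid s u -> base_set k (cval phi u).
Proof. by move=> su; rewrite (cvalE su); have [] := chartP phi. Qed.

Lemma cvalMn u m : dual_monoid s u -> cval phi (u *+ m) = cval phi u ^+ m.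
Proof.
move=> su; elim: m => [|m IH]; first by rewrite mulr0n cval0.
rewrite mulrS cvalD// ?IH ?exprS//; elim: m {IH} => [|m IH].
  by rewrite mulr0n; exact: dual_monoid0.
by rewrite mulrS; exact: dual_monoidD.
Qed.

End Cval.

Lemma cval_continuous (s : set 'rV[R]_n) u :
  continuous (fun phi : chart k s => cval phi u).
Proof.
rewrite /cval; case: pselect => [su|_]; last exact: cst_continuous.
exact: (@ptws_eval_continuous _ _ (@chart_pred R k n s)).
Qed.

Lemma cval_cvg (s : set 'rV[R]_n) (F : set_system (chart k s)) (phi : chart k s) :
  Filter F -> (forall u, dual_monoid s u -> (fun psi => cval psi u) @ F --> cval phi u) ->
  F --> phi.
Proof.
move=> FF Fu; apply: (@initial_topology_cvg _ _
  (set_val : @chart_pred R k n s -> {ptws dual_monoid s -> C})).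
apply/cvg_sup => a.
apply: (@initial_topology_cvg _ _ (fun g : dual_monoid s -> C => g a)).
have := Fu _ (set_valP a); rewrite cval_val.
rewrite (_ : (fun psi : chart k s => _) = fun psi => chart_fun psi a)//.
by apply/funext => psi; rewrite cval_val.
Qed.

Lemma make_chart (s : set 'rV[R]_n) (h : 'rV[int]_n -> C) : h 0 = 1 ->
  (forall u, dual_monoid s u -> base_set k (h u)) ->
  (forall u v, dual_monoid s u -> dual_monoid s v -> h (u + v) = h u * h v) ->
  exists phi : chart k s, forall u, dual_monoid s u -> cval phi u = h u.
Proof.
move=> h0 hk hD.
have hP : chart_pred k (fun a : dual_monoid s => h (set_val a)).
  split=> [a|a ->//|a b c ->]; first exact/hk/set_valP.
  by apply: hD; exact: set_valP.
exists (SigSub (mem_set hP)) => u su; by rewrite (cvalE _ su).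
Qed.

(* The value of a point at a character u = a - b of M, defined as soon as b does
   not vanish at the point; it does not depend on the chart. *)
Definition vrel (x : chart_sum k Sigma) u (c : C) := exists a b,
  [/\ dual_monoid (set_val (projT1 x)) a, dual_monoid (set_val (projT1 x)) b,
      u = a - b, cval (projT2 x) b != 0 & c = cval (projT2 x) a / cval (projT2 x) b].

Lemma vrel_fun x u c c' : vrel x u c -> vrel x u c' -> c = c'.
Proof.
move=> [a [b [xa xb -> b0 ->]]] [a' [b' [xa' xb' ab b'0 ->]]].
apply/eqP; rewrite eqr_div// -!cvalD//; apply/eqP; congr (cval _ _).
by move/eqP : ab; rewrite subr_eq addrAC eq_sym subr_eq => /eqP.
Qed.

Definition fan_index (i : I) : Sigma := SigSub (mem_set (coneP i)).

Lemma fan_index_surj (s : Sigma) : exists i, s = fan_index i.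
Proof.
have [i sE] := cone_surj hSigma (set_valP s); exists i; exact: val_inj.
Qed.

Definition inc i (phi : chart k (cone i)) : X :=
  toric_point (existT (fun s : Sigma => chart k (set_val s)) (fan_index i) phi).

Lemma inc_surj (x : X) : exists i phi, x = @inc i phi.
Proof.
have xE : x = toric_point (repr (x : {eq_quot glue_equiv k Sigma})).
  by rewrite /toric_point reprK.
case: (repr _) xE => s phi ->; have [i si] := fan_index_surj s.
by subst s; exists i, phi.
Qed.

(** A character [w] exposing the face is invertible on the chart of the face. Numerator and
    denominator of a fraction over the face are shifted by the same multiple of [w] into the dual
    monoid of the larger cone, which does not change the quotient. *)
Lemma glue_step_vrel x y u c : glue_step x y -> vrel x u c <-> vrel y u c.
Proof.
case: x y => s psi [t phi] [/= st E]; have [i si] := fan_index_surj s.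
have [j tj] := fan_index_surj t; subst s t.
have ij : cone_le i j.
    apply/cone_leP => v iv; case: st => w _ stE.
    by have : set_val (fan_index i) v by []; rewrite stE => -[].
have [w we] := le_exposed ij; have jw := we.1.
have E' v : dmon j v -> cval psi v = cval phi v.
  move=> jv; rewrite (cvalE _ jv) (cvalE _ (dmon_le ij jv)); exact: E.
have w0 : cval phi w != 0.
  rewrite -E'//; apply/eqP => w0; have iw := dmon_le ij jw.
  have := cvalD psi iw (exposes_opp we).
  by rewrite subrr cval0 w0 mul0r => /eqP; rewrite oner_eq0.
split=> -[a [b [/= xa xb -> b0 ->]]]; last first.
  by exists a, b; rewrite /= !E'//; split => //; exact: dmon_le ij _.
have [N aN] := exposes_shift we xa; have [N' bN'] := exposes_shift we xb.
have aNN : dmon j (a + w *+ (N + N')).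
  by rewrite mulrnDr addrA; apply: dmonD => //; exact: dmonMn.
have bNN : dmon j (b + w *+ (N + N')).
  by rewrite addnC mulrnDr addrA; apply: dmonD => //; exact: dmonMn.
have iw : dmon i (w *+ (N + N')) by apply: dmon_le ij _; exact: dmonMn.
have w0' : cval psi (w *+ (N + N')) != 0.
  by rewrite E' ?cvalMn ?expf_neq0//; exact: dmonMn.
exists (a + w *+ (N + N')), (b + w *+ (N + N')).
rewrite /= -!E'// !cvalD// mulf_neq0// -mulf_div divff// mulr1; split => //.
by rewrite addrAC opprD addrA addrAC subrr add0r -addrA addrC subrK || 
   by rewrite opprD addrACA subrr addr0.
Qed.

Lemma glue_vrel x y u c : Defs.glue x y -> vrel x u c <-> vrel y u c.
Proof.
move=> /asboolP; elim=> {x y}[x y|x|x y _ ->|x y z _ -> _ ->]//.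
exact: glue_step_vrel.
Qed.

Definition pval (x : X) u c := vrel (repr (x : {eq_quot glue_equiv k Sigma})) u c.

Lemma pval_inc i phi u c : pval (@inc i phi) u c <->
  vrel (existT (fun s : Sigma => chart k (set_val s)) (fan_index i) phi) u c.
Proof. by apply: glue_vrel; apply/toric_pointP; exact: reprK. Qed.

Definition dom (x : X) u := exists c, pval x u c.

Definition ev (x : X) u : C := xget 0 (pval x u).

Lemma evP x u c : pval x u c -> dom x u /\ ev x u = c.
Proof.
move=> xuc; split; first by exists c.
by apply: (@xget_unique _ _ _ c) => // c' /vrel_fun; exact.
Qed.

Lemma ev_inc i phi u : dmon i u ->
  dom (@inc i phi) u /\ ev (inc phi) u = cval phi u.
Proof.
move=> iu; apply: evP; apply/pval_inc; exists u, 0; rewrite /= cval0 subr0 divr1.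
by split => //; first [exact: dual_monoid0|exact: oner_neq0].
Qed.

Lemma dom_incP i phi u : dom (@inc i phi) u <->
  exists a b, [/\ dmon i a, dmon i b, u = a - b & cval phi b != 0].
Proof.
split=> [[c /pval_inc[a [b [ia ib ub b0 _]]]]|[a [b [ia ib ub b0]]]].
  by exists a, b.
exists (cval phi a / cval phi b); apply/pval_inc; by exists a, b.
Qed.

Lemma dom0 x : dom x 0.
Proof.
have [i [phi ->]] := inc_surj x; exact: (ev_inc phi (dmon0 i)).1.
Qed.

Lemma ev0 x : ev x 0 = 1.
Proof.
have [i [phi ->]] := inc_surj x; by rewrite (ev_inc phi (dmon0 i)).2 cval0.
Qed.

Lemma ev_add x u v : dom x u -> dom x v ->
  dom x (u + v) /\ ev x (u + v) = ev x u * ev x v.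
Proof.
have [i [phi ->]] := inc_surj x.
move=> [c cu] [d dv]; rewrite (evP cu).2 (evP dv).2; apply: evP.
move: cu dv => /pval_inc[a [b [/= ia ib -> b0 ->]]].
move=> /pval_inc[a' [b' [/= ia' ib' -> b'0 ->]]].
apply/pval_inc; exists (a + a'), (b + b') => /=.
rewrite !cvalD// mulf_neq0// mulf_div opprD addrACA.
by split => //; exact: dual_monoidD.
Qed.

Lemma domD x u v : dom x u -> dom x v -> dom x (u + v).
Proof. by move=> xu xv; have [] := ev_add xu xv. Qed.

Lemma evD x u v : dom x u -> dom x v -> ev x (u + v) = ev x u * ev x v.
Proof. by move=> xu xv; have [] := ev_add xu xv. Qed.

Lemma domMn x u m : dom x u -> dom x (u *+ m).
Proof.
move=> xu; elim: m => [|m IH]; first by rewrite mulr0n; exact: dom0.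
by rewrite mulrS; exact: domD.
Qed.

Lemma evMn x u m : dom x u -> ev x (u *+ m) = ev x u ^+ m.
Proof.
move=> xu; elim: m => [|m IH]; first by rewrite mulr0n ev0.
by rewrite mulrS evD ?IH ?exprS//; exact: domMn.
Qed.

Lemma dom_opp x u : dom x u -> ev x u != 0 -> dom x (- u).
Proof.
have [i [phi ->]] := inc_surj x.
move=> [c cu]; rewrite (evP cu).2; move: cu => /pval_inc[a [b [/= ia ib -> b0 ->]]].
rewrite mulf_eq0 negb_or => /andP[a0 _].
by apply/dom_incP; exists b, a; rewrite opprB.
Qed.

Lemma evN x u : dom x u -> dom x (- u) -> ev x u * ev x (- u) = 1.
Proof. by move=> xu xNu; rewrite -evD// subrr ev0. Qed.

Lemma ev_neq0 x u : dom x u -> dom x (- u) -> ev x u != 0.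
Proof.
move=> xu xNu; apply/eqP => u0; have := evN xu xNu.
by rewrite u0 mul0r => /eqP; rewrite eq_sym oner_eq0.
Qed.

Lemma ev_base x u : dom x u -> base_set k (ev x u).
Proof.
have [i [phi ->]] := inc_surj x.
move=> [c cu]; rewrite (evP cu).2; move: cu => /pval_inc[a [b [/= ia ib _ _ ->]]].
apply: base_setM; first exact: cval_base.
move: (cval_base phi ib); move: (cval phi b) => z.
by case: (k) => //= z0; [rewrite realV|rewrite invr_ge0].
Qed.

(** Membership in the open chart of the cone [i], phrased through values alone; [inX_chart] recovers
    an actual point of the chart. *)
Definition inX i (x : X) := dmon i `<=` dom x.

Lemma inX_inc i phi : inX i (@inc i phi).
Proof. by move=> u /(ev_inc phi)[]. Qed.

Lemma inX_ex x : exists i, inX i x.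
Proof. by have [i [phi ->]] := inc_surj x; exists i; exact: inX_inc. Qed.

Lemma inX_le i j x : cone_le i j -> inX i x -> inX j x.
Proof. by move=> ij xi u /(dmon_le ij)/xi. Qed.

Lemma inX_exposed u i j x : exposes u i j -> inX j x -> ev x u != 0 -> inX i x.
Proof.
move=> ue xj u0 a ia; have [N jaN] := exposes_shift ue ia.
rewrite -[a](addrK (u *+ N)) -mulNrn; apply: domD; first exact: xj.
by apply/domMn/dom_opp => //; apply: xj; case: ue.
Qed.

Lemma sep_neq0 i j x : inX i x -> inX j x -> ev x (sep i j) != 0.
Proof.
move=> xi xj; apply: ev_neq0; first exact: xi (sepl i j).1.
exact: xj (sepr i j).1.
Qed.

Lemma inX_meet i j x : inX i x -> inX j x -> inX (meet i j) x.
Proof.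
by move=> xi xj; apply: (inX_exposed (sepl i j)) => //; exact: sep_neq0.
Qed.

Lemma inX_sep i j x : inX i x -> ev x (sep i j) != 0 -> inX j x.
Proof.
move=> xi s0; apply: inX_le (meet_ler i j) _; exact: inX_exposed (sepl i j) _ _.
Qed.

Lemma make_point i (h : 'rV[int]_n -> C) : h 0 = 1 ->
  (forall u, dmon i u -> base_set k (h u)) ->
  (forall u v, dmon i u -> dmon i v -> h (u + v) = h u * h v) ->
  exists x : X, inX i x /\ forall u, dmon i u -> ev x u = h u.
Proof.
move=> h0 hk hD; have [phi phiE] := make_chart h0 hk hD.
exists (inc phi); split; first exact: inX_inc.
by move=> u iu; rewrite (ev_inc phi iu).2 phiE.
Qed.

Lemma inc_restr i j (psi : chart k (cone i)) (phi : chart k (cone j)) :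
  cone_le i j -> (forall u, dmon j u -> cval psi u = cval phi u) ->
  inc psi = inc phi.
Proof.
move=> ij E; apply/toric_pointP/asboolP; apply: Relation_Operators.rst_step.
split=> [|a b ab] /=.
  have [w [jw we]] := le_exposed ij; exists (lattice_vec R w) => //.
  by apply/seteqP; split => v /we.
by rewrite -!cval_val ab E//; exact: set_valP.
Qed.

(** The values of [x] define points of the chart [i] and of the chart of the meet with the cone [j]
    where [x] was given; the point over the meet is glued to both others. *)
Lemma inX_chart i x : inX i x -> exists phi, x = @inc i phi.
Proof.
have [j [psi xE]] := inc_surj x => xi.
have xj : inX j x by rewrite xE; exact: inX_inc.
have [|u iu|u v iu iv|phi phiE] := @make_chart (cone i) (ev x).
- exact: ev0.
- exact/ev_base/xi.
- by apply: evD; exact: xi.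
have xm := inX_meet xi xj.
have [|u iu|u v iu iv|chi chiE] := @make_chart (cone (meet i j)) (ev x).
- exact: ev0.
- exact/ev_base/xm.
- by apply: evD; exact: xm.
exists phi; rewrite -(inc_restr (meet_lel i j) (psi := chi)) => [|u iu].
  rewrite {1}xE; apply/esym/inc_restr => [|u ju]; first exact: meet_ler.
  by rewrite chiE ?xE ?(ev_inc psi ju).2//; exact: dmon_le (meet_ler i j) ju.
by rewrite chiE ?phiE//; exact: dmon_le (meet_lel i j) iu.
Qed.

Lemma ev_inj i x y : inX i x -> inX i y ->
  (forall u, dmon i u -> ev x u = ev y u) -> x = y.
Proof.
move=> /inX_chart[phi ->] /inX_chart[psi ->] E; apply: inc_restr.
  exact: cone_le_refl.
by move=> u iu; have := E _ iu; rewrite !(ev_inc _ iu).2.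
Qed.

Lemma toric_openP (U : set X) : open U <-> forall i, open (@inc i @^-1` U).
Proof.
have -> : open U = open ((\pi_({eq_quot glue_equiv k Sigma})) @^-1` U) by [].
rewrite sigT_openP; split=> [oU i|oU s]; first exact: (oU (fan_index i)).
by have [i ->] := fan_index_surj s; exact: oU.
Qed.

Lemma inX_open i : open (inX i).
Proof.
apply/toric_openP => j.
have -> : @inc j @^-1` inX i = [set phi | cval phi (sep j i) != 0].
  apply/seteqP; split => phi /=.
    by rewrite -(ev_inc phi (sepl j i).1).2; apply: sep_neq0; exact: inX_inc.
  rewrite -(ev_inc phi (sepl j i).1).2; apply: inX_sep; exact: inX_inc.
have -> : [set phi : chart k (cone j) | cval phi (sep j i) != 0] =
    (fun phi => cval phi (sep j i)) @^-1` (~` [set 0]).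
  by apply/seteqP; split => phi /= /eqP.
apply: open_comp => [phi _|]; first exact: cval_continuous.
apply: closed_openC; apply: accessible_closed_set1; apply: hausdorff_accessible.
exact: norm_hausdorff.
Qed.

Lemma inX_near i x : inX i x -> \forall y \near x, inX i y.
Proof. by move=> xi; apply: open_nbhs_nbhs; split => //; exact: inX_open. Qed.

(** In another chart [j], the character [u] is the difference of [u + sep j i *+ N] and
    [sep j i *+ N], both in the dual monoid of [j]; so its value is a quotient of continuous
    functions with invertible denominator. *)
Lemma ev_open i u (W : set C) : dmon i u -> open W ->
  open [set x | inX i x /\ W (ev x u)].
Proof.
move=> iu oW; apply/toric_openP => j.
have su := dmon_le (meet_ler j i) iu.
have [N jN] := exposes_shift (sepl j i) su; have js := (sepl j i).1.
have E phi : inX i (@inc j phi) ->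
    ev (inc phi) u = cval phi (u + sep j i *+ N) / cval phi (sep j i) ^+ N.
  move=> xi; have xj := @inX_inc j phi; have s0 := sep_neq0 xj xi.
  have [_ sE] := ev_inc phi js; have [_ uE] := ev_inc phi jN.
  rewrite -sE -uE evD ?evMn ?mulfK ?expf_neq0//.
  - exact: xj.
  - exact: xi.
  - by apply: domMn; exact: xj.
rewrite openE => phi [xi Wx]; rewrite /interior.
have cE : {for phi, continuous (fun phi => cval phi (u + sep j i *+ N) /
    cval phi (sep j i) ^+ N : C)}.
  have c1 : {for phi, continuous (fun phi : chart k (cone j) =>
      cval phi (u + sep j i *+ N))} by exact: cval_continuous.
  have c2 : {for phi, continuous (fun phi : chart k (cone j) =>
      cval phi (sep j i))} by exact: cval_continuous.
  have c3 := cvg_expr (m := N) (FF := nbhs_filter phi) c2.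
  have s0 : cval phi (sep j i) ^+ N != 0.
    rewrite expf_neq0// -(ev_inc phi js).2; apply: sep_neq0 => //; exact: inX_inc.
  exact: (cvgM c1 (cvgV s0 c3)).
have oXi : open (@inc j @^-1` inX i) by move/toric_openP : (@inX_open i); exact.
have n1 : \forall psi \near phi, inX i (@inc j psi) by apply: open_nbhs_nbhs.
have n2 : \forall psi \near phi, W (cval psi (u + sep j i *+ N) /
    cval psi (sep j i) ^+ N).
  by apply: cE; apply: open_nbhs_nbhs; split => //; rewrite -E.
near=> psi; have psi_i : inX i (@inc j psi) by near: psi.
split => //; rewrite E//; near: psi; exact: n2.
Unshelve. all: by end_near.
Qed.

Lemma ev_continuous i u x : dmon i u -> inX i x ->
  {for x, continuous (fun y => ev y u)}.
Proof.
move=> iu xi A; rewrite nbhsE => -[W [oW Wx] WA].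
have : nbhs x [set x | inX i x /\ W (ev x u)].
  by apply: open_nbhs_nbhs; split => //; exact: ev_open.
by apply: filterS => y [_ /WA].
Qed.

Lemma toric_cvg (F : set_system X) i x : Filter F -> inX i x -> F (inX i) ->
  (forall u, dmon i u -> (fun y => ev y u) @ F --> ev x u) -> F --> x.
Proof.
move=> FF xi Fi Fu; have [phi xE] := inX_chart xi.
pose r y := xget phi [set psi | y = @inc i psi].
have rP y : inX i y -> y = inc (r y).
  by move=> /inX_chart[psi yE]; rewrite /r; case: xgetP => // /(_ psi).
have Fr : r @ F --> phi.
  apply: cval_cvg => u iu.
  rewrite -(ev_inc phi iu).2 -xE => A /(Fu _ iu) FA.
  have {}FA : F [set y | A (ev y u)] by [].
  suff : F [set y | A (cval (r y) u)] by [].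
  by apply: filterS (filterI Fi FA) => y [yi]; rewrite /= {1}(rP y yi) (ev_inc _ iu).2.
move=> A; rewrite nbhsE => -[U [oU Ux] UA].
apply: filterS UA _.
have : nbhs phi (@inc i @^-1` U).
  apply: open_nbhs_nbhs; split; last by rewrite /= -xE.
  by move/toric_openP : oU; exact.
by move=> /Fr; rewrite /nbhs/= => FU; near=> y; rewrite (rP y);
  [near: y; exact: FU|near: y].
Unshelve. all: by end_near.
Qed.

(** Points sharing a chart are separated by a value. Otherwise the separating character vanishes at
    [x] and its opposite at [y]; the sets where these have modulus less than 1 are disjoint, because
    on the overlap the two values are inverse to each other. *)
Lemma toric_hausdorff : hausdorff_space X.
Proof.
rewrite open_hausdorff => x y xy.
have share l : inX l x -> inX l y -> exists2 AB : set X * set X,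
    x \in AB.1 /\ y \in AB.2 & [/\ open AB.1, open AB.2 & AB.1 `&` AB.2 == set0].
  move=> xl yl.
  have [u /not_implyP[lu /eqP uxy]] : exists u, ~ (dmon l u -> ev x u = ev y u).
    by apply/existsNP => E; move/eqP : xy; apply; exact: (ev_inj xl yl).
  have : hausdorff_space C by exact: norm_hausdorff.
  rewrite open_hausdorff => /(_ _ _ uxy)[[A B] [/= xA yB] [oA oB /eqP AB]].
  exists ([set x | inX l x /\ A (ev x u)], [set x | inX l x /\ B (ev x u)]) => /=.
    by split; apply/mem_set; split => //; exact/set_mem.
  split; [exact: ev_open|exact: ev_open|].
  apply/eqP; rewrite -subset0 => z [[_ Az] [_ Bz]].
  by have : set0 (ev z u) by rewrite -AB.
have [i xi] := inX_ex x; have [j yj] := inX_ex y.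
have [yi|yi] := pselect (inX i y); first exact: share xi yi.
have [s0|/eqP s0] := pselect (ev x (sep i j) = 0); last first.
  exact: share (inX_sep xi s0) yj.
pose B := [set z : C | `|z| < 1].
have oB : open B.
  rewrite (_ : B = ball (0 : C) 1); first exact: ball_open.
  by rewrite -ball_normE; apply/seteqP; split => z; rewrite /B /= sub0r normrN.
have js := (sepr i j).1.
have sy : ev y (- sep i j) = 0.
  apply: contrapT => /eqP s1; apply: yi; apply: (inX_le (meet_lel i j)).
  exact: inX_exposed (sepr i j) yj s1.
have B0 : B 0 by rewrite /B /= normr0.
exists ([set z | inX i z /\ B (ev z (sep i j))],
        [set z | inX j z /\ B (ev z (- sep i j))]) => /=.
  by split; apply/mem_set; rewrite /= ?s0 ?sy.
split; [by apply: ev_open => //; case: (sepl i j)|exact: ev_open|].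
apply/eqP; rewrite -subset0 => z [[zi Bz] [zj Bz']].
have := evN (zi _ (sepl i j).1) (zj _ js) => /(congr1 Num.norm).
rewrite normr1 normrM => z1; have := mulr_ilt1 (normr_ge0 _) (normr_ge0 _) Bz Bz'.
by rewrite z1 ltxx.
Qed.

End ToricPoints.

(** * Barycentric weights *)

Lemma seq_argmax (d : Order.disp_t) (T : orderType d) (A : eqType) (f : A -> T)
    (s : seq A) x : x \in s -> exists2 m, m \in s & forall y, y \in s -> (f y <= f m)%O.
Proof.
elim: s x => // a s IH x _; have [->|] := eqVneq s [::].
  by exists a; rewrite ?mem_head// => y; rewrite inE => /eqP ->.
case: s IH => // b s IH _; have [m ms mmax] := IH b (mem_head _ _).
have [am|/ltW ma] := leP (f a) (f m).
  exists m => [|y]; first by rewrite inE ms orbT.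
  by rewrite inE => /orP[/eqP->//|]; exact: mmax.
exists a => [|y]; first exact: mem_head.
by rewrite inE => /orP[/eqP->//|/mmax ym]; exact: le_trans ma.
Qed.

Section Barycentric.
Variables (R : realType) (n : nat) (Sigma : set (set 'rV[R]_n)).
Hypothesis hSigma : rational_fan Sigma.

Local Notation I := 'I_(ncones hSigma).
Local Notation dmon := (@dmon R n Sigma hSigma).
Local Notation cone_le := (@cone_le R n Sigma hSigma).
Local Notation bary := (@bary R n Sigma hSigma).
Implicit Types (s : I -> R) (i j k l : I) (u v : 'rV[int]_n).

(** The absolute value only turns the pairing into a natural exponent: the pairing is nonnegative
    whenever [k] lies below a cone [i] with [dmon i u], and elsewhere the base of the power will be
    1. *)
Definition ht u k : nat := `|dot u (bary k)|%N.

(* A weight [s k < 1] means that the cone [k] is used, and [s k = 0] that it is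
   at infinity. *)
Definition mono s u : R := \prod_k s k ^+ ht u k.

Definition weight s := forall k, 0 <= s k <= 1.

Definition below s i := forall k, s k < 1 -> cone_le k i.

Definition chain s := forall k l, s k < 1 -> s l < 1 -> cone_le k l \/ cone_le l k.

Definition canonical s k0 := [/\ weight s, s k0 = 0,
  forall k, s k < 1 -> cone_le k0 k, forall k, s k = 0 -> k = k0 & chain s].

Definition rk i := #|[pred k | cone_le k i]|.

Lemma rk_lt i j : cone_le i j -> ~~ cone_le j i -> (rk i < rk j)%N.
Proof.
move=> ij ji; apply: proper_card; apply/fintype.properP; split.
  by apply/fintype.subsetP => k ki; exact: (cone_le_trans (ki : cone_le k i) ij).
by exists j; [exact: cone_le_refl|exact: ji].
Qed.

Lemma chain_top (P : pred I) k0 : P k0 ->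
  (forall k l, P k -> P l -> cone_le k l \/ cone_le l k) ->
  exists2 t, P t & forall k, P k -> cone_le k t.
Proof.
move=> Pk0 ch; case: (arg_maxnP rk Pk0) => t Pt tmax; exists t => // k Pk.
have [//|tk] := ch _ _ Pk Pt; apply: contrapT => /negP kt.
by have := tmax _ Pk; rewrite /= leqNgt rk_lt.
Qed.

Lemma htD i k u v : cone_le k i -> dmon i u -> dmon i v ->
  ht (u + v) k = (ht u k + ht v k)%N.
Proof.
move=> ki iu iv; rewrite /ht dotDl.
have := bary_ge0 ki iu; have := bary_ge0 ki iv; lia.
Qed.

Lemma ht_eq0 u k : (ht u k == 0%N) = (dot u (bary k) == 0).
Proof. by rewrite absz_eq0. Qed.

Lemma ht0 k : ht 0 k = 0%N.
Proof. by rewrite /ht dot0l. Qed.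

Section Mono.
Variable s : I -> R.
Hypothesis ws : weight s.

Lemma weight_ge0 k : 0 <= s k. Proof. by have /andP[] := ws k. Qed.
Lemma weight_le1 k : s k <= 1. Proof. by have /andP[] := ws k. Qed.

Lemma weight_eq1 k : ~ s k < 1 -> s k = 1.
Proof. by move=> /negP; rewrite -leNgt => ?; apply/eqP; rewrite eq_le weight_le1. Qed.

Lemma mono_ge0 u : 0 <= mono s u.
Proof. by apply: prodr_ge0 => k _; rewrite exprn_ge0// weight_ge0. Qed.

Lemma mono_le1 u : mono s u <= 1.
Proof.
by apply: prodr_ile1 => k _; rewrite exprn_ge0 ?exprn_ile1 ?weight_ge0 ?weight_le1.
Qed.

Lemma mono0 : mono s 0 = 1.
Proof. by rewrite /mono big1// => k _; rewrite ht0. Qed.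

Lemma monoD i u v : below s i -> dmon i u -> dmon i v ->
  mono s (u + v) = mono s u * mono s v.
Proof.
move=> si iu iv; rewrite /mono -big_split/=; apply: eq_bigr => k _.
have [/si ki|/weight_eq1 ->] := pselect (s k < 1); last by rewrite !expr1n mulr1.
by rewrite (htD ki iu iv) exprD.
Qed.

Lemma mono_eq1 u : (forall k, s k < 1 -> dot u (bary k) = 0) -> mono s u = 1.
Proof.
move=> u0; rewrite /mono big1// => k _.
have [/u0/eqP|/weight_eq1 ->] := pselect (s k < 1); last by rewrite expr1n.
by rewrite -ht_eq0 => /eqP ->.
Qed.

Lemma mono_eq1P u k : mono s u = 1 -> s k < 1 -> dot u (bary k) = 0.
Proof.
move=> u1 sk; apply/eqP; rewrite -ht_eq0; apply/negPn/negP => hk.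
have : mono s u < 1; last by rewrite u1 ltxx.
rewrite /mono (bigD1 k)//=.
apply: (@le_lt_trans _ _ (s k ^+ ht u k)); last by rewrite exprn_ilt1// weight_ge0.
rewrite ler_piMr ?exprn_ge0 ?weight_ge0//; apply: prodr_ile1 => l _.
by rewrite exprn_ge0 ?exprn_ile1 ?weight_ge0 ?weight_le1.
Qed.

Lemma mono_eq0 u k : s k = 0 -> dot u (bary k) != 0 -> mono s u = 0.
Proof.
by move=> sk; rewrite -ht_eq0 => hk; rewrite /mono (bigD1 k)//= sk expr0n (negPf hk) mul0r.
Qed.

Lemma mono_gt0 u : (forall k, s k = 0 -> dot u (bary k) = 0) -> 0 < mono s u.
Proof.
move=> u0; apply: prodr_gt0 => k _; have [/u0/eqP|sk] := eqVneq (s k) 0.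
  by rewrite -ht_eq0 => /eqP ->.
by rewrite exprn_gt0// lt0r sk weight_ge0.
Qed.

End Mono.

Lemma mono_canonical_eq0 s k0 i u : canonical s k0 -> below s i -> dmon i u ->
  (mono s u != 0) = (dot u (bary k0) == 0).
Proof.
move=> [ws s0 _ z0 _] si iu; apply/idP/idP => [|/eqP uk0].
  by apply: contraNT => uk0; rewrite (mono_eq0 s0).
by rewrite gt_eqF// mono_gt0// => k /z0 ->.
Qed.

(** At a cone [j] of maximal rank where the weights differ, all weights strictly above [j] agree. A
    character blind to the remaining cones of the chain of the larger weight, but positive on [j],
    then tells the two monomials apart. *)
Lemma barycentric_unique i s s' k0 k0' : canonical s k0 -> canonical s' k0' ->
  below s i -> below s' i -> (forall u, dmon i u -> mono s u = mono s' u) ->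
  forall j, s j = s' j.
Proof.
move=> cs cs' si s'i ss'; apply: contrapT => /existsNP[j0 /eqP sj0].
case: (@arg_maxnP _ j0 (fun j => s j != s' j) rk sj0) => j sj jmax.
have up k : cone_le j k -> k != j -> s k = s' k.
  move=> jk kj; apply/eqP; apply: contrapT => /negP/jmax; rewrite /= leqNgt rk_lt//.
  by apply: contra kj => kj; rewrite (cone_le_anti jk kj).
wlog lt : s s' k0 k0' cs cs' si s'i ss' {j0 sj0 jmax} sj up / s j < s' j.
  move=> H; move: (sj); rewrite neq_lt => /orP[lt|lt].
    exact: (H s s' k0 k0').
  apply: (H s' s k0' k0) => //; first by move=> u /ss'.
    by rewrite eq_sym.
  by move=> k jk kj; rewrite up.
have [ws s0 sm sz _] := cs; have [ws' s'0 _ _ s'ch] := cs'.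
have sj1 : s j < 1 by apply: lt_le_trans lt _; exact: weight_le1.
(* The cones active for [s'] that do not contain [j]. They form a chain; a character exposing its
   largest element [t] kills the barycenters of all of them and is positive on that of [j]. *)
pose P k := (s' k < 1) && ~~ cone_le j k.
have Pk0' : P k0'.
  rewrite /P s'0 ltr01/=; apply/negP => jk0'.
  have jk : k0' != j.
    by apply: contraTneq lt => <-; rewrite s'0 -leNgt weight_ge0.
  have kE : k0' = k0 by apply: sz; rewrite up.
  by move: jk; rewrite kE (cone_le_anti (sm _ sj1)) ?eqxx// -kE.
have [t /andP[st jt] tmax] := chain_top Pk0'
  (fun k l Pk Pl => s'ch _ _ (andP Pk).1 (andP Pl).1).
have [u ue] := le_exposed (s'i _ st); have iu := ue.1.
have uj : (0 < ht u j)%N.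
  rewrite lt0n ht_eq0; apply/eqP => /(exposes_bary ue (si _ sj1)).
  by apply/negP.
(* The common contribution of the cones strictly above [j]. It is nonzero since the only zero of [s]
   is at [k0], which lies below [j]. *)
pose Q := \prod_(k | cone_le j k && (k != j)) s' k ^+ ht u k.
have Q0 : 0 < Q.
  apply: prodr_gt0 => k /andP[jk kj]; rewrite exprn_gt0// lt0r weight_ge0// andbT.
  rewrite -up//; apply: contra kj => /eqP/sz kE.
  by rewrite kE (cone_le_anti (sm _ sj1)) -?kE.
have E' : mono s' u = s' j ^+ ht u j * Q.
  rewrite /mono (bigID (cone_le j))/= [X in _ * X]big1 ?mulr1.
    by rewrite (bigD1 j) ?cone_le_refl.
  move=> k jk; have [s'k|/(weight_eq1 ws') ->] := pselect (s' k < 1); last first.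
    by rewrite expr1n.
  have kt : cone_le k t by apply: tmax; rewrite /P s'k jk.
  by move/(exposes_bary ue (s'i _ s'k))/eqP : kt; rewrite -ht_eq0 => /eqP ->.
have E : mono s u <= s j ^+ ht u j * Q.
  rewrite /mono (bigID (cone_le j))/= (bigD1 j) ?cone_le_refl//=.
  rewrite (eq_bigr (fun k => s' k ^+ ht u k)) => [|k /andP[jk kj]]; last by rewrite up.
  rewrite -/Q ler_piMr// ?mulr_ge0 ?exprn_ge0 ?weight_ge0 ?(ltW Q0)//.
  apply: prodr_ile1 => k _.
  by rewrite exprn_ge0 ?exprn_ile1 ?weight_ge0 ?weight_le1.
move: E; rewrite ss'// E' ler_pM2r// leNgt ltr_pXn2r ?lt//.
- by rewrite nnegrE weight_ge0.
- by rewrite nnegrE weight_ge0.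
Qed.

(* Points at infinity are absorbed by the largest cone at infinity. *)
Lemma barycentric_reduce s l : weight s -> chain s -> s l = 0 ->
  exists s' k0, [/\ canonical s' k0,
    forall k, s' k = s k \/ s' k = 1,
    s k0 = 0 /\ (forall k, s k = 0 -> k != k0 -> s' k = 1) &
    forall u i, below s i -> dmon i u -> mono s u = mono s' u].
Proof.
move=> ws ch sl; have [|k k' /eqP sk /eqP sk'|t /eqP st tmax] := @chain_top (fun k => s k == 0) l.
- exact/eqP.
- by apply: ch; rewrite ?sk ?sk' ltr01.
pose s' k := if cone_le k t && (k != t) then 1 else s k.
have s's k : s' k = s k \/ s' k = 1 by rewrite /s'; case: ifP; [right|left].
have s'1 k : s' k < 1 -> s' k = s k /\ s k < 1.
  by case: (s's k) => ->; [split|rewrite ltxx].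
exists s', t; split=> //.
- split.
  + by move=> k; case: (s's k) => ->; rewrite ?ler01 ?lexx//; exact: ws.
  + by rewrite /s' eqxx andbF.
  + move=> k /[dup] /s'1[_ sk]; rewrite /s'.
    have [kt|//] := ch k t sk ltac:(by rewrite st).
    by rewrite kt /=; case: eqP => [->|_]; rewrite ?ltxx ?cone_le_refl.
  + move=> k; rewrite /s'; case: ifP => [_ /eqP|+ /eqP/tmax kt].
      by rewrite oner_eq0.
    by rewrite kt /= => /negbT/negPn/eqP.
  + by move=> k k' /s'1[_ sk] /s'1[_ sk']; exact: ch.
- by split => // k /eqP/tmax kt ktn; rewrite /s' kt ktn.
move=> u i si iu; have [ut|ut] := eqVneq (dot u (bary t)) 0; last first.
  by rewrite (mono_eq0 st ut) (mono_eq0 _ ut)// /s' eqxx andbF.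
apply: eq_bigr => k _; rewrite /s'; case: ifP => [/andP[kt _]|//].
have it : cone_le t i by apply: si; rewrite st.
have /eqP := bary_eq0_le kt (dmon_le it iu) ut.
by rewrite -ht_eq0 => /eqP ->.
Qed.

Definition monoidal i (h : 'rV[int]_n -> R) := [/\ h 0 = 1,
  forall u, dmon i u -> 0 <= h u <= 1 &
  forall u v, dmon i u -> dmon i v -> h (u + v) = h u * h v].

Lemma monoidalMn i h u m : monoidal i h -> dmon i u -> h (u *+ m) = h u ^+ m.
Proof.
move=> [h0 _ hD] iu; elim: m => [|m IH]; first by rewrite mulr0n h0.
by rewrite mulrS hD ?IH ?exprS//; exact: dmonMn.
Qed.

(* Subtracting the largest possible multiple of the barycenter of the cone lands
   on a proper face: there is a character u on which h agrees with r ^ ht. *)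
Lemma monoidal_strip i h : monoidal i h ->
  (exists u, [/\ dmon i u, ht u i != 0%N & h u != 0]) ->
  exists r u, [/\ 0 < r <= 1, dmon i u, ht u i != 0%N, h u = r ^+ ht u i &
    forall v, dmon i v -> h v <= r ^+ ht v i].
Proof.
move=> mh [u0 [iu0 hu0 hn0]]; have [h0 h01 hD] := mh.
have [G [Gi iG]] := dmon_fingen i.
have htDi u v : dmon i u -> dmon i v -> ht (u + v) i = (ht u i + ht v i)%N.
  by apply: htD; exact: cone_le_refl.
have htM u m : ht (u *+ m) i = (ht u i * m)%N.
  by rewrite /ht dotMnl -mulr_natr abszM natz absz_nat.
have Gspan x : nspan [set` G] x -> dmon i x.
  by elim=> [|g y Gg _ iy]; [exact: dmon0|apply: dmonD => //; exact: Gi].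
pose G' := [seq g <- G | (ht g i != 0%N) && (h g != 0)].
have [g0 G'g0] : exists g, g \in G'.
  apply: contrapT => nG'.
  have hG x : nspan [set` G] x -> ht x i != 0%N -> h x = 0.
    elim=> [|g y Gg Gy IH]; first by rewrite ht0.
    have ig := Gi _ Gg; have iy := Gspan _ Gy.
    rewrite htDi// hD// addn_eq0 negb_and.
    have [g0|g0 _] := eqVneq (ht g i) 0%N; first by move=> /IH ->; rewrite mulr0.
    have [->|hg] := eqVneq (h g) 0; first by rewrite mul0r.
    by exfalso; apply: nG'; exists g; rewrite mem_filter g0 hg.
  have [N N0 GN] := iG _ iu0; move: hn0.
  have := hG _ GN; rewrite htM (monoidalMn _ mh iu0) muln_eq0 negb_or hu0 -lt0n N0.
  by move=> /(_ isT)/eqP; rewrite expf_eq0 N0 /= => /eqP ->; rewrite eqxx.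
(* The maximum r of [f] over [G'] gives h <= r ^ ht on the generators and, by multiplicativity,
   everywhere; equality holds at the maximizer. *)
pose f g := h g `^ (ht g i)%:R^-1.
have [g G'g gmax] := seq_argmax f G'g0.
move: (G'g); rewrite mem_filter => /andP[/andP[hg hgn0] Gg].
have ig := Gi _ Gg.
have fE y : dmon i y -> ht y i != 0%N -> f y ^+ ht y i = h y.
  move=> iy hy; rewrite -powR_mulrn ?powR_ge0// -powRrM mulVf ?pnatr_eq0//.
  by rewrite powRr1//; have /andP[] := h01 _ iy.
have f0 : 0 < f g by apply: powR_gt0; rewrite lt0r hgn0; have /andP[] := h01 _ ig.
have f1 : f g <= 1.
  rewrite leNgt; apply/negP => f1; have /andP[_] := h01 _ ig.
  have h1 : 1 < h g by rewrite -fE// exprn_egt1.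
  by move=> /(lt_le_trans h1); rewrite ltxx.
have Gle x : nspan [set` G] x -> h x <= f g ^+ ht x i.
  elim=> [|y z Gy Gz IH]; first by rewrite ht0 h0.
  have iy := Gi _ Gy; have iz := Gspan _ Gz.
  rewrite htDi// hD// exprD ler_pM//; first by have /andP[] := h01 _ iy.
    by have /andP[] := h01 _ iz.
  have [->|hy] := eqVneq (ht y i) 0%N; first by have /andP[] := h01 _ iy.
  have [->|hyn0] := eqVneq (h y) 0; first by rewrite exprn_ge0// ltW.
  rewrite -{1}(fE y)// lerXn2r ?nnegrE ?powR_ge0//.
  by apply: gmax; rewrite mem_filter hy hyn0.
exists (f g), g; split => //; first by rewrite f0.
  by rewrite fE.
move=> v iv; have [N N0 GN] := iG _ iv; have := Gle _ GN.
rewrite htM exprM (monoidalMn _ mh iv) ler_pXn2r//; rewrite nnegrE.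
  by have /andP[] := h01 _ iv.
by rewrite exprn_ge0// ltW.
Qed.

(** Induction on the number of faces: after division by the largest power r ^ ht, the quotient is
    still at most 1 and equals 1 at some character [w] positive on the barycenter. It therefore
    extends to the dual monoid of the proper face exposed by [w], whose weights are completed by r
    at [i]. *)
Lemma barycentric_exists i h : monoidal i h -> exists s k0,
  [/\ canonical s k0, below s i & forall u, dmon i u -> h u = mono s u].
Proof.
elim: {i}(rk i) {-2}i (leqnn (rk i)) h => [|m IH] i rki h mh.
  move: rki; rewrite leqn0 => /eqP/card0_eq/(_ i).
  by rewrite !inE cone_le_refl.
have [h0 h01 hD] := mh.
have monoE (r : R) s : s i = 1 -> forall u,
    mono (fun k => if k == i then r else s k) u = r ^+ ht u i * mono s u.
  move=> si u; rewrite /mono (bigD1 i)//= eqxx; congr (_ * _).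
  rewrite [RHS](bigD1 i)//= si expr1n mul1r; apply: eq_bigr => k /negPf ->//.
have [ex|nex] := pselect (exists u, [/\ dmon i u, ht u i != 0%N & h u != 0]); last first.
  (* Here [h] vanishes at all characters positive on [bary i], so [i] is the cone at infinity. The
     other characters are invertible in the monoid, and h <= 1 at u and at -u forces h u = 1. *)
  exists (fun k => if k == i then 0 else 1), i; split.
  - split.
    + by move=> k; case: ifP => _; rewrite ?ler01 ?lexx.
    + by rewrite eqxx.
    + by move=> k; case: eqP => [->|_]; rewrite ?ltxx ?cone_le_refl.
    + by move=> k; case: eqP => // _ /eqP; rewrite oner_eq0.
    + move=> k l; case: eqP => [->|_]; rewrite ?ltxx//; case: eqP => [->|_].
        by left; exact: cone_le_refl.
      by rewrite ltxx.
  - by move=> k; case: eqP => [->|_]; rewrite ?ltxx ?cone_le_refl.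
  - move=> u iu; rewrite (monoE 0 (fun=> 1))// expr0n mono_eq1 ?mulr1; last first.
    + by move=> k; rewrite ltxx.
    + by move=> k; rewrite ler01 lexx.
    have [/eqP|hu] := eqVneq (ht u i) 0%N; last first.
      by apply: contrapT => /eqP hn0; apply: nex; exists u.
    rewrite ht_eq0 => /eqP u0; have iNu := bary_eq0N iu u0.
    have := hD _ _ iu iNu; rewrite subrr h0 => hh.
    have /andP[a0 a1] := h01 _ iu; have /andP[b0 b1] := h01 _ iNu.
    apply/eqP; rewrite eq_le a1/= hh -[leRHS]mulr1 ler_wpM2l//.
have [r [w [/andP[r0 r1] iw hw0 hw hle]]] := monoidal_strip mh ex.
have rX m' : 0 < r ^+ m' by rewrite exprn_gt0.
pose h' u := h u / r ^+ ht u i.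
have h'D u v : dmon i u -> dmon i v -> h' (u + v) = h' u * h' v.
  move=> iu iv; rewrite /h' hD// (htD (cone_le_refl i) iu iv) exprD invfM.
  by rewrite mulrACA.
have h'w : h' w = 1 by rewrite /h' hw divff// gt_eqF.
have h'wM u m' : dmon i u -> h' (u + w *+ m') = h' u.
  move=> iu; elim: m' => [|m' IHm]; first by rewrite addr0.
  rewrite mulrSr addrA h'D// ?IHm ?h'w ?mulr1//.
  by apply: dmonD => //; exact: dmonMn.
have h'01 u : dmon i u -> 0 <= h' u <= 1.
  move=> iu; have /andP[hu0 _] := h01 _ iu.
  by rewrite divr_ge0 ?(ltW (rX _))//= ler_pdivrMr// mul1r hle.
have [j we] := face_exposed iw; have ji := exposes_le we.
have nij : ~~ cone_le i j.
  apply/negP => /(exposes_bary we (cone_le_refl i))/eqP.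
  by rewrite -ht_eq0 (negPf hw0).
(* Extension to the localization: as [h' w = 1], every shift by a multiple of [w] into [dmon i]
   yields the same value. *)
pose h'' a := h' (a + w *+ xget 0%N [set N | dmon i (a + w *+ N)]).
have h''E a N : dmon i (a + w *+ N) -> h'' a = h' (a + w *+ N).
  move=> iN; rewrite /h''; case: xgetP => [N' _ /= iN'|/(_ N)//].
  by rewrite -(h'wM _ N iN') -(h'wM _ N' iN) -!addrA -!mulrnDr addnC.
have mh'' : monoidal j h''.
  split=> [|u ju|u v ju jv].
  - by rewrite (h''E _ 0%N) ?addr0 /h' ?h0 ?ht0 ?divr1//; exact: dmon0.
  - by have [N iN] := exposes_shift we ju; rewrite (h''E _ N)// h'01.
  - have [N iN] := exposes_shift we ju; have [N' iN'] := exposes_shift we jv.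
    rewrite (h''E u N)// (h''E v N')// -h'D// addrACA -mulrnDr; apply: h''E.
    by rewrite mulrnDr addrACA; exact: dmonD.
have rkj : (rk j <= m)%N.
  by rewrite -ltnS; apply: leq_trans rki; exact: rk_lt.
have [s [k0 [cs sj hs]]] := IH j rkj h'' mh''.
have [ws s0 sm sz sch] := cs.
have si : s i = 1 by apply: weight_eq1 => // /sj; exact/negP.
pose s' k := if k == i then r else s k.
have s'1 k : s' k < 1 -> k = i \/ s k < 1.
  by rewrite /s'; case: eqP; [left|right].
have k0j : cone_le k0 j by apply: sj; rewrite s0.
exists s', k0; split.
- split.
  + by move=> k; rewrite /s'; case: ifP => // _; rewrite (ltW r0).
  + rewrite /s'; case: eqP => // k0i; move: si; rewrite -k0i s0 => /eqP.
    by rewrite eq_sym oner_eq0.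
  + by move=> k /s'1[->|/sm//]; exact: cone_le_trans k0j ji.
  + move=> k; rewrite /s'; case: ifP => [_ r00|_ /sz//].
    by move: r0; rewrite r00 ltxx.
  + move=> k l /s'1[->|sk] /s'1[->|sl]; last exact: sch.
    * by left; exact: cone_le_refl.
    * by right; apply: cone_le_trans ji; exact: sj.
    * by left; apply: cone_le_trans ji; exact: sj.
- by move=> k /s'1[->|/sj kj]; [exact: cone_le_refl|exact: cone_le_trans kj ji].
- move=> u iu; rewrite monoE// -hs; last exact: dmon_le ji iu.
  rewrite (h''E u 0%N) addr0// /h' mulrCA divff ?mulr1// gt_eqF//.
Qed.

End Barycentric.

(** * Topology of the complex numbers and of the torus *)

Section ComplexTopology.
Variable R : realType.
Local Notation C := (R[i]^o).

(** The norm on [R[i]] takes values in [R[i]]; this is the same number as an element of [R], where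
    it can be compared with weights and raised to real powers. *)
Definition modc (z : R[i]) : R := complex.Re `|z|.

Lemma modcE z : (modc z)%:C = `|z|.
Proof. by rewrite /modc RRe_real// normr_real. Qed.

Lemma modc_ge0 z : 0 <= modc z.
Proof. by rewrite -lecR modcE normr_ge0. Qed.

Lemma modcM z w : modc (z * w) = modc z * modc w.
Proof. by apply: complexI; rewrite rmorphM/= !modcE normrM. Qed.

Lemma modc0 : modc 0 = 0.
Proof. by apply: complexI; rewrite modcE normr0. Qed.

Lemma modc1 : modc 1 = 1.
Proof. by apply: complexI; rewrite modcE normr1. Qed.

Lemma modc_eq0 z : (modc z == 0) = (z == 0).
Proof. by rewrite -(inj_eq (@complexI R)) modcE normr_eq0. Qed.

Lemma modc_real (r : R) : modc r%:C = `|r|.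
Proof. by apply: complexI; rewrite modcE normc_def/= expr0n/= addr0 sqrtr_sqr. Qed.

Lemma modcN z : modc (- z) = modc z.
Proof. by rewrite /modc normrN. Qed.

Lemma modcV z : modc z^-1 = (modc z)^-1.
Proof. by apply: complexI; rewrite fmorphV/= !modcE normfV. Qed.

Lemma modc_eq1 z : `|z| = 1 -> modc z = 1.
Proof. by move=> z1; apply: complexI; rewrite modcE. Qed.

Lemma modc_dist z w : `|modc z - modc w| <= modc (z - w).
Proof.
rewrite -lecR modcE; apply: le_trans (ler_dist_dist z w).
by rewrite -!modcE -rmorphB/= -[leRHS]modcE modc_real.
Qed.

Lemma modc_ge_Re z : `|complex.Re z| <= modc z.
Proof. by rewrite -lecR modcE; exact: normc_ge_Re. Qed.

Lemma modc_ge_Im z : `|complex.Im z| <= modc z.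
Proof.
have := modc_ge_Re ('i * z); rewrite modcM (_ : modc 'i = 1).
  by rewrite mul1r; case: z => a b; rewrite /= mul0r sub0r normrN mul1r.
by rewrite modc_eq1// normc_def /= expr0n/= expr1n add0r sqrtr1.
Qed.

Section Filters.
Context {T : Type} {F : set_system T} {FF : Filter F}.

Lemma cvgC_modc (f : T -> C) (a : C) :
  f @ F --> a <-> forall e : R, 0 < e -> \forall x \near F, modc (a - f x) < e.
Proof.
split=> [/cvgrPdist_lt fa e e0|fa].
  have e0' : 0 < e%:C :> R[i] by rewrite ltcR.
  by apply: filterS (fa _ e0') => x; rewrite -modcE ltcR.
apply/cvgrPdist_lt => e e0.
have eE : (complex.Re e)%:C = e by rewrite RRe_real// gtr0_real.
have e0' : 0 < complex.Re e by rewrite -ltcR eE.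
by apply: filterS (fa _ e0') => x; rewrite -ltcR modcE eE.
Qed.

Lemma cvg_modc (f : T -> C) (a : C) :
  f @ F --> a -> (fun x => modc (f x)) @ F --> modc a.
Proof.
move=> /cvgC_modc fa; apply/cvgrPdist_lt => e /fa; apply: filterS => x.
exact: le_lt_trans (modc_dist _ _).
Qed.

Lemma cvg_Re (f : T -> C) (a : C) :
  f @ F --> a -> (fun x => complex.Re (f x)) @ F --> complex.Re a.
Proof.
move=> /cvgC_modc fa; apply/cvgrPdist_lt => e /fa; apply: filterS => x.
by apply: le_lt_trans; rewrite -raddfB modc_ge_Re.
Qed.

Lemma cvg_Im (f : T -> C) (a : C) :
  f @ F --> a -> (fun x => complex.Im (f x)) @ F --> complex.Im a.
Proof.
move=> /cvgC_modc fa; apply/cvgrPdist_lt => e /fa; apply: filterS => x.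
by apply: le_lt_trans; rewrite -raddfB modc_ge_Im.
Qed.

Lemma cvg_real_complex (f : T -> R) (a : R) :
  f @ F --> a -> (fun x => (f x)%:C : C) @ F --> (a%:C : C).
Proof.
move=> /cvgrPdist_lt fa; apply/cvgC_modc => e /fa; apply: filterS => x.
by rewrite -rmorphB/= modc_real.
Qed.

End Filters.

Lemma modc_continuous : continuous (modc : C -> R).
Proof. by move=> z; exact: (@cvg_modc _ (nbhs z) (nbhs_filter z) idfun z cvg_id). Qed.

Lemma Re_continuous : continuous (complex.Re (R := R) : C -> R).
Proof. by move=> z; exact: (@cvg_Re _ (nbhs z) (nbhs_filter z) idfun z cvg_id). Qed.

Lemma Im_continuous : continuous (complex.Im (R := R) : C -> R).
Proof. by move=> z; exact: (@cvg_Im _ (nbhs z) (nbhs_filter z) idfun z cvg_id). Qed.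

Lemma base_set_nneg k (r : R) : 0 <= r -> base_set k r%:C.
Proof.
move=> r0; have r0' : 0 <= r%:C by rewrite lecR.
by case: k => //=; exact: ger0_real.
Qed.

Lemma base_set_closed k : closed (base_set k : set C).
Proof.
have imE (z : C) : (z \is Num.real) = (complex.Im z == 0) by case: z => a b; exact: complex_real.
have clIm : closed [set z : C | complex.Im z = 0].
  apply: (@closed_comp _ _ (fun z : C => complex.Im z) [set 0]).
    by move=> z _; exact: Im_continuous.
  exact: closed_eq.
have clRe : closed [set z : C | 0 <= complex.Re z].
  apply: (@closed_comp _ _ (fun z : C => complex.Re z) [set x | 0 <= x]).
    by move=> z _; exact: Re_continuous.
  exact: closed_ge.
case: k => /=; first exact: closedT.
- by rewrite (_ : mkset _ = [set z : C | complex.Im z = 0])//; apply/seteqP;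
    split => z /=; rewrite imE => /eqP.
- rewrite (_ : mkset _ = [set z : C | complex.Im z = 0] `&` [set z : C | 0 <= complex.Re z]).
    exact: closedI.
  apply/seteqP; split => z /=; rewrite lecE /=.
    by case/andP => /eqP -> ->.
  by move=> [-> ->]; rewrite eqxx.
Qed.

Lemma C_closed1 (a : C) : closed [set a].
Proof. by apply: accessible_closed_set1; apply: hausdorff_accessible; exact: norm_hausdorff. Qed.

Lemma closed_eq_fun (T : topologicalType) (f g : T -> C) :
  continuous f -> continuous g -> closed [set t | f t = g t].
Proof.
move=> cf cg; rewrite (_ : mkset _ = (fun t => f t - g t : C) @^-1` [set 0]).
  by apply: closed_comp (@C_closed1 0) => t _; exact: (cvgB (cf t) (cg t)).
by apply/seteqP; split=> t /= /eqP; [rewrite -subr_eq0|rewrite subr_eq0] => /eqP.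
Qed.

Lemma closed_modc_le : compact [set z : C | modc z <= 1].
Proof.
pose f (p : R * R) : C := p.1%:C + 'i * p.2%:C.
have cf : continuous f.
  move=> p; have c1 : (fun p : R * R => p.1%:C : C) @ p --> (p.1%:C : C).
    by apply: cvg_real_complex; exact: cvg_fst.
  have c2 : (fun p : R * R => p.2%:C : C) @ p --> (p.2%:C : C).
    by apply: cvg_real_complex; exact: cvg_snd.
  have c3 : (fun p : R * R => 'i * p.2%:C : C) @ p --> ('i * p.2%:C : C).
    have c0 : (fun _ : R * R => 'i : C) @ p --> ('i : C) by exact: cvg_cst.
    exact: (cvgM c0 c2).
  exact: (cvgD c1 c3).
have cI : compact (f @` (`[-1, 1]%classic `*` `[-1, 1]%classic)).
  apply: continuous_compact; first exact: continuous_subspaceT.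
  by apply: compact_setX; exact: segment_compact.
apply: (subclosed_compact _ cI) => [|z /= z1].
  apply: (@closed_comp _ _ (fun z : C => modc z) [set x | x <= 1]); last exact: closed_le.
  by move=> z _; exact: modc_continuous.
exists (complex.Re z, complex.Im z); last by rewrite /f -complexE.
by split; rewrite /= in_itv/= -ler_norml;
  [apply: le_trans (modc_ge_Re z) _|apply: le_trans (modc_ge_Im z) _].
Qed.

End ComplexTopology.

Lemma compact_subtype (X : topologicalType) (A : set X) :
  compact A -> compact [set: A].
Proof.
move=> cA F PF _; pose G := (set_val : A -> X) @ F.
have GA : G A.
  by rewrite /G; apply: (@filterS _ F _ setT) => [a _|]; [exact: set_valP|exact: filterT].
have [x [Ax clx]] := cA G _ GA.
exists (SigSub (mem_set Ax)); split => // B U FB.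
rewrite nbhsE => -[V [[W oW <-] Wx] VU].
have := clx (set_val @` B) W.
have GB : G (set_val @` B) 
  by rewrite /G; apply: (@filterS _ F _ B) FB => b Bb; exists b.
move=> /(_ GB (open_nbhs_nbhs (conj oW Wx)))[_ [[b Bb <-] Wb]].
by exists b; split => //; exact: VU.
Qed.

Section TorusCompact.
Variables (R : realType) (k : base) (n : nat).
Local Notation T := (torus R k n).
Local Notation C := (R[i]^o).

Lemma torus_eval_continuous m : continuous (fun t : T => torus_fun t m : C).
Proof. exact: (@ptws_eval_continuous _ _ (@torus_pred R k n)). Qed.

(** By Tychonoff: the conditions defining the torus are closed in the product of closed unit discs
    indexed by all characters. *)
Lemma torus_compact : compact [set: T].
Proof.
apply: compact_subtype.
have evc m : continuous (fun f : {ptws 'rV[int]_n -> C} => f m).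
  exact: (@proj_continuous _ (fun=> C) m).
apply: (subclosed_compact _
  (tychonoff (A := fun _ : 'rV[int]_n => [set z : C | modc z <= 1])
     (fun _ => @closed_modc_le R))); last first.
  by move=> t [t1 _] m /=; have [_ /modc_eq1 ->] := t1 m.
rewrite (_ : @torus_pred R k n =
   (\bigcap_m ((fun f : {ptws 'rV[int]_n -> C} => f m) @^-1`
      (base_set k `&` [set z : C | modc z = 1]))) `&`
   (\bigcap_p [set f : {ptws 'rV[int]_n -> C} | f (p.1 + p.2) = f p.1 * f p.2])).
  apply: closedI; apply: closed_bigI => m _.
    apply: closed_comp => [f _|]; first exact: evc.
    apply: closedI; first exact: base_set_closed.
    apply: (@closed_comp _ _ (fun z : C => modc z) [set 1]); last exact: closed_eq.
    by move=> z _; exact: modc_continuous.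
  apply: closed_eq_fun => [|f]; first exact: evc.
  exact: (cvgM (evc _ f) (evc _ f)).
apply/seteqP; split=> f /=.
  move=> [f1 fD]; split=> [m _|p _] /=; last exact: fD.
  by have [fk /modc_eq1] := f1 m.
move=> [f1 fD]; split=> [m|a b]; last exact: (fD (a, b)).
by have [fk fm] := f1 m I; rewrite -modcE fm.
Qed.

End TorusCompact.

(** * Orbits and blocks *)

Lemma cvg_near (S : Type) (V : topologicalType) (F : set_system S) {FF : Filter F}
    (f g : S -> V) (a : V) :
  (\forall x \near F, f x = g x) -> f @ F --> a -> g @ F --> a.
Proof.
move=> fg fa A /fa FA; suff : F [set x | A (g x)] by [].
have {}FA : F [set x | A (f x)] by [].
by apply: filterS (filterI fg FA) => x [fgx]; rewrite /= -fgx.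
Qed.

Section Orbits.
Variables (R : realType) (k : base) (n : nat) (Sigma : set (set 'rV[R]_n)).
Hypothesis hSigma : rational_fan Sigma.

Local Notation cone := (@cone R n Sigma hSigma).
Local Notation I := 'I_(ncones hSigma).
Local Notation dmon := (@dmon R n Sigma hSigma).
Local Notation cone_le := (@cone_le R n Sigma hSigma).
Local Notation exposes := (@exposes R n Sigma hSigma).
Local Notation bary := (@bary R n Sigma hSigma).
Local Notation X := (toric_variety k Sigma).
Local Notation T := (torus R k n).
Local Notation C := (R[i]^o).
Local Notation inX := (@inX R k n Sigma hSigma).
Local Notation mono := (@mono R n Sigma hSigma).
Local Notation below := (@below R n Sigma hSigma).
Local Notation canonical := (@canonical R n Sigma hSigma).
Local Notation lv := (@lattice_vec R n).

Definition in_orbit i (x : X) := [/\ inX i x, forall j, inX j x -> cone_le i j &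
  forall u, dmon i u -> (ev x u != 0) = (dot u (bary i) == 0)].

(** Among the characters not vanishing at [x], one exposing a face of least rank is taken; that face
    is the cone of the orbit. *)
Lemma orbit_exists x : exists i, in_orbit i x.
Proof.
have [i0 xi0] := inX_ex hSigma x.
pose P m := `[< exists u j, [/\ exposes u j i0, ev x u != 0 & rk j = m] >].
have exP : exists m, P m.
  have [j je] := face_exposed (dmon0 i0).
  by exists (rk j); apply/asboolP; exists 0, j; split => //; rewrite (ev0 hSigma) oner_neq0.
case: (ex_minnP exP) => m /asboolP[u [i [ue u0 rki]]] minm; subst m.
have iu := ue.1; have xi := inX_exposed ue xi0 u0.
have ev0P a : dmon i a -> (ev x a != 0) = (dot a (bary i) == 0).
  move=> ia; apply/idP/idP => [a0|/eqP a0]; last first.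
    exact: ev_neq0 (xi _ ia) (xi _ (bary_eq0N ia a0)).
  have [N aN] := exposes_shift ue ia.
  (* This character still does not vanish at [x] and exposes a face inside the cone [i]. By
     minimality the face is [i] itself, so [w], and with it [a], kills [bary i]. *)
  pose w := a + u *+ N + u.
  have i0w : dmon i0 w by exact: dmonD.
  have xa := xi _ ia; have xu := xi0 _ iu.
  have w0 : ev x w != 0.
    have xN := domMn hSigma N xu.
    by rewrite /w evD ?evD ?evMn ?mulf_neq0 ?expf_neq0//; exact: domD.
  have [j we] := face_exposed i0w.
  have ji0 := exposes_le we; have ii0 := exposes_le ue.
  have sum0 l : cone_le l i0 -> dot w (bary l) = 0 ->
      dot (a + u *+ N) (bary l) = 0 /\ dot u (bary l) = 0.
    move=> li0 /eqP; rewrite /w dotDl paddr_eq0; last 2 first.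
    - exact: bary_ge0 li0 aN.
    - exact: bary_ge0 li0 iu.
    by case/andP => /eqP -> /eqP ->.
  have ji : cone_le j i.
    apply/(exposes_bary ue ji0); apply: (sum0 _ ji0 _).2.
    exact/(exposes_bary we ji0)/cone_le_refl.
  have ij : cone_le i j.
    apply: contrapT => /negP nij; have := rk_lt ji nij; rewrite ltnNge minm//.
    by apply/asboolP; exists w, j.
  have /(exposes_bary we ii0)/(sum0 _ ii0)[] := ij.
  rewrite dotDl dotMnl => + ui; rewrite ui mul0rn addr0 => ->.
  exact: eqxx.
exists i; split=> // j xj.
have := sep_neq0 xi xj; rewrite ev0P; last exact: (sepl i j).1.
move=> /eqP /(exposes_bary (sepl i j) (cone_le_refl i)).
by move/cone_le_trans; apply; exact: meet_ler.
Qed.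

Lemma in_orbitN i x u : in_orbit i x -> dmon i u -> ev x u != 0 -> dmon i (- u).
Proof. by move=> [_ _ xE] iu; rewrite xE// => /eqP; exact: bary_eq0N. Qed.

Lemma act_inc t i (phi : chart k (cone i)) :
  toric_act t (inc phi) = inc (chart_act t phi).
Proof. exact: toric_act_point. Qed.

Lemma act_ev t i x : inX i x -> inX i (toric_act t x) /\
  forall u, dmon i u -> ev (toric_act t x) u = torus_fun t u * ev x u.
Proof.
move=> /inX_chart[phi ->]; rewrite act_inc; split; first exact: inX_inc.
move=> u iu; rewrite (ev_inc (chart_act t phi) iu).2 (ev_inc phi iu).2.
by rewrite (cvalE _ iu) (cvalE phi iu).
Qed.

Lemma toric_continuous_action : continuous_action (@toric_act R k n Sigma).
Proof.
split=> [x|g h x|p].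
- have [i xi] := inX_ex hSigma x; have [ti E] := act_ev 1%g xi.
  by apply: (ev_inj ti xi) => u iu; rewrite E//; exact: mul1r.
- have [i xi] := inX_ex hSigma x; have [ghi Egh] := act_ev (g * h)%g xi.
  have [hi Eh] := act_ev h xi; have [gi Eg] := act_ev g hi.
  by apply: (ev_inj ghi gi) => u iu; rewrite Egh// Eg// Eh// mulrA.
have [i xi] := inX_ex hSigma p.2.
apply: (toric_cvg _ (act_ev p.1 xi).1) => [|u iu].
  have : \forall q \near p, inX i q.2.
    by apply: (@cvg_snd _ _ (nbhs p.1) (nbhs p.2)); exact: inX_near.
  by apply: filterS => q /(act_ev q.1)[].
rewrite (act_ev p.1 xi).2//.
have c1 : (fun q : T * X => torus_fun q.1 u : C) @ p --> (torus_fun p.1 u : C).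
  apply: (@continuous_comp _ _ _ fst (fun t : T => torus_fun t u : C)).
    exact: cvg_fst.
  exact: torus_eval_continuous.
have c2 : (fun q : T * X => ev q.2 u : C) @ p --> (ev p.2 u : C).
  apply: (@continuous_comp _ _ _ snd (fun y : X => ev y u)).
    exact: cvg_snd.
  exact: ev_continuous xi.
apply: (cvg_near _ (cvgM c1 c2)).
have : \forall q \near p, inX i q.2.
  by apply: (@cvg_snd _ _ (nbhs p.1) (nbhs p.2)); exact: inX_near.
by apply: filterS => q qi; rewrite (act_ev q.1 qi).2.
Qed.

(* The phase of a point lives on the orthogonal lattice of its orbit and is
   extended to M along the projection onto this direct summand. *)
Lemma polar x : exists t : T, forall i u, inX i x -> dmon i u ->
  ev x u = torus_fun t u * (modc (ev x u))%:C.
Proof.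
have [i xo] := orbit_exists x; have [xi xmin xE] := xo.
have [p [pD pi pid]] := perp_projection i.
have p0 u : ev x (p u) != 0.
  have [ip iNp] := pi u; exact: ev_neq0 (xi _ ip) (xi _ iNp).
have tP : torus_pred k (fun u => ev x (p u) / `|ev x (p u)| : C).
  split=> [m|a b].
    split; last by rewrite normrM normfV normr_id divff// normr_eq0.
    apply: base_setM; first by apply/ev_base/xi; case: (pi m).
    rewrite -modcE -fmorphV; apply: base_set_nneg.
    by rewrite invr_ge0 modc_ge0.
  have xp m := xi _ (pi m).1.
  by rewrite pD evD// normrM invfM mulrACA.
exists (SigSub (mem_set tP)) => j u xj ju.
have [->|u0] := eqVneq (ev x u) 0; first by rewrite modc0 mulr0.
have iu := dmon_le (xmin _ xj) ju.
have -> : torus_fun (SigSub (mem_set tP)) u = ev x (p u) / `|ev x (p u)| by [].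
rewrite pid//; last exact: in_orbitN xo iu u0.
by rewrite modcE divfK// normr_eq0.
Qed.

Definition block i : set X :=
  [set x | inX i x /\ forall u, dmon i u -> modc (ev x u) <= 1].

Lemma block_barycentric i x : block i x -> exists (t : T) s k0,
  [/\ canonical s k0, below s i &
      forall u, dmon i u -> ev x u = torus_fun t u * (mono s u)%:C].
Proof.
move=> [xi x1]; have [t tE] := polar x.
have [|s [k0 [cs si sE]]] := @barycentric_exists R n Sigma hSigma i (fun u => modc (ev x u)).
  split=> [|u iu|u v iu iv]; first by rewrite (ev0 hSigma) modc1.
    by rewrite modc_ge0 x1.
  by rewrite evD ?modcM//; exact: xi.
by exists t, s, k0; split => // u iu; rewrite -sE// -(tE i).
Qed.

Lemma additive_dot (L : 'rV[int]_n -> R) : {morph L : u v / u + v} ->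
  exists w, forall u, L u = dot (lv u) w.
Proof.
move=> LD.
have L0 : L 0 = 0 by apply: (@addIr _ (L 0)); rewrite -LD !add0r.
have LN u : L (- u) = - L u.
  by apply/eqP; rewrite -addr_eq0 -LD addNr L0.
have LMn u m : L (u *+ m) = L u *+ m.
  by elim: m => [|m IH]; rewrite ?mulr0n ?L0// !mulrS LD IH.
have LZ (m : int) u : L (m *: u) = m%:~R * L u.
  case: m => m; first by rewrite -[Posz m]natz scaler_nat LMn natz mulr_natl.
  rewrite NegzE scaleNr LN -[Posz m.+1]natz scaler_nat LMn natz.
  by rewrite rmorphN mulNr mulr_natl.
exists (\row_i L (delta_mx 0 i)) => u; rewrite {1}(row_sum_delta u).
rewrite (big_morph _ LD L0); apply: eq_bigr => i _.
by rewrite LZ !mxE.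
Qed.

(** The vector [w] represents -log|x| on the characters orthogonal to the orbit cone [t]. Moving it
    towards [bary t] does not affect these characters, and a cone containing points arbitrarily far
    out on this ray is the one sought. *)
Lemma complete_block x : complete_fan Sigma -> exists i, block i x.
Proof.
move=> complete; have [t xo] := orbit_exists x; have [xt xmin xE] := xo.
have [p [pD pt pid]] := perp_projection t.
have p0 u : 0 < modc (ev x (p u)).
  rewrite lt0r modc_ge0 modc_eq0 andbT.
  have [ip iNp] := pt u; exact: ev_neq0 (xt _ ip) (xt _ iNp).
have [|w wE] := @additive_dot (fun u => - ln (modc (ev x (p u)))).
  move=> u v; rewrite pD evD ?modcM ?lnM ?opprD ?posrE ?p0//.
    exact: xt (pt u).1.
  exact: xt (pt v).1.
have cov (z : 'rV[R]_n) : exists i, cone i z.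
  have : [set: 'rV[R]_n] z by [].
  by rewrite -complete => -[s /(cone_surj hSigma)[i ->] iz]; exists i.
(* Pigeonhole: the cones cover the ray and are finitely many, so one of them contains
   [w + N%:R *: lv (bary t)] for arbitrarily large N. *)
have [i iN] : exists i : I, forall N0 : nat, exists2 N : nat, (N0 <= N)%N &
    cone i (w + N%:R *: lv (bary t)).
  apply: contrapT => /forallNP nx.
  have [f fP] : {f : I -> nat & forall i N, (f i <= N)%N ->
      ~ cone i (w + N%:R *: lv (bary t))}.
    apply: (@choice _ _ (fun i f => forall N, (f <= N)%N -> ~ cone i (w + N%:R *: lv (bary t)))).
    move=> i; have /existsNP[N0 H] := nx i; exists N0 => N N0N iN.
    by apply: H; exists N.
  have [i ii] := cov (w + (\max_i f i)%:R *: lv (bary t)).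
  by apply: (fP i _ _ ii); exact: leq_bigmax.
(* A character of [dmon i] negative on [bary t] would become negative far out on the ray. *)
have ti : cone_le t i.
  apply: bary_le => u iu; rewrite leNgt; apply/negP => ut.
  have [N0 N0u] : exists N0 : nat, dot (lv u) w < N0%:R.
    by exists (Num.truncn (dot (lv u) w)).+1; exact: truncnS_gt.
  have [N N0N /iu] := iN N0; rewrite pairingE dotDr dotZr.
  rewrite -(pairingE (lv u) (lv (bary t))) pairing_lattice leNgt => /negP; apply.
  have ut1 : (dot u (bary t))%:~R <= -1 :> R.
    by rewrite -(intrN R 1) ler_int; lia.
  have N1 : N0%:R <= N%:R :> R by rewrite ler_nat.
  have : N%:R * (dot u (bary t))%:~R <= - N%:R :> R.
    by rewrite -mulrN1 ler_wpM2l.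
  by lra.
exists i; split=> [|u iu]; first exact: inX_le ti xt.
have tu := dmon_le ti iu.
have [->|u0] := eqVneq (ev x u) 0; first by rewrite modc0 ler01.
have tNu := in_orbitN xo tu u0.
have := u0; rewrite xE// => /eqP ut.
have [N _ /iu] := iN 0%N; rewrite pairingE dotDr dotZr.
rewrite -(pairingE (lv u) (lv (bary t))) pairing_lattice ut mulr0 addr0 -wE pid//.
have u1 : modc (ev x u) \is Num.pos by rewrite posrE lt0r modc_ge0 modc_eq0 u0.
by rewrite oppr_ge0 -expR_le1 lnK.
Qed.

End Orbits.

(** * Deformation onto the blocks *)

Lemma continuous_filter (X Y : topologicalType) (f : X -> Y) :
  (forall x (F : set_system X), Filter F -> F --> x -> f @ F --> f x) -> continuous f.
Proof. by move=> fc x; apply: fc; exact: cvg_id. Qed.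

Lemma cvg_continuous (X Y : topologicalType) (f : X -> Y) (F : set_system X) x :
  {for x, continuous f} -> F --> x -> f @ F --> f x.
Proof. by move=> fx Fx A /fx; exact: Fx. Qed.

Section RealContinuity.
Variables (R : realType) (T : Type) (F : set_system T).
Context {FF : Filter F}.
Implicit Types (f g : T -> R) (a b : R).

Lemma cvg_maxr f a b : f @ F --> a -> (fun x => Num.max b (f x)) @ F --> Num.max b a.
Proof.
move=> fa; apply: (@continuous_cvg _ _ _ _ _ _ (fun z : R => Num.max b z)) => //.
by apply: (@continuous_max R R (cst b : R -> R^o) idfun a); [exact: cvg_cst|exact: cvg_id].
Qed.

Lemma cvg_minr f a b : f @ F --> a -> (fun x => Num.min b (f x)) @ F --> Num.min b a.
Proof.
move=> fa; apply: (@continuous_cvg _ _ _ _ _ _ (fun z : R => Num.min b z)) => //.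
by apply: (@continuous_min R R (cst b : R -> R^o) idfun a); [exact: cvg_cst|exact: cvg_id].
Qed.

Lemma cvg_prodr (I : Type) (r : seq I) (P : pred I) (f : I -> T -> R) (a : I -> R) :
  (forall i, P i -> f i @ F --> a i) ->
  (fun x => \prod_(i <- r | P i) f i x) @ F --> \prod_(i <- r | P i) a i.
Proof. by move=> fa; apply: cvg_big => //; exact: mul_continuous. Qed.

Lemma cvg_sumr (I : Type) (r : seq I) (P : pred I) (f : I -> T -> R) (a : I -> R) :
  (forall i, P i -> f i @ F --> a i) ->
  (fun x => \sum_(i <- r | P i) f i x) @ F --> \sum_(i <- r | P i) a i.
Proof. by move=> fa; apply: cvg_big => //; exact: add_continuous. Qed.

Lemma cvg_exprr f a m : f @ F --> a -> (fun x => f x ^+ m) @ F --> a ^+ m.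
Proof. exact: (@cvg_expr R T F f FF a m). Qed.

End RealContinuity.

Section Weights.
Variables (R : realType) (k : base) (n : nat) (Sigma : set (set 'rV[R]_n)).
Hypothesis hSigma : rational_fan Sigma.

Local Notation I := 'I_(ncones hSigma).
Local Notation cone_le := (@cone_le R n Sigma hSigma).
Local Notation sep := (@sep R n Sigma hSigma).
Local Notation X := (toric_variety k Sigma).
Local Notation inX := (@inX R k n Sigma hSigma).
Local Notation in_orbit := (@in_orbit R k n Sigma hSigma).
Local Notation block := (@block R k n Sigma hSigma).
(** One more than the number of cones, so that #|A| < N is strict for every set A of cones and N is
    positive. *)
Local Notation N := (ncones hSigma).+1.

(* A continuous function on X, positive exactly on the chart of the cone i. *)
Definition chart_bump i (x : X) : R :=
  if `[< inX i x >] then \prod_j (Num.max 1 (modc (ev x (sep i j))))^-1 else 0.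

Lemma max1_gt0 (r : R) : 0 < Num.max 1 r.
Proof. by rewrite lt_max ltr01. Qed.

Lemma max1_le1 (r : R) : 0 <= (Num.max 1 r)^-1 <= 1.
Proof. by rewrite invr_ge0 ltW ?max1_gt0//= invf_le1 ?max1_gt0// le_max lexx. Qed.

Lemma chart_bump_ge0 i x : 0 <= chart_bump i x.
Proof.
rewrite /chart_bump; case: ifP => // _; apply: prodr_ge0 => j _.
by have /andP[] := max1_le1 (modc (ev x (sep i j))).
Qed.

Lemma chart_bump_le1 i x : chart_bump i x <= 1.
Proof.
by rewrite /chart_bump; case: ifP => // _; apply: prodr_ile1 => j _; exact: max1_le1.
Qed.

Lemma chart_bump_gt0 i x : inX i x -> 0 < chart_bump i x.
Proof.
move=> xi; rewrite /chart_bump asboolT//; apply: prodr_gt0 => j _.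
by rewrite invr_gt0 max1_gt0.
Qed.

Lemma chart_bump_eq0 i x : ~ inX i x -> chart_bump i x = 0.
Proof. by move=> xi; rewrite /chart_bump asboolF. Qed.

Lemma chart_bump_block i x : block i x -> chart_bump i x = 1.
Proof.
move=> [xi x1]; rewrite /chart_bump asboolT// big1// => j _.
by rewrite max_l ?invr1// x1//; case: (sepl i j).
Qed.

(** At a point outside of the chart [i], the opposite of the separating character tends to 0; its
    modulus bounds the bump nearby, since it is the inverse of the modulus appearing in the factor
    of index [j]. *)
Lemma chart_bump_continuous i : continuous (chart_bump i).
Proof.
apply: continuous_filter => x F FF Fx; have [xi|xi] := pselect (inX i x).
  apply: (@cvg_near _ _ _ _ (fun y => \prod_j (Num.max 1 (modc (ev y (sep i j))))^-1)).
    by apply: filterS (Fx _ (inX_near xi)) => y yi; rewrite /chart_bump asboolT.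
  rewrite /chart_bump asboolT//; apply: cvg_prodr => j _.
  apply: cvgV; first by rewrite gt_eqF// max1_gt0.
  apply: cvg_maxr; apply: cvg_modc.
  exact: cvg_continuous (ev_continuous (sepl i j).1 xi) Fx.
rewrite (chart_bump_eq0 xi); have [j xj] := inX_ex hSigma x.
have jN := (sepr i j).1.
have xs0 : ev x (- sep i j) = 0.
  apply: contrapT => /eqP s0; apply: xi; apply: inX_le (meet_lel i j) _.
  exact: inX_exposed (sepr i j) xj s0.
have c0 : (fun y => modc (ev y (- sep i j))) @ F --> (0 : R).
  rewrite -(modc0 R) -xs0; apply: cvg_modc.
  exact: cvg_continuous (ev_continuous jN xj) Fx.
apply: (squeeze_cvgr _ _ c0); last exact: (cvg_cst (0 : R)).
apply: filterS (Fx _ (inX_near xj)) => y yj; rewrite chart_bump_ge0 /=.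
have [yi|yi] := pselect (inX i y); last by rewrite chart_bump_eq0// modc_ge0.
rewrite /chart_bump asboolT// (bigD1 j)//=.
apply: (@le_trans _ _ (Num.max 1 (modc (ev y (sep i j))))^-1).
  rewrite ler_piMr//; first by have /andP[] := max1_le1 (modc (ev y (sep i j))).
  by apply: prodr_ile1 => l _; exact: max1_le1.
have yE := evN hSigma (yi _ (sepl i j).1) (yj _ jN).
have s0 := sep_neq0 yi yj.
rewrite -[leRHS](mulKf (x := modc (ev y (sep i j)))) ?modc_eq0//.
rewrite -modcM yE modc1 mulr1 lef_pV2 ?posrE ?max1_gt0//.
  by rewrite le_max lexx orbT.
by rewrite lt0r modc_eq0 s0 modc_ge0.
Qed.

Lemma chart_bump_act t i x : chart_bump i (toric_act t x) = chart_bump i x.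
Proof.
have [xi|xi] := pselect (inX i x).
  have [txi tE] := act_ev t xi; rewrite /chart_bump !asboolT//.
  apply: eq_bigr => j _; rewrite tE ?modcM; last by case: (sepl i j).
  by have [/(_ (sep i j))[_ /modc_eq1 ->] _] := torusP t; rewrite mul1r.
rewrite !chart_bump_eq0// => txi; apply: xi.
have [a1 aM _] := @toric_continuous_action R k n Sigma hSigma.
by rewrite -[x](a1 x) -(mulVg t) aM; have [] := act_ev (t^-1)%g txi.
Qed.

(* Vanishes exactly on the closure of the orbit of the cone i, and is 1 on the
   blocks that do not meet it. *)
Definition stratum_dist i (x : X) : R :=
  1 - \prod_(j | ~~ cone_le i j) (1 - chart_bump j x).

Lemma stratum_dist_01 i x : 0 <= stratum_dist i x <= 1.
Proof.
have b j : 0 <= 1 - chart_bump j x <= 1.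
  by rewrite subr_ge0 chart_bump_le1 gerBl chart_bump_ge0.
rewrite /stratum_dist subr_ge0 gerBl prodr_ile1 ?prodr_ge0// => j _.
by have /andP[] := b j.
Qed.

Lemma stratum_dist_continuous i : continuous (stratum_dist i).
Proof.
apply: continuous_filter => x F FF Fx; apply: cvgB; first exact: cvg_cst.
apply: cvg_prodr => j _; apply: cvgB; first exact: cvg_cst.
exact: cvg_continuous (@chart_bump_continuous j x) Fx.
Qed.

Lemma stratum_dist_block i j x : block j x -> ~~ cone_le i j -> stratum_dist i x = 1.
Proof.
move=> xj ij; rewrite /stratum_dist (bigD1 j)//= chart_bump_block//.
by rewrite subrr mul0r subr0.
Qed.

Lemma stratum_dist_orbit i x : in_orbit i x -> stratum_dist i x = 0.
Proof.
move=> [_ xmin _]; rewrite /stratum_dist big1 ?subrr// => j ij.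
by rewrite chart_bump_eq0 ?subr0// => /xmin; exact/negP.
Qed.

Lemma stratum_dist_gt0 i j x : inX j x -> ~~ cone_le i j -> 0 < stratum_dist i x.
Proof.
move=> xj ij; rewrite subr_gt0 (bigD1 j)//=.
apply: (@le_lt_trans _ _ (1 - chart_bump j x)).
  rewrite ler_piMr ?subr_ge0 ?chart_bump_le1//; apply: prodr_ile1 => l _.
  by rewrite subr_ge0 chart_bump_le1 gerBl chart_bump_ge0.
by rewrite ltrBlDr ltrDl chart_bump_gt0.
Qed.

(** No cone of the fan contains all members of [A]: the corresponding orbit closures have no common
    point. *)
Definition unbounded (A : {set I}) := ~~ [exists r, [forall i in A, cone_le i r]].

(** All factors lie in (0, 1], so the product is a positive continuous lower bound for every sum of
    distances over an unbounded set. *)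
Definition gap (x : X) : R :=
  \prod_(A | unbounded A) Num.min 1 (\sum_(i in A) stratum_dist i x).

Lemma sum_dist_gt0 A x : unbounded A -> 0 < \sum_(i in A) stratum_dist i x.
Proof.
move=> bA; have [j xj] := inX_ex hSigma x.
have [i iA ij] : exists2 i, i \in A & ~~ cone_le i j.
  apply: contrapT => ni; move/negP: bA; apply; apply/existsP; exists j.
  apply/forall_inP => i iA; apply: contrapT => /negP ij; apply: ni.
  by exists i.
rewrite (bigD1 i)//= ltr_pwDl ?(stratum_dist_gt0 xj)//.
by apply: sumr_ge0 => l _; have /andP[] := stratum_dist_01 l x.
Qed.

Lemma gap_gt0 x : 0 < gap x.
Proof. by apply: prodr_gt0 => A bA; rewrite lt_min ltr01 sum_dist_gt0. Qed.

Lemma gap_le_term A x : unbounded A ->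
  gap x <= Num.min 1 (\sum_(i in A) stratum_dist i x).
Proof.
have t01 B : unbounded B -> 0 <= Num.min 1 (\sum_(i in B) stratum_dist i x) <= 1.
  by move=> bB; rewrite le_min ler01 ltW ?sum_dist_gt0//= ge_min lexx.
move=> bA; rewrite /gap (bigD1 A)//= ler_piMr//; first by have /andP[] := t01 _ bA.
by apply: prodr_ile1 => B /andP[bB _]; exact: t01.
Qed.

Lemma gap_le1 x : gap x <= 1.
Proof.
apply: prodr_ile1 => A bA.
by rewrite le_min ler01 ltW ?sum_dist_gt0//= ge_min lexx.
Qed.

Lemma gap_continuous : continuous gap.
Proof.
apply: continuous_filter => x F FF Fx.
apply: cvg_prodr => A _; apply: cvg_minr; apply: cvg_sumr => i _.
exact: cvg_continuous (@stratum_dist_continuous i x) Fx.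
Qed.

Lemma active_bounded x : exists r, forall i,
  N%:R * stratum_dist i x < gap x -> cone_le i r.
Proof.
pose A := [set i : I | N%:R * stratum_dist i x < gap x]%SET.
have [bA|] := boolP (unbounded A); last first.
  move=> /negPn/existsP[r /forall_inP rA]; exists r => i ix; apply: rA.
  by rewrite inE.
exfalso; have := gap_le_term x bA; rewrite le_min => /andP[_].
rewrite leNgt => /negP; apply.
rewrite -(@ltr_pM2l _ N%:R)// mulr_sumr.
apply: (@le_lt_trans _ _ (\sum_(i in A) gap x)).
  by apply: ler_sum => i; rewrite inE => /ltW.
rewrite sumr_const -[ltLHS]mulr_natl ltr_pM2r ?gap_gt0// ltr_nat ltnS.
by rewrite (leq_trans (max_card _))// card_ord.
Qed.

(* With N the number of cones, the cones i such that [push i x < 1] have an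
   upper bound: otherwise their distances would add up to at least the gap. *)
Definition push i (x : X) : R := Num.min 1 (2 * N%:R * stratum_dist i x / gap x).

Lemma push01 i x : 0 <= push i x <= 1.
Proof.
rewrite le_min ler01 ge_min lexx andbT/= divr_ge0 ?(ltW (gap_gt0 x))//.
by rewrite mulr_ge0//; have /andP[] := stratum_dist_01 i x.
Qed.

Lemma ratio_continuous i :
  continuous (fun x => 2 * N%:R * stratum_dist i x / gap x : R).
Proof.
apply: continuous_filter => x F FF Fx; apply: cvgM; last first.
  apply: cvgV; first by rewrite gt_eqF// gap_gt0.
  exact: cvg_continuous (@gap_continuous x) Fx.
apply: cvgM; first exact: cvg_cst.
exact: cvg_continuous (@stratum_dist_continuous i x) Fx.
Qed.

Lemma push_continuous i : continuous (push i).
Proof.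
apply: continuous_filter => x F FF Fx; apply: cvg_minr.
exact: cvg_continuous (@ratio_continuous i x) Fx.
Qed.

Lemma push_orbit i x : in_orbit i x -> push i x = 0.
Proof.
by move=> xi; rewrite /push stratum_dist_orbit// mulr0 mul0r min_r.
Qed.

Lemma push_block i j x : block j x -> push i x < 1 -> cone_le i j.
Proof.
move=> xj; apply: contraTT => ij; rewrite -leNgt /push (stratum_dist_block xj ij).
rewrite le_min lexx/= mulr1 ler_pdivlMr ?gap_gt0// mul1r (le_trans (gap_le1 x))//.
by rewrite -natrM ler1n.
Qed.

Lemma push_act t i x : push i (toric_act t x) = push i x.
Proof.
have sE j : stratum_dist j (toric_act t x) = stratum_dist j x.
  by congr (1 - _); apply: eq_bigr => l _; rewrite chart_bump_act.
rewrite /push sE (_ : gap (toric_act t x) = gap x)//.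
by apply: eq_bigr => A _; congr Num.min; apply: eq_bigr.
Qed.

(** The factor 2 in [push] provides openness. A cone not below the bound [r] obtained at [x] has
    [N%:R * stratum_dist i x >= gap x], so the ratio in [push] is at least 2 at [x] and exceeds 1
    nearby: a single chart [r] serves a whole neighborhood. *)
Lemma push_near x : exists r, inX r x /\
  \forall y \near x, inX r y /\ forall i, push i y < 1 -> cone_le i r.
Proof.
have [r rP] := active_bounded x; exists r.
have [t xt] := orbit_exists hSigma x.
have xr : inX r x.
  apply: inX_le (rP t _) _; last by case: xt.
  by rewrite (stratum_dist_orbit xt) mulr0 gap_gt0.
split=> //; apply: filterI; first exact: inX_near.
have FF := nbhs_filter x; apply: (@filter_forall _ _ _ (nbhs x) FF) => i.
have [ir|ir] := boolP (cone_le i r).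
  exact: nearW.
have i1 : N%:R * stratum_dist i x / gap x >= 1.
  rewrite ler_pdivlMr ?gap_gt0// mul1r leNgt; apply/negP => /rP.
  exact/negP.
have : (1 : R) < 2 * N%:R * stratum_dist i x / gap x.
  have -> : 2 * N%:R * stratum_dist i x / gap x = 2 * (N%:R * stratum_dist i x / gap x).
    by rewrite !mulrA.
  by apply: (@lt_le_trans _ _ 2); [rewrite ltr1n|rewrite ler_peMr].
have c := @ratio_continuous i x.
move=> /(cvgr_gt _ c); apply: filterS => y y1.
by rewrite /push min_l ?ltxx// ltW.
Qed.

End Weights.

Section PhasePower.
Variable R : realType.
Local Notation C := (R[i]^o).

(* z |-> z |z|^(q-1), extended by 0 at 0; continuous in (q, z) except at (0, 0). *)
Definition phase_power (q : R) (z : R[i]) : R[i] :=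
  if z == 0 then 0 else z / `|z| * (modc z `^ q)%:C.

Lemma phase_power0 q : phase_power q 0 = 0.
Proof. by rewrite /phase_power eqxx. Qed.

Lemma phase_power1 z : phase_power 1 z = z.
Proof.
rewrite /phase_power; case: eqP => [->//|/eqP z0].
by rewrite powRr1 ?modc_ge0// modcE divfK// normr_eq0.
Qed.

Lemma phase_power_one q : phase_power q 1 = 1.
Proof. by rewrite /phase_power oner_eq0 modc1 powR1 normr1 divr1 mulr1. Qed.

Lemma phase_powerM q z w : phase_power q (z * w) = phase_power q z * phase_power q w.
Proof.
rewrite /phase_power mulf_eq0; case: eqP => [_|_] /=; first by rewrite mul0r.
case: eqP => [_|_]; first by rewrite mulr0.
rewrite normrM modcM (powRM _ (modc_ge0 _) (modc_ge0 _)) rmorphM/= invfM.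
by rewrite (mulrACA z) [LHS]mulrACA.
Qed.

Lemma phase_power_unit q z w : `|z| = 1 -> phase_power q (z * w) = z * phase_power q w.
Proof.
move=> z1; rewrite phase_powerM; congr (_ * _).
have z0 : z != 0 by rewrite -normr_eq0 z1 oner_eq0.
by rewrite /phase_power (negPf z0) modc_eq1// powR1 z1 divr1 mulr1.
Qed.

Lemma modc_phase_power q z :
  modc (phase_power q z) = if z == 0 then 0 else modc z `^ q.
Proof.
rewrite /phase_power; case: eqP => [_|/eqP z0]; first exact: modc0.
have m1 : modc `|z| = modc z by rewrite -modcE modc_real (ger0_norm (modc_ge0 z)).
rewrite 2!modcM modcV modc_real (ger0_norm (powR_ge0 _ _)) m1 divff ?mul1r//.
by rewrite modc_eq0.
Qed.

Lemma base_set_phase_power k q z : base_set k z -> base_set k (phase_power q z).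
Proof.
move=> kz; rewrite /phase_power; case: eqP => [_|_].
  by rewrite -[0]/(0%:C); exact: base_set_nneg.
rewrite -mulrA; apply: base_setM => //; rewrite -modcE -fmorphV -rmorphM.
by apply: base_set_nneg; rewrite mulr_ge0 ?invr_ge0 ?modc_ge0 ?powR_ge0.
Qed.

Lemma cvg_phase_power (T : Type) (F : set_system T) {FF : Filter F}
    (q : T -> R) (z : T -> C) (q0 : R) (z0 : C) : z0 != 0 ->
  q @ F --> q0 -> z @ F --> z0 ->
  (fun x => phase_power (q x) (z x) : C) @ F --> (phase_power q0 z0 : C).
Proof.
move=> z00 cq cz.
have cm : (fun x => modc (z x)) @ F --> modc z0 by exact: cvg_modc.
have m0 : 0 < modc z0 by rewrite lt0r modc_eq0 z00 modc_ge0.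
have near0 : \forall x \near F, 0 < modc (z x) by exact: cvgr_gt cm _ m0.
have pE (r : R) (w : C) : 0 < modc w ->
    phase_power r w = w * ((modc w)^-1 * expR (r * ln (modc w)))%:C.
  move=> w0; have w00 : w != 0 by rewrite -modc_eq0 gt_eqF.
  by rewrite /phase_power (negPf w00) /powR gt_eqF// rmorphM fmorphV/= modcE mulrA.
apply: (cvg_near (f := fun x => z x *
    ((modc (z x))^-1 * expR (q x * ln (modc (z x))))%:C : C)).
  by apply: filterS near0 => x /pE ->.
have m00 : modc z0 != 0 by rewrite gt_eqF.
have cl : (fun x => ln (modc (z x))) @ F --> ln (modc z0).
  exact: (cvg_continuous (F := (fun x => modc (z x)) @ F) (continuous_ln m0) cm).
have cE : (fun x => expR (q x * ln (modc (z x)))) @ F --> expR (q0 * ln (modc z0)).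
  exact: (cvg_continuous (F := (fun x => q x * ln (modc (z x))) @ F)
    (@continuous_expR R _) (cvgM cq cl)).
have cm' : (fun x => (modc (z x))^-1 * expR (q x * ln (modc (z x)))) @ F -->
    (modc z0)^-1 * expR (q0 * ln (modc z0)) by exact: (cvgM (cvgV m00 cm) cE).
have cr : (fun x => ((modc (z x))^-1 * expR (q x * ln (modc (z x))))%:C : C) @ F -->
    (((modc z0)^-1 * expR (q0 * ln (modc z0)))%:C : C) by exact: cvg_real_complex.
have cc := cvgM cz cr.
have -> : (phase_power q0 z0 : C) =
    (z0 : C) * ((modc z0)^-1 * expR (q0 * ln (modc z0)))%:C by exact: pE.
exact: cc.
Qed.

(** If q <= e, then a ^ q <= 1 suffices; if q > e, then a ^ q <= a ^ e <= e as soon as a <= e ^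
    (1/e), whence the constant. The uniformity in q handles the approach to exponent 0. *)
Lemma powR_uniform_small (e : R) : 0 < e -> exists2 d, 0 < d <= 1 &
  forall a q, 0 < a < d -> 0 <= q <= 1 -> q * a `^ q <= e.
Proof.
move=> e0; exists (Num.min 1 (e `^ e^-1)).
  by rewrite lt_min ltr01 powR_gt0//= ge_min lexx.
move=> a q /andP[a0]; rewrite lt_min => /andP[a1 ae] /andP[q0 q1].
have a01 : 0 < a <= 1 by rewrite a0 ltW.
have [qe|eq] := leP q e.
  apply: le_trans qe; rewrite ler_piMr// -(powRr0 a).
  exact: ger_powR.
apply: (@le_trans _ _ (a `^ q)); first by rewrite ler_piMl// powR_ge0.
apply: (@le_trans _ _ (a `^ e)); first by apply: ger_powR => //; exact: ltW.
rewrite [leRHS](_ : e = (e `^ e^-1) `^ e); last by rewrite -powRrM mulVf ?powRr1 ?gt_eqF// ltW.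
by apply: ge0_ler_powR; rewrite ?nnegrE ?powR_ge0 ?ltW.
Qed.

End PhasePower.

Section Deformation.
Variables (R : realType) (k : base) (n : nat) (Sigma : set (set 'rV[R]_n)).
Hypothesis hSigma : rational_fan Sigma.

Local Notation I := 'I_(ncones hSigma).
Local Notation dmon := (@dmon R n Sigma hSigma).
Local Notation cone_le := (@cone_le R n Sigma hSigma).
Local Notation meet := (@meet R n Sigma hSigma).
Local Notation X := (toric_variety k Sigma).
Local Notation C := (R[i]^o).
Local Notation inX := (@inX R k n Sigma hSigma).
Local Notation ht := (@ht R n Sigma hSigma).
Local Notation mono := (@mono R n Sigma hSigma).
Local Notation below := (@below R n Sigma hSigma).
Local Notation block := (@block R k n Sigma hSigma).
Local Notation push := (@push R k n Sigma hSigma).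

(** A formula multiplicative on the larger monoid of the meet defines a point there, which restricts
    to both charts. It is the means of changing the chart in which a point is given by a formula. *)
Lemma rep_transfer i j (y : X) (h : 'rV[int]_n -> C) : h 0 = 1 ->
  (forall u, dmon (meet i j) u -> base_set k (h u)) ->
  (forall u v, dmon (meet i j) u -> dmon (meet i j) v -> h (u + v) = h u * h v) ->
  inX i y -> (forall u, dmon i u -> ev y u = h u) ->
  inX j y /\ forall u, dmon j u -> ev y u = h u.
Proof.
move=> h0 hk hD yi yE; have [z [zm zE]] := make_point h0 hk hD.
have zi := inX_le (meet_lel i j) zm.
have -> : y = z.
  apply: (ev_inj yi zi) => u iu; rewrite yE// zE//.
  exact: dmon_le (meet_lel i j) iu.
split=> [|u ju]; first exact: inX_le (meet_ler i j) zm.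
by rewrite zE//; exact: dmon_le (meet_ler i j) ju.
Qed.

Definition pushed (x : X) (p : R) (i : I) : R := 1 - p + p * push i x.

Definition deform_val (x : X) (p : R) u : C :=
  phase_power (1 - p) (ev x u) * (mono (pushed x p) u)%:C.

Definition supported i (x : X) := inX i x /\ forall l, push l x < 1 -> cone_le l i.

(** The chart is existentially quantified, and [deformP] shows that any supported chart gives the
    same point. For times in [0, 1] the fallback [q.1] never occurs. *)
Definition deform (q : X * R) : X := xget q.1 [set y | exists i,
  [/\ supported i q.1, inX i y & forall u, dmon i u -> ev y u = deform_val q.1 q.2 u]].

Section Fixed.
Variable p : R.
Hypothesis p01 : 0 <= p <= 1.

Lemma pushed_weight x : weight (pushed x p).
Proof.
move=> i; have /andP[s0 s1] := push01 i x; move: p01 => /andP[p0 p1].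
rewrite /pushed addr_ge0 ?subr_ge0 ?mulr_ge0//=.
by rewrite -lerBrDl opprB addrC subrK ler_piMr.
Qed.

Lemma pushed_lt1 x i : pushed x p i < 1 -> push i x < 1.
Proof.
rewrite /pushed; apply: contraTT; rewrite -!leNgt => s1.
move: p01 => /andP[p0 p1]; rewrite -lerBlDl opprB addrC subrK.
by rewrite ler_peMr.
Qed.

Lemma pushed_below x i : supported i x -> below (pushed x p) i.
Proof. by move=> [_ si] l /pushed_lt1/si. Qed.

Lemma deform_val0 x : deform_val x p 0 = 1.
Proof. by rewrite /deform_val (ev0 hSigma) phase_power_one mono0 mulr1. Qed.

Lemma deform_val_base x i u : inX i x -> dmon i u -> base_set k (deform_val x p u).
Proof.
move=> xi iu; apply: base_setM.
  by apply: base_set_phase_power; apply: ev_base hSigma _ _ _; exact: xi.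
by apply: base_set_nneg; apply: mono_ge0; exact: pushed_weight.
Qed.

Lemma deform_valD x i u v : supported i x -> dmon i u -> dmon i v ->
  deform_val x p (u + v) = deform_val x p u * deform_val x p v.
Proof.
move=> si iu iv; rewrite /deform_val (evD hSigma); [|exact: si.1|exact: si.1].
rewrite phase_powerM (monoD (pushed_weight x) (pushed_below si) iu iv).
by rewrite rmorphM/= mulrACA.
Qed.

Lemma supported_meet x i j : supported i x -> supported j x -> supported (meet i j) x.
Proof.
move=> [xi si] [xj sj]; split; first exact: inX_meet.
by move=> l xl; apply: le_meet; [exact: si|exact: sj].
Qed.

Lemma supported_exists x : exists i, supported i x.
Proof.
by have [r [_ /nbhs_singleton]] := push_near hSigma x; exists r.
Qed.

Lemma deformP x i : supported i x -> inX i (deform (x, p)) /\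
  forall u, dmon i u -> ev (deform (x, p)) u = deform_val x p u.
Proof.
move=> si; have [y [yi yE]] := make_point (deform_val0 x)
  (fun u => @deform_val_base x i u si.1) (fun u v => @deform_valD x i u v si).
rewrite /deform; case: xgetP => /= [z _ [j [sj zj zE]]|/(_ y)]; last first.
  by move=> []; exists i.
have sm := supported_meet sj si.
apply: (rep_transfer (deform_val0 x)) zj zE.
  by move=> u; apply: deform_val_base; exact: sm.1.
by move=> u v; exact: deform_valD.
Qed.

Lemma modc_deform_val x u : modc (deform_val x p u) =
  modc (phase_power (1 - p) (ev x u)) * mono (pushed x p) u.
Proof.
rewrite modcM modc_real ger0_norm//; apply: mono_ge0; exact: pushed_weight.
Qed.

Lemma supported_block x i : block i x -> supported i x.
Proof. by move=> bi; split=> [|l]; [case: bi|exact: push_block]. Qed.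

Lemma deform_block x i : block i x -> block i (deform (x, p)).
Proof.
move=> bi; have [di dE] := deformP (supported_block bi); split=> // u iu.
rewrite dE// modc_deform_val mulr_ile1 ?modc_ge0//.
- by apply: mono_ge0; exact: pushed_weight.
- rewrite modc_phase_power; case: eqP => // /eqP z0.
  rewrite -[leRHS](powRr0 (modc (ev x u))); apply: ger_powR.
    by rewrite lt0r modc_eq0 z0 modc_ge0 bi.2.
  by rewrite subr_ge0; case/andP: p01.
- by apply: mono_le1; exact: pushed_weight.
Qed.

Lemma deform_act t x : deform (toric_act t x, p) = toric_act t (deform (x, p)).
Proof.
have [i si] := supported_exists x; have [di dE] := deformP si.
have [txi tE] := act_ev t si.1; have [tdi tdE] := act_ev t di.
have si' : supported i (toric_act t x).
  by split=> // l; rewrite push_act; exact: si.2.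
have [di' dE'] := deformP si'.
apply: (ev_inj di' tdi) => u iu; rewrite dE'// tdE// dE//.
rewrite /deform_val tE// phase_power_unit ?mulrA; last first.
  by have [/(_ u)[]] := torusP t.
congr (_ * (_)%:C); apply: eq_bigr => l _.
by rewrite /pushed push_act.
Qed.

End Fixed.

Lemma deform0 x : deform (x, 0) = x.
Proof.
have p01 : 0 <= (0 : R) <= 1 by rewrite lexx ler01.
have [i si] := supported_exists x; have [di dE] := deformP p01 si.
apply: (ev_inj di si.1) => u iu; rewrite dE// /deform_val subr0 phase_power1.
rewrite mono_eq1 ?mulr1//; first exact: pushed_weight.
by move=> l; rewrite /pushed subr0 mul0r addr0 ltxx.
Qed.

(** At time 1 the exponent of the modulus is 0, so the first factor has modulus 0 or 1 and the
    monomial is at most 1. *)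
Lemma deform1_block x : exists i, block i (deform (x, 1)).
Proof.
have p01 : 0 <= (1 : R) <= 1 by rewrite lexx ler01.
have [i si] := supported_exists x; have [di dE] := deformP p01 si.
exists i; split=> // u iu; rewrite dE// modc_deform_val// subrr modc_phase_power.
rewrite powRr0 mulr_ile1 ?mono_ge0 ?mono_le1//; try exact: pushed_weight.
  by case: ifP.
by case: ifP.
Qed.

Lemma mono_le_factor s u l : weight s -> ht u l != 0%N -> mono s u <= s l.
Proof.
move=> ws; case E : (ht u l) => [//|m] _; rewrite /mono (bigD1 l)//= E exprS.
rewrite -mulrA ler_piMr ?(weight_ge0 ws)// mulr_ile1 ?exprn_ge0 ?(weight_ge0 ws)//.
- by apply: prodr_ge0 => j _; rewrite exprn_ge0 ?(weight_ge0 ws).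
- by rewrite exprn_ile1 ?(weight_ge0 ws) ?(weight_le1 ws).
- apply: prodr_ile1 => j _.
  by rewrite exprn_ge0 ?exprn_ile1 ?(weight_ge0 ws) ?(weight_le1 ws).
Qed.

Section DeformCvg.
Variables (x0 : X) (p0 : R) (F : set_system (X * R)).
Context {FF : Filter F}.
Hypothesis F01 : \forall q \near F, 0 <= q.2 <= 1.
Hypothesis Fx : (fun q => q.1) @ F --> x0.
Hypothesis Fp : (fun q => q.2) @ F --> p0.

Lemma cvg_pushed i : (fun q => pushed q.1 q.2 i) @ F --> pushed x0 p0 i.
Proof.
apply: cvgD; first by apply: cvgB => //; exact: cvg_cst.
apply: cvgM => //.
exact: (cvg_continuous (F := (fun q => q.1) @ F) (@push_continuous R k n Sigma hSigma i x0) Fx).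
Qed.

(** Where the limit value is 0, [phase_power] may be discontinuous. The orbit cone [t] of the limit
    has positive height at [u], so the monomial is at most 1 - p + p * [push t]. The first summand
    is absorbed by [powR_uniform_small], the second one by the continuity of [push t], which
    vanishes at the limit. *)
Lemma cvg_deform_val r u : inX r x0 -> dmon r u ->
  (fun q => deform_val q.1 q.2 u) @ F --> deform_val x0 p0 u.
Proof.
move=> xr ru.
have cev : (fun q => ev q.1 u) @ F --> ev x0 u.
  exact: (cvg_continuous (F := (fun q => q.1) @ F) (ev_continuous ru xr) Fx).
have [z0|z0] := eqVneq (ev x0 u) 0; last first.
  have c1 : (fun q : X * R => phase_power (1 - q.2) (ev q.1 u) : C) @ F -->
      (phase_power (1 - p0) (ev x0 u) : C).
    by apply: cvg_phase_power => //; apply: cvgB => //; exact: cvg_cst.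
  apply: (cvgM c1); apply: cvg_real_complex; apply: cvg_prodr => i _.
  by apply: cvg_exprr; exact: cvg_pushed.
rewrite [X in _ --> X]/deform_val z0 phase_power0 mul0r.
apply/cvgC_modc => e e0.
have [t [xt xmin xE]] := orbit_exists hSigma x0.
have tr := xmin _ xr; have tu := dmon_le tr ru.
have htu : ht u t != 0%N by rewrite ht_eq0 -xE// z0 eqxx.
have e3 : 0 < e / 3 by rewrite divr_gt0.
have [d /andP[d0 d1] dP] := powR_uniform_small e3.
have ct : (fun q => push t q.1) @ F --> (0 : R).
  rewrite -(push_orbit (k := k) (x := x0) (i := t) (hSigma := hSigma))//.
  exact: (cvg_continuous (F := (fun q => q.1) @ F) (@push_continuous R k n Sigma hSigma t x0) Fx).
have n1 : \forall q \near F, push t q.1 < e / 3 by exact: cvgr_lt ct _ e3.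
have n2 : \forall q \near F, modc (ev q.1 u) < d.
  by apply: cvgr_lt _ d0; rewrite -(modc0 R) -z0; exact: cvg_modc.
apply: filterS (filterI F01 (filterI n1 n2)) => -[x p] /= [p01 [s1 zd]].
rewrite sub0r modcN modc_deform_val// modc_phase_power.
case: eqP => [_|/eqP zn0]; first by rewrite mul0r.
have a0 : 0 < modc (ev x u) by rewrite lt0r modc_eq0 zn0 modc_ge0.
move: (p01) => /andP[p0' p1].
have q01 : 0 <= 1 - p <= 1 by rewrite subr_ge0 p1 gerBl.
have /andP[sg0 sg1] := push01 t x.
apply: (@le_lt_trans _ _ (modc (ev x u) `^ (1 - p) * pushed x p t)).
  rewrite ler_wpM2l ?powR_ge0//; apply: mono_le_factor => //.
  exact: pushed_weight.
rewrite /pushed mulrDr.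
have b1 : modc (ev x u) `^ (1 - p) * (1 - p) <= e / 3.
  by rewrite mulrC; apply: dP => //; rewrite a0.
have b2 : modc (ev x u) `^ (1 - p) * (p * push t x) <= e / 3.
  apply: (@le_trans _ _ (push t x)); last exact: ltW.
  rewrite mulrA ler_piMl// mulr_ile1 ?powR_ge0//.
  rewrite -[leRHS](powRr0 (modc (ev x u))); apply: ger_powR; last by case/andP: q01.
  by rewrite a0 (le_trans (ltW zd)).
by lra.
Qed.

(** Stated for filters eventually inside the time interval, so as to cover both the homotopies
    within [0, 1] and the retraction at fixed time 1. *)
Lemma cvg_deform : 0 <= p0 <= 1 -> deform @ F --> deform (x0, p0).
Proof.
move=> p001; have [r [xr near_r]] := push_near hSigma x0.
have sr : supported r x0 by split=> //; case: (nbhs_singleton near_r).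
have [dr dE] := deformP p001 sr.
have Fr : \forall q \near F, supported r q.1 by exact: (Fx near_r).
apply: (toric_cvg _ dr).
  suff : F [set q | inX r (deform q)] by [].
  by apply: filterS (filterI F01 Fr) => -[x p] /= [p01 /(deformP p01)[]].
move=> u ru; rewrite dE//.
apply: (cvg_near (f := fun q => deform_val q.1 q.2 u)).
  by apply: filterS (filterI F01 Fr) => -[x p] /= [p01 /(deformP p01)[_ ->]].
exact: cvg_deform_val xr ru.
Qed.

End DeformCvg.

End Deformation.

(** * Equivariant cells *)

Section DiskCube.
Variables (R : realType) (m : nat).
Implicit Types (x y : 'rV[R]_m) (c : R).

Definition l2norm x : R := Num.sqrt (\sum_i x 0 i ^+ 2).
Definition supnorm x : R := \big[Num.max/0]_i `|x 0 i|.

Lemma l2norm_sqr x : l2norm x ^+ 2 = \sum_i x 0 i ^+ 2.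
Proof. by rewrite sqr_sqrtr// sumr_ge0// => i _; exact: sqr_ge0. Qed.

Lemma l2norm_ge0 x : 0 <= l2norm x.
Proof. exact: sqrtr_ge0. Qed.

Lemma supnorm_ge x i : `|x 0 i| <= supnorm x.
Proof. exact: le_bigmax. Qed.

Lemma supnorm_ge0 x : 0 <= supnorm x.
Proof. exact: bigmax_ge_id. Qed.

Lemma supnorm_le_l2norm x : supnorm x <= l2norm x.
Proof.
apply: bigmax_le => [|i _]; first exact: l2norm_ge0.
rewrite -sqrtr_sqr ler_sqrt; last by rewrite sumr_ge0// => j _; exact: sqr_ge0.
by rewrite (bigD1 i)//= lerDl sumr_ge0// => j _; exact: sqr_ge0.
Qed.

Lemma supnorm_eq0 x : supnorm x = 0 -> x = 0.
Proof.
move=> x0; apply/rowP => i; rewrite mxE; apply/eqP; rewrite -normr_eq0 eq_le.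
by rewrite normr_ge0 andbT -x0 supnorm_ge.
Qed.

Lemma l2norm_eq0 x : l2norm x = 0 -> x = 0.
Proof.
move=> x0; apply: supnorm_eq0; apply/eqP; rewrite eq_le supnorm_ge0 andbT -x0.
exact: supnorm_le_l2norm.
Qed.

Lemma supnorm0 : supnorm 0 = 0.
Proof.
apply/eqP; rewrite eq_le supnorm_ge0 andbT; apply: bigmax_le => // i _.
by rewrite mxE normr0.
Qed.

Lemma l2norm0 : l2norm 0 = 0.
Proof. by rewrite /l2norm big1 ?sqrtr0// => i _; rewrite mxE expr0n. Qed.

Lemma l2normZ c x : 0 <= c -> l2norm (c *: x) = c * l2norm x.
Proof.
move=> c0; rewrite /l2norm -[in RHS](ger0_norm c0) -sqrtr_sqr -sqrtrM ?sqr_ge0//.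
by rewrite mulr_sumr; congr Num.sqrt; apply: eq_bigr => i _; rewrite mxE exprMn.
Qed.

Lemma supnormZ c x : 0 <= c -> supnorm (c *: x) = c * supnorm x.
Proof.
move=> c0; rewrite /supnorm; elim/big_rec2: _ => [|i a b _ ->]; first by rewrite mulr0.
by rewrite mxE normrM ger0_norm// maxr_pMr.
Qed.

Lemma supnorm_attained x : 0 < supnorm x -> exists i, `|x 0 i| = supnorm x.
Proof.
move=> x0; apply: contrapT => /forallNP nx; have : supnorm x < supnorm x.
  rewrite {1}/supnorm; apply: bigmax_lt => // i _.
  by rewrite lt_neqAle supnorm_ge andbT; apply/eqP.
by rewrite ltxx.
Qed.

(** Radial rescaling exchanging the Euclidean norm and the sup norm: cells are modelled on disks,
    whereas weights fill a cube. The division by 0 at the origin is harmless because the zero vector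
    is being scaled. *)
Definition disk_to_cube x := (l2norm x / supnorm x) *: x.
Definition cube_to_disk y := (supnorm y / l2norm y) *: y.

Lemma supnorm_neq0 x : x != 0 -> supnorm x != 0.
Proof. by apply: contra_neq => /supnorm_eq0. Qed.

Lemma l2norm_neq0 x : x != 0 -> l2norm x != 0.
Proof. by apply: contra_neq => /l2norm_eq0. Qed.

Lemma supnorm_disk_to_cube x : supnorm (disk_to_cube x) = l2norm x.
Proof.
rewrite supnormZ ?divr_ge0 ?l2norm_ge0 ?supnorm_ge0//.
have [->|x0] := eqVneq x 0; first by rewrite supnorm0 l2norm0 mulr0.
by rewrite divfK// supnorm_neq0.
Qed.

Lemma l2norm_cube_to_disk y : l2norm (cube_to_disk y) = supnorm y.
Proof.
rewrite l2normZ ?divr_ge0 ?l2norm_ge0 ?supnorm_ge0//.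
have [->|y0] := eqVneq y 0; first by rewrite supnorm0 l2norm0 mulr0.
by rewrite divfK// l2norm_neq0.
Qed.

Lemma cube_to_diskK : cancel cube_to_disk disk_to_cube.
Proof.
move=> y; have [->|y0] := eqVneq y 0.
  by rewrite /cube_to_disk /disk_to_cube !scaler0.
rewrite /disk_to_cube l2norm_cube_to_disk /cube_to_disk.
rewrite supnormZ ?divr_ge0 ?l2norm_ge0 ?supnorm_ge0// scalerA.
have s0 := supnorm_neq0 y0; have l0 := l2norm_neq0 y0.
by rewrite (_ : _ * _ = 1) ?scale1r//; field; rewrite ?s0 ?l0.
Qed.

Lemma disk_to_cubeK : cancel disk_to_cube cube_to_disk.
Proof.
move=> x; have [->|x0] := eqVneq x 0.
  by rewrite /cube_to_disk /disk_to_cube !scaler0.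
rewrite /cube_to_disk supnorm_disk_to_cube /disk_to_cube.
rewrite l2normZ ?divr_ge0 ?l2norm_ge0 ?supnorm_ge0// scalerA.
have s0 := supnorm_neq0 x0; have l0 := l2norm_neq0 x0.
by rewrite (_ : _ * _ = 1) ?scale1r//; field; rewrite ?s0 ?l0.
Qed.

Lemma coordinate_continuous i : continuous (fun x : 'rV[R]_m => x 0 i).
Proof. exact: coord_continuous. Qed.

Lemma l2norm_continuous : continuous l2norm.
Proof.
apply: continuous_filter => x F FF Fx.
have c : (fun x => \sum_i x 0 i ^+ 2) @ F --> \sum_i x 0 i ^+ 2.
  apply: cvg_sumr => i _; apply: cvg_exprr.
  exact: cvg_continuous (@coordinate_continuous i x) Fx.
exact: (cvg_continuous (F := (fun x => \sum_i x 0 i ^+ 2) @ F) (@sqrt_continuous R _) c).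
Qed.

Lemma supnorm_continuous : continuous supnorm.
Proof.
apply: continuous_filter => x F FF Fx; apply: cvg_big => [z|i _].
  by apply: (@continuous_max R _ fst snd); [exact: cvg_fst|exact: cvg_snd].
by apply: cvg_norm; exact: cvg_continuous (@coordinate_continuous i x) Fx.
Qed.

Lemma disk_to_cube_continuous i : continuous (fun x => disk_to_cube x 0 i).
Proof.
apply: continuous_filter => x F FF Fx.
have cl := cvg_continuous (@l2norm_continuous x) Fx.
have [x0|x0] := eqVneq x 0.
  rewrite x0 [X in _ --> X](_ : _ = 0); last by rewrite /disk_to_cube scaler0 mxE.
  apply/cvgrPdist_lt => e e0.
  have : \forall y \near F, l2norm y < e.
    by apply: cvgr_lt cl _ _; rewrite x0 l2norm0.
  apply: filterS => y ye; rewrite sub0r normrN; apply: le_lt_trans ye.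
  by rewrite -supnorm_disk_to_cube; exact: supnorm_ge.
rewrite /disk_to_cube (_ : (fun y => _) = fun y => l2norm y / supnorm y * y 0 i); last first.
  by apply/funext => y; rewrite mxE.
rewrite mxE; apply: cvgM; last exact: cvg_continuous (@coordinate_continuous i x) Fx.
apply: cvgM => //; apply: cvgV; first exact: supnorm_neq0.
exact: cvg_continuous (@supnorm_continuous x) Fx.
Qed.

Lemma disk_l2norm x : disk x <-> l2norm x <= 1.
Proof.
by split; rewrite /disk /= -l2norm_sqr expr_le1 ?l2norm_ge0.
Qed.

Lemma open_disk_l2norm x : open_disk x <-> l2norm x < 1.
Proof. by split; rewrite /open_disk /= -l2norm_sqr expr_lt1 ?l2norm_ge0. Qed.

Lemma unit_sphere_l2norm x : unit_sphere x <-> l2norm x = 1.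
Proof.
rewrite /unit_sphere /= -l2norm_sqr; split=> [/eqP|->]; last by rewrite expr1n.
by rewrite sqrf_eq1 => /orP[/eqP//|/eqP x1]; have := l2norm_ge0 x; rewrite x1 oppr_ge0 ler10.
Qed.

Lemma disk_closed : closed (disk (R := R) (m := m)).
Proof.
rewrite (_ : @disk R m = l2norm @^-1` [set r | r <= 1]).
  by apply: closed_comp; [move=> x _; exact: l2norm_continuous|exact: closed_le].
by apply/seteqP; split => x /disk_l2norm.
Qed.

Lemma disk_compact : compact (disk (R := R) (m := m)).
Proof.
apply: (subclosed_compact disk_closed
  (rV_compact (fun i : 'I_m => @segment_compact R (-1) 1))) => x /disk_l2norm x1 i /=.
rewrite in_itv/= -ler_norml (le_trans (supnorm_ge x i))//.
exact: le_trans (supnorm_le_l2norm x) x1.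
Qed.

End DiskCube.

(** * Torus and weight coordinates on the blocks *)

Section Coordinates.
Variables (R : realType) (k : base) (n : nat) (Sigma : set (set 'rV[R]_n)).
Hypothesis hSigma : rational_fan Sigma.

Local Notation I := 'I_(ncones hSigma).
Local Notation dmon := (@dmon R n Sigma hSigma).
Local Notation cone_le := (@cone_le R n Sigma hSigma).
Local Notation meet := (@meet R n Sigma hSigma).
Local Notation sep := (@sep R n Sigma hSigma).
Local Notation bary := (@bary R n Sigma hSigma).
Local Notation X := (toric_variety k Sigma).
Local Notation T := (torus R k n).
Local Notation C := (R[i]^o).
Local Notation inX := (@inX R k n Sigma hSigma).
Local Notation mono := (@mono R n Sigma hSigma).
Local Notation below := (@below R n Sigma hSigma).
Local Notation canonical := (@canonical R n Sigma hSigma).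
Local Notation block := (@block R k n Sigma hSigma).
Local Notation weight := (@weight R n Sigma hSigma).
Local Notation chain := (@chain R n Sigma hSigma).

Definition coordinates (x : X) (t : T) (s : I -> R) := exists i,
  [/\ below s i, inX i x & forall u, dmon i u -> ev x u = torus_fun t u * (mono s u)%:C].

Lemma coordinates_at x t s i : weight s -> coordinates x t s -> below s i ->
  inX i x /\ forall u, dmon i u -> ev x u = torus_fun t u * (mono s u)%:C.
Proof.
move=> ws [j [sj xj xE]] si; have [t1 tD] := torusP t.
have sm : below s (meet j i).
  by move=> l sl; apply: le_meet; [exact: sj|exact: si].
apply: (rep_transfer _ _ _ xj xE); first by rewrite torus_fun0 mono0 mulr1.
  move=> u mu; apply: base_setM; first by case: (t1 u).
  by apply: base_set_nneg; exact: mono_ge0.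
by move=> u v mu mv; rewrite tD (monoD ws sm mu mv) rmorphM/= mulrACA.
Qed.

Lemma below_exists s l : chain s -> s l = 0 -> exists2 i, s i < 1 & below s i.
Proof.
move=> ch sl; have [|k' l' sk' sl'|i si imax] := @chain_top _ _ _ hSigma (fun k => s k < 1) l.
- by rewrite sl ltr01.
- exact: ch.
- by exists i.
Qed.

Lemma coordinates_exists t s l : weight s -> chain s -> s l = 0 ->
  exists x, coordinates x t s /\ exists i, block i x.
Proof.
move=> ws ch sl; have [i _ si] := below_exists ch sl; have [t1 tD] := torusP t.
have [||u v iu iv|x [xi xE]] := @make_point R k n Sigma hSigma i
  (fun u => torus_fun t u * (mono s u)%:C).
- by rewrite torus_fun0 mono0 mulr1.
- move=> u iu; apply: base_setM; first by case: (t1 u).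
  by apply: base_set_nneg; exact: mono_ge0.
- by rewrite tD (monoD ws si iu iv) rmorphM/= mulrACA.
exists x; split; first by exists i.
exists i; split=> // u iu; rewrite xE// modcM modc_real modc_eq1 ?mul1r; last first.
  by case: (t1 u).
by rewrite ger0_norm ?mono_le1// mono_ge0.
Qed.

Lemma coordinates_unique x y t s : weight s -> coordinates x t s ->
  coordinates y t s -> x = y.
Proof.
move=> ws [i [si xi xE]] cy; have [yi yE] := coordinates_at ws cy si.
by apply: (ev_inj xi yi) => u iu; rewrite xE// yE.
Qed.

Lemma torus_funMn (t : T) u m : torus_fun t (u *+ m) = torus_fun t u ^+ m.
Proof.
have [_ tD] := torusP t.
by elim: m => [|m IH]; rewrite ?mulr0n ?torus_fun0// mulrS tD IH exprS.
Qed.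

Lemma torus_fun_neq0 (t : T) u : torus_fun t u != 0.
Proof. by have [t1 _] := torusP t; rewrite -normr_eq0 (t1 u).2 oner_eq0. Qed.

Lemma modc_coordinates (t : T) s u : weight s ->
  modc (torus_fun t u * (mono s u)%:C) = mono s u.
Proof.
move=> ws; have [t1 _] := torusP t.
have [_ tu] := t1 u.
by rewrite modcM modc_real (modc_eq1 tu) mul1r ger0_norm// mono_ge0.
Qed.

(** Let [i], [i'] be the tops of the two chains. The values of the separating character and of its
    opposite at [x] are inverse to each other and both of modulus at most 1, hence of modulus 1; so
    they kill the barycenters of the tops, and i = i'. Then [barycentric_unique] applies on one
    chart. *)
Lemma coordinates_inj x t t' s s' a a' : canonical s a -> canonical s' a' ->
  coordinates x t s -> coordinates x t' s' ->
  s = s' /\ forall u, dmon a u -> dmon a (- u) -> torus_fun t u = torus_fun t' u.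
Proof.
move=> cs cs' xs xs'; have [ws sa sm _ sch] := cs; have [ws' s'a' _ _ s'ch] := cs'.
have [i si1 si] := below_exists sch sa; have [i' s'i'1 s'i'] := below_exists s'ch s'a'.
have [xi xE] := coordinates_at ws xs si; have [xi' xE'] := coordinates_at ws' xs' s'i'.
have [iu _] := sepl i i'; have [i'u _] := sepr i i'.
have prod1 : mono s (sep i i') * mono s' (- sep i i') = 1.
  rewrite -(modc_coordinates t _ ws) -(modc_coordinates t' _ ws') -xE// -xE'//.
  by rewrite -modcM (evN hSigma) ?modc1//; [exact: xi|exact: xi'].
have m0 := mono_ge0 ws (sep i i'); have m1 := mono_le1 ws (sep i i').
have m0' := mono_ge0 ws' (- sep i i'); have m1' := mono_le1 ws' (- sep i i').
have s1 : mono s (sep i i') = 1.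
  by apply/eqP; rewrite eq_le m1/= -prod1 ler_piMr.
have s1' : mono s' (- sep i i') = 1 by rewrite -prod1 s1 mul1r.
have ii' : cone_le i i'.
  apply: cone_le_trans (meet_ler i i').
  apply/(exposes_bary (sepl i i') (cone_le_refl i)); exact: mono_eq1P s1 si1.
have i'i : cone_le i' i.
  apply: cone_le_trans (meet_lel i i').
  apply/(exposes_bary (sepr i i') (cone_le_refl i')); exact: mono_eq1P s1' s'i'1.
have ei : i' = i by exact: cone_le_anti.
subst i'; have mE u : dmon i u -> mono s u = mono s' u.
  by move=> iu'; rewrite -(modc_coordinates t u ws) -xE// xE'// modc_coordinates.
have ss' := barycentric_unique cs cs' si s'i' mE.
split=> [|u au aNu]; first exact/funext.
have ai : cone_le a i by apply: si; rewrite sa.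
(* The phases are read off only at characters of [dmon i] orthogonal to the cone [a]; any [u]
   orthogonal to that cone is the difference of two of these, [u + w *+ N] and [w *+ N]. *)
have [w we] := le_exposed ai; have [N iN] := exposes_shift we au.
have w0 : dot w (bary a) = 0 by apply/(exposes_bary we ai); exact: cone_le_refl.
have tt v : dmon i v -> dot v (bary a) = 0 -> torus_fun t v = torus_fun t' v.
  move=> iv v0; have mv0 : (mono s v)%:C != 0 :> R[i].
    rewrite -[0]/(0%:C) (inj_eq (@complexI R)) (mono_canonical_eq0 cs si iv).
    exact/eqP.
  by apply: (mulIf mv0); rewrite -xE// xE'// mE.
have [_ tD] := torusP t; have [_ tD'] := torusP t'.
have := tt _ iN; rewrite dotDl dotMnl w0 mul0rn addr0 dmonN_bary// => /(_ erefl).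
rewrite tD tD' !torus_funMn (tt w we.1 w0).
by apply: mulIf; rewrite expf_neq0// torus_fun_neq0.
Qed.

Lemma coordinates_act x t s g : coordinates x t s ->
  coordinates (toric_act g x) (g * t)%g s.
Proof.
move=> [i [si xi xE]]; have [gi gE] := act_ev g xi; exists i; split=> // u iu.
by rewrite gE// xE// mulrA.
Qed.

(** The characters invertible on the dual monoid of [a] are those that do not vanish on its orbit,
    so these are the torus elements acting trivially on the orbit. *)
Definition stabilizer_set a : set T :=
  [set t | forall u, dmon a u -> dmon a (- u) -> torus_fun t u = 1].

Lemma stabilizer_closed a : closed (stabilizer_set a).
Proof.
rewrite (_ : stabilizer_set a = \bigcap_(u in [set u | dmon a u /\ dmon a (- u)])
  [set t : T | torus_fun t u = 1]).
  apply: closed_bigI => u _; apply: closed_eq_fun; last exact: cst_continuous.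
  exact: torus_eval_continuous.
apply/seteqP; split => t tP u; first by case=> ? ?; exact: tP.
by move=> ? ?; exact: tP.
Qed.

Lemma stabilizerM a g h :
  stabilizer_set a g -> stabilizer_set a h -> stabilizer_set a (g * h)%g.
Proof.
move=> ga ha u au aNu.
by rewrite -[LHS]/(torus_fun g u * torus_fun h u) ga// ha// mulr1.
Qed.

Lemma stabilizerV a g : stabilizer_set a g -> stabilizer_set a (g^-1)%g.
Proof.
by move=> ga u au aNu; rewrite -[LHS]/(torus_fun g (- u)) ga// opprK.
Qed.

Definition stabilizer (a : I) : closed_subgroup T :=
  @ClosedSubgroup _ (stabilizer_set a) (fun _ _ _ => erefl)
    (@stabilizerM a) (@stabilizerV a) (@stabilizer_closed a).

Lemma coordinates_twist x t s a h : weight s -> s a = 0 -> coordinates x t s ->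
  stabilizer_set a h -> coordinates x (t * h)%g s.
Proof.
move=> ws sa [i [si xi xE]] ha; exists i; split=> // u iu; rewrite xE//.
rewrite -[torus_fun (t * h)%g u]/(torus_fun t u * torus_fun h u).
have ai : cone_le a i by apply: si; rewrite sa.
have [ua|ua] := eqVneq (dot u (bary a)) 0; last by rewrite (mono_eq0 sa ua) !mulr0.
have au := dmon_le ai iu.
by rewrite (ha u au (bary_eq0N au ua)) mulr1.
Qed.

End Coordinates.

Section Cells.
Variables (R : realType) (n : nat) (Sigma : set (set 'rV[R]_n)).
Hypothesis hSigma : rational_fan Sigma.
Local Notation I := 'I_(ncones hSigma).
Local Notation cone_le := (@cone_le R n Sigma hSigma).

Definition chain_set (A : {set I}) :=
  [forall k in A, forall l in A, cone_le k l || cone_le l k].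

Lemma chain_setP (A : {set I}) : reflect
  (forall k l, k \in A -> l \in A -> cone_le k l \/ cone_le l k) (chain_set A).
Proof.
apply: (iffP idP) => [/forall_inP ch k l kA lA|ch].
  by have /forall_inP/(_ l lA)/orP := ch _ kA.
by apply/forall_inP => k kA; apply/forall_inP => l lA; apply/orP; exact: ch.
Qed.

Definition cell m := {A : {set I} | chain_set A && (#|A| == m.+1)}.

Section Cell.
Variables (m : nat) (j : cell m).

Lemma cell_chain : chain_set (val j). Proof. by case/andP: (valP j). Qed.
Lemma cell_card : #|val j| = m.+1. Proof. by case/andP: (valP j) => _ /eqP. Qed.

Lemma apex_exists : exists a, a \in val j /\ forall l, l \in val j -> cone_le a l.
Proof.
have /card_gt0P[k kj] : (0 < #|val j|)%N by rewrite cell_card.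
case: (arg_minnP (fun i : I => rk i) kj) => a aj amin; exists a; split => // l lj.
have [//|la] := chain_setP _ cell_chain _ _ aj lj.
apply: contrapT => /negP al; have := amin _ lj; rewrite leqNgt => /negP; apply.
exact: rk_lt.
Qed.

Definition apex := projT1 (cid apex_exists).

Lemma apex_in : apex \in val j.
Proof. by rewrite /apex; case: cid => a []. Qed.

Lemma apex_le l : l \in val j -> cone_le apex l.
Proof. by rewrite /apex; case: cid => a [? aP] /=; exact: aP. Qed.

Definition others := enum (val j :\ apex)%SET.

Lemma size_others : size others = m.
Proof.
by have := cell_card; rewrite (cardsD1 apex (val j)) apex_in /others -cardE => -[].
Qed.

Lemma mem_others l : (l \in others) = (l != apex) && (l \in val j).
Proof. by rewrite mem_enum in_setD1. Qed.

(* The barycentric weights of a point of the disk: 0 at the apex, the cube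
   coordinates, rescaled to [0, 1], at the other elements of the chain. *)
Definition cell_weight (x : 'rV[R]_m) (l : I) : R :=
  if l == apex then 0
  else nth 1 [seq (1 + disk_to_cube x 0 i) / 2 | i <- enum 'I_m] (index l others).

Lemma cell_weight_apex x : cell_weight x apex = 0.
Proof. by rewrite /cell_weight eqxx. Qed.

Lemma cell_weight_in l : l \in others -> exists i, forall x,
  cell_weight x l = (1 + disk_to_cube x 0 i) / 2.
Proof.
move=> lo; have lm : (index l others < m)%N by rewrite -[ltnRHS]size_others index_mem.
exists (Ordinal lm) => x; rewrite /cell_weight.
move: (lo); rewrite mem_others => /andP[/negPf -> _].
rewrite (nth_map (Ordinal lm)) ?size_enum_ord//; congr ((1 + disk_to_cube x 0 _) / 2).
by apply: val_inj; rewrite /= nth_enum_ord.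
Qed.

(** The index of such a cone is past the end of the list, and the default [1] of [nth] is its
    weight. *)
Lemma cell_weight_out x l : l \notin val j -> cell_weight x l = 1.
Proof.
move=> lj; rewrite /cell_weight; case: eqP => [la|_].
  by move: lj; rewrite la apex_in.
rewrite nth_default// size_map size_enum_ord -size_others memNindex//.
by rewrite mem_others negb_and lj orbT.
Qed.

Lemma cell_weight_nth i : exists2 l, l \in others & forall x,
  cell_weight x l = (1 + disk_to_cube x 0 i) / 2.
Proof.
have im : (i < size others)%N by rewrite size_others.
pose l := nth apex others i; have lo : l \in others by exact: mem_nth.
exists l => // x; rewrite /cell_weight.
move: (lo); rewrite mem_others => /andP[/negPf -> _].
rewrite index_uniq ?enum_uniq// (nth_map i) ?size_enum_ord//.
by congr ((1 + disk_to_cube x 0 _) / 2); apply: val_inj; rewrite /= nth_enum_ord.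
Qed.

Lemma cell_weightP l : [\/ l = apex, l \notin val j | l \in others].
Proof.
have [->|la] := eqVneq l apex; first by constructor 1.
by have [lj|lj] := boolP (l \in val j); [constructor 3; rewrite mem_others la|constructor 2].
Qed.

Lemma cell_weight_continuous l : continuous (cell_weight ^~ l).
Proof.
apply: continuous_filter => x F FF Fx.
have [->|lj|/cell_weight_in[i iE]] := cell_weightP l.
- rewrite cell_weight_apex; apply: (cvg_near (f := fun=> 0)); last exact: cvg_cst.
  by apply: nearW => y; rewrite cell_weight_apex.
- rewrite (cell_weight_out x lj); apply: (cvg_near (f := fun=> (1 : R))); last exact: cvg_cst.
  by apply: nearW => y; rewrite cell_weight_out.
- rewrite iE; apply: (cvg_near (f := fun y => (1 + disk_to_cube y 0 i) / 2)).
    by apply: nearW => y; rewrite iE.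
  apply: cvgM; last exact: cvg_cst.
  apply: cvgD; first exact: cvg_cst.
  exact: cvg_continuous (@disk_to_cube_continuous R m i x) Fx.
Qed.

Lemma cube_coordinate (x : 'rV[R]_m) i : `|disk_to_cube x 0 i| <= l2norm x.
Proof. by rewrite -supnorm_disk_to_cube supnorm_ge. Qed.

Lemma cell_weight_weight x : disk x -> weight (cell_weight x).
Proof.
move=> /disk_l2norm x1 l.
have [->|lj|/cell_weight_in[i ->]] := cell_weightP l.
- by rewrite cell_weight_apex lexx ler01.
- by rewrite cell_weight_out// ler01 lexx.
- have := le_trans (cube_coordinate x i) x1; rewrite ler_norml => /andP[a b].
  by rewrite divr_ge0 -?lerBlDl ?sub0r//= ler_pdivrMr//; lra.
Qed.

Lemma cell_weight_lt1 x l : cell_weight x l < 1 -> l \in val j.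
Proof. by move=> xl; apply: contraTT xl => lj; rewrite cell_weight_out// ltxx. Qed.

Lemma cell_weight_chain x : chain (cell_weight x).
Proof.
by move=> l l' /cell_weight_lt1 lj /cell_weight_lt1; apply: (chain_setP _ cell_chain).
Qed.

Lemma cell_weight_open x : open_disk x ->
  canonical (cell_weight x) apex /\ forall l, (cell_weight x l < 1) = (l \in val j).
Proof.
move=> ox; have x1 : l2norm x < 1 by exact/open_disk_l2norm.
have dx : disk x by apply/disk_l2norm; exact: ltW.
have bnd l : l \in others -> 0 < cell_weight x l < 1.
  move=> /cell_weight_in[i ->].
  have := le_lt_trans (cube_coordinate x i) x1; rewrite ltr_norml => /andP[a b].
  by apply/andP; split; lra.
have lt1 l : (cell_weight x l < 1) = (l \in val j).
  apply/idP/idP => [/cell_weight_lt1//|lj].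
  have [->|lj'|/bnd/andP[]//] := cell_weightP l.
    by rewrite cell_weight_apex ltr01.
  by rewrite lj in lj'.
split=> //; split.
- exact: cell_weight_weight.
- exact: cell_weight_apex.
- by move=> l /cell_weight_lt1; exact: apex_le.
- move=> l l0; have [//|lj|/bnd] := cell_weightP l.
    by move: l0; rewrite cell_weight_out// => /eqP; rewrite oner_eq0.
  by rewrite l0 ltxx.
- exact: cell_weight_chain.
Qed.

Lemma cell_weight_sphere x : unit_sphere x ->
  exists2 l, l \in others & cell_weight x l = 0 \/ cell_weight x l = 1.
Proof.
move=> /unit_sphere_l2norm x1.
have [|i xi] := @supnorm_attained R m (disk_to_cube x).
  by rewrite supnorm_disk_to_cube x1.
have [l lo lE] := cell_weight_nth i; exists l => //; rewrite lE.
move: xi; rewrite supnorm_disk_to_cube x1 => /eqP; rewrite eqr_norml => /andP[/orP[]/eqP-> _].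
  by right; field.
by left; rewrite subrr mul0r.
Qed.

Lemma cell_weight_inj x y : cell_weight x = cell_weight y -> x = y.
Proof.
move=> xy; apply: (can_inj (@disk_to_cubeK R m)); apply/rowP => i.
have [l _ lE] := cell_weight_nth i; have := congr1 (fun f => f l) xy.
by rewrite !lE; lra.
Qed.

Lemma cell_weight_surj s a : canonical s a ->
  (forall l, (s l < 1) = (l \in val j)) ->
  exists2 x, open_disk x & cell_weight x = s.
Proof.
move=> [ws sa sm sz _] sj.
have ea : a = apex.
  apply: cone_le_anti; first by apply: sm; rewrite sj apex_in.
  by apply: apex_le; rewrite -sj sa ltr01.
pose y := \row_(i < m) (2 * s (nth apex others i) - 1).
exists (cube_to_disk y).
  apply/open_disk_l2norm; rewrite l2norm_cube_to_disk; apply: bigmax_lt => // i _.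
  rewrite mxE; set l := nth _ _ _.
  have : l \in others by apply: mem_nth; rewrite size_others.
  rewrite mem_others -sj -ea => /andP[la l1].
  have l0 : 0 < s l.
    by rewrite lt0r weight_ge0// andbT; apply: contra la => /eqP/sz ->.
  by rewrite ltr_norml; lra.
apply/funext => l; have [->|lj|lo] := cell_weightP l.
- by rewrite cell_weight_apex -ea sa.
- by rewrite cell_weight_out//; apply/esym/weight_eq1 => //; rewrite sj; exact/negP.
- have lm : (index l others < m)%N by rewrite -[ltnRHS]size_others index_mem.
  have [l' l'o l'E] := cell_weight_nth (Ordinal lm).
  rewrite /cell_weight; move: (lo); rewrite mem_others => /andP[/negPf -> _].
  rewrite (nth_map (Ordinal lm)) ?size_enum_ord// cube_to_diskK mxE nth_enum_ord//.
  by rewrite nth_index//; field.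
Qed.

End Cell.
End Cells.

Section CosetSpace.
Variables (G : topGroupType) (H : closed_subgroup G).

Lemma lcoset_eq g h : lcoset H g = lcoset H h <-> subgroup_set H (g^-1 * h)%g.
Proof.
by split=> [/eqquotP/asboolP|gh]; [|apply/eqquotP/asboolP].
Qed.

Definition coset_repr (c : coset_space H) : G := repr (c : {eq_quot coset_equiv H}).

Lemma coset_reprK c : lcoset H (coset_repr c) = c.
Proof. exact: reprK. Qed.

Lemma lcoset_continuous : continuous (lcoset H).
Proof. exact: pi_continuous. Qed.

Lemma coset_space_compact : compact [set: G] -> compact [set: coset_space H].
Proof.
move=> cG; have -> : [set: coset_space H] = lcoset H @` [set: G].
  by apply/seteqP; split=> // c _; exists (coset_repr c) => //; exact: coset_reprK.
by apply: continuous_compact => //; apply: continuous_subspaceT; exact: lcoset_continuous.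
Qed.

End CosetSpace.

Lemma injective_hausdorff (S V : topologicalType) (f : S -> V) :
  injective f -> continuous f -> hausdorff_space V -> hausdorff_space S.
Proof.
move=> fi fc; rewrite !open_hausdorff => hV x y xy.
have [|[A B] /= [fxA fyB] [oA oB /eqP AB]] := hV (f x) (f y).
  by apply: contra_neq xy => /fi.
move/continuousP : fc => fc.
exists (f @^-1` A, f @^-1` B) => /=.
  by split; apply/mem_set; exact/set_mem.
split; [exact: fc|exact: fc|].
by rewrite -preimage_setI AB preimage_set0.
Qed.

Lemma finite_union_compact (V : topologicalType) (J : finType) (K : J -> set V) :
  (forall i, compact (K i)) -> compact (\bigcup_(i in [set: J]) K i).
Proof.
move=> cK; rewrite (_ : [set: J] = [set` index_enum J]).
  by rewrite bigcup_seq; apply: bigsetU_compact => i _; exact: cK.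
by apply/seteqP; split=> // i _ /=; rewrite mem_index_enum.
Qed.

(** * Skeleta and attaching maps *)

Section GCW.
Variables (R : realType) (k : base) (n : nat) (Sigma : set (set 'rV[R]_n)).
Hypothesis hSigma : rational_fan Sigma.

Local Notation I := 'I_(ncones hSigma).
Local Notation dmon := (@dmon R n Sigma hSigma).
Local Notation cone_le := (@cone_le R n Sigma hSigma).
Local Notation bary := (@bary R n Sigma hSigma).
Local Notation X := (toric_variety k Sigma).
Local Notation T := (torus R k n).
Local Notation C := (R[i]^o).
Local Notation inX := (@inX R k n Sigma hSigma).
Local Notation mono := (@mono R n Sigma hSigma).
Local Notation canonical := (@canonical R n Sigma hSigma).
Local Notation block := (@block R k n Sigma hSigma).
Local Notation weight := (@weight R n Sigma hSigma).
Local Notation chain := (@chain R n Sigma hSigma).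
Local Notation coordinates := (@coordinates R k n Sigma hSigma).
Local Notation cell := (@cell R n Sigma hSigma).
Local Notation stabilizer := (@stabilizer R k n Sigma hSigma).

(** [Z] is the union of the blocks up to an equivariant embedding [f]. This form covers both the
    variety itself with the identity, if the blocks cover it, and the subtype of the blocks in
    general. *)
Variables (Z : topologicalType) (actZ : T -> Z -> Z) (f : Z -> X).
Hypothesis actZ_continuous : continuous_action actZ.
Hypothesis f_inj : injective f.
Hypothesis f_initial : forall (F : set_system Z) z, Filter F -> f @ F --> f z <-> F --> z.
Hypothesis f_act : forall t z, f (actZ t z) = toric_act t (f z).
Hypothesis f_image : forall x, (exists z, f z = x) <-> exists i, block i x.

Definition active (s : I -> R) : {set I} := [set l | s l < 1]%SET.

(** A chain of m + 1 active cones gives an m-cell, one weight being fixed to 0; so at most m active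
    cones is the (m-1)-skeleton, in accordance with the indexing in [finite_GCW]. *)
Definition skeleton m : set Z := [set z | exists t s a,
  [/\ canonical s a, coordinates (f z) t s & (#|active s| <= m)%N]].

Lemma f_continuous : continuous f.
Proof. by move=> z; apply/f_initial; exact: cvg_id. Qed.

Lemma Z_hausdorff : hausdorff_space Z.
Proof. exact: injective_hausdorff f_inj f_continuous (toric_hausdorff hSigma). Qed.

Lemma Z_coordinates t s l : weight s -> chain s -> s l = 0 ->
  exists z, coordinates (f z) t s.
Proof.
move=> ws ch sl; have [x [xs xb]] := coordinates_exists t ws ch sl.
by have [z zx] := (f_image x).2 xb; exists z; rewrite zx.
Qed.

Lemma Z_unique t s z z' : weight s -> coordinates (f z) t s ->
  coordinates (f z') t s -> z = z'.
Proof. by move=> ws zs z's; apply: f_inj; exact: coordinates_unique ws zs z's. Qed.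

Lemma Z_canonical z : exists t s a, canonical s a /\ coordinates (f z) t s.
Proof.
have [|i zi] := (f_image (f z)).1; first by exists z.
have [t [s [a [cs si zE]]]] := block_barycentric zi.
by exists t, s, a; split => //; exists i; split => //; case: zi.
Qed.

Lemma skeleton0 : skeleton 0 = set0.
Proof.
rewrite -subset0 => z [t [s [a [[_ sa _ _ _] _]]]].
rewrite leqn0 cards_eq0 => /eqP A0.
have : a \in active s by rewrite inE sa ltr01.
by rewrite A0 finset.in_set0.
Qed.

Lemma skeleton_top : skeleton (ncones hSigma) = setT.
Proof.
apply/seteqP; split=> // z _; have [t [s [a [cs zs]]]] := Z_canonical z.
by exists t, s, a; split => //; rewrite (leq_trans (max_card _))// card_ord.
Qed.

Section Cells.
Variable m : nat.
Implicit Type j : cell m.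

Definition cell_group j := stabilizer (apex j).

(* The default value of [xget] only matters outside of the disk. *)
Definition cell_map j (p : coset_space (cell_group j) * 'rV[R]_m) : Z :=
  xget (projT1 (cid (Z_coordinates 1%g
      (cell_weight_weight j (x := 0) ((disk_l2norm 0).2
        (eq_ind_r (fun r => r <= 1) ler01 (@l2norm0 R m))))
      (@cell_weight_chain R n Sigma hSigma m j 0) (cell_weight_apex j 0))))
    [set z | coordinates (f z) (coset_repr p.1) (cell_weight j p.2)].

Lemma cell_mapP j t x : disk x ->
  coordinates (f (cell_map (lcoset (cell_group j) t, x))) t (cell_weight j x).
Proof.
move=> dx; have ws := cell_weight_weight j dx.
have sa := cell_weight_apex j x.
set c := lcoset _ t.
have : coordinates (f (cell_map (c, x))) (coset_repr c) (cell_weight j x).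
  rewrite /cell_map; case: xgetP => // /= nz; exfalso.
  have [z zs] := Z_coordinates (coset_repr c) ws (@cell_weight_chain R n Sigma hSigma m j x) sa.
  exact: nz zs.
have /lcoset_eq st : lcoset (cell_group j) (coset_repr c) = lcoset (cell_group j) t.
  exact: coset_reprK.
by move=> /(coordinates_twist ws sa)/(_ st); rewrite mulgA mulgV mul1g.
Qed.

Lemma cell_mapP' j c x : disk x ->
  coordinates (f (cell_map (j := j) (c, x))) (coset_repr c) (cell_weight j x).
Proof. by move=> dx; rewrite -{1}(coset_reprK c); exact: cell_mapP. Qed.

Lemma cell_top j : exists i, forall l, l \in val j -> cone_le l i.
Proof.
have [t _ tmax] := chain_top (P := mem (val j)) (k0 := apex j) (apex_in j)
  (chain_setP _ (cell_chain j)).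
by exists t.
Qed.

(** The choice of representatives need not be continuous, but a character orthogonal to the apex is
    trivial on the stabilizer and so descends to the coset space. *)
Lemma perp_eval_continuous j u : dmon (apex j) u -> dmon (apex j) (- u) ->
  continuous (fun c : coset_space (cell_group j) => torus_fun (coset_repr c) u : C).
Proof.
move=> au aNu; apply/quotient_continuous.
rewrite (_ : _ \o _ = fun t : T => torus_fun t u : C); first exact: torus_eval_continuous.
apply/funext => t /=.
have /lcoset_eq/(_ u au aNu) : lcoset (cell_group j) (coset_repr (lcoset (cell_group j) t))
    = lcoset (cell_group j) t by exact: coset_reprK.
rewrite -[torus_fun (_ * _)%g u]/(torus_fun (coset_repr _) (- u) * torus_fun t u) => E.
have [_ tD] := torusP (coset_repr (lcoset (cell_group j) t)).
apply/esym; rewrite -[LHS]mul1r -(torus_fun0 (coset_repr (lcoset (cell_group j) t))).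
by rewrite -(subrr u) tD -mulrA E mulr1.
Qed.

(** All cells over one chain land in the chart of its top cone, where values decide. Characters
    positive on the apex vanish identically on the cell; the others are a continuous function of the
    coset times a monomial in continuous weights. *)
Lemma cell_map_continuous j :
  {within [set: coset_space (cell_group j)] `*` disk (m := m), continuous (@cell_map j)}.
Proof.
apply/subspace_continuousP => -[c x] [_ /= dx].
set F := within _ _.
have FF : Filter F by exact: within_filter.
have Fd : \forall q \near F, disk q.2 by apply: filterS (withinT _ _) => q [].
have Fc : (fun q => q.1) @ F --> c.
  move=> B cB; have n1 : nbhs (c, x) [set q | B q.1].
    by apply: (@cvg_fst _ _ (nbhs c) (nbhs x)).
  by apply: filterS n1 => q Bq _.
have Fx : (fun q => q.2) @ F --> x.
  move=> B xB; have n1 : nbhs (c, x) [set q | B q.2].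
    by apply: (@cvg_snd _ _ (nbhs c) (nbhs x)).
  by apply: filterS n1 => q Bq _.
apply/f_initial; have [i iP] := cell_top j.
have at_i q : disk q.2 -> inX i (f (cell_map (j := j) q)) /\ forall u, dmon i u ->
    ev (f (cell_map q)) u = torus_fun (coset_repr q.1) u * (mono (cell_weight j q.2) u)%:C.
  case: q => c' x' /= dx'.
  apply: coordinates_at (cell_mapP' c' dx') _; first exact: cell_weight_weight.
  by move=> l /cell_weight_lt1; exact: iP.
have [fi fE] := at_i (c, x) dx.
apply: (toric_cvg _ fi).
  suff : F [set q | inX i (f (cell_map q))] by [].
  by apply: filterS Fd => q /at_i[].
move=> u iu; rewrite fE//.
apply: (cvg_near (f := fun q => torus_fun (coset_repr q.1) u *
    (mono (cell_weight j q.2) u)%:C : C)).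
  by apply: filterS Fd => q /at_i[_ ->].
have au : dmon (apex j) u by apply: dmon_le iu; apply: iP; exact: apex_in.
have [ua|ua] := eqVneq (dot u (bary (apex j))) 0; last first.
  have z0 y : (mono (cell_weight j y) u)%:C = 0 :> R[i].
    by rewrite (mono_eq0 (cell_weight_apex j y) ua).
  rewrite z0 mulr0; apply: (cvg_near (f := fun=> 0 : C)); last exact: cvg_cst.
  by apply: nearW => q; rewrite z0 mulr0.
have c1 : (fun q => torus_fun (coset_repr q.1) u : C) @ F --> (torus_fun (coset_repr c) u : C).
  have cp := @perp_eval_continuous j u au (bary_eq0N au ua).
  by move=> B /(cp c)/Fc.
have c2 : (fun q => (mono (cell_weight j q.2) u)%:C : C) @ F -->
    ((mono (cell_weight j x) u)%:C : C).
  apply: cvg_real_complex; apply: cvg_prodr => l _; apply: cvg_exprr.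
  exact: (cvg_continuous (F := (fun q => q.2) @ F)
    (@cell_weight_continuous R n Sigma hSigma m j l x) Fx).
exact: (cvgM c1 c2).
Qed.

(** On the sphere some weight besides that of the apex is 0 or 1. A weight 1 removes its cone from
    the chain; a second weight 0 makes [barycentric_reduce] drop all zeros but one. Either way at
    most m active cones remain. *)
Lemma cell_map_sphere j c x : unit_sphere x -> skeleton m (cell_map (j := j) (c, x)).
Proof.
move=> sx; have dx : disk x by move/unit_sphere_l2norm: sx => sx; apply/disk_l2norm; rewrite sx.
have ws := cell_weight_weight j dx.
have [s' [a [cs' s's [sa sz] mE]]] := barycentric_reduce ws
  (@cell_weight_chain R n Sigma hSigma m j x) (cell_weight_apex j x).
exists (coset_repr c), s', a; split=> //.
  have [i [si zi zE]] := cell_mapP' c dx; exists i; split=> // [l s'l|u iu].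
    by apply: si; case: (s's l) s'l => ->; rewrite ?ltxx.
  by rewrite zE// (mE u i).
have sub l : s' l < 1 -> l \in val j.
  by move=> s'l; apply: (cell_weight_lt1 (x := x)); case: (s's l) s'l => ->; rewrite ?ltxx.
rewrite -ltnS -(cell_card j); apply: proper_card; apply/fintype.properP; split.
  by apply/fintype.subsetP => l; rewrite inE; exact: sub.
have [l lo [l0|l1]] := cell_weight_sphere j sx; last first.
  exists l; first by move: lo; rewrite mem_others => /andP[].
  by rewrite inE -leNgt; case: (s's l) => ->; rewrite ?l1.
have [la|la] := eqVneq l a.
  exists (apex j); first exact: apex_in.
  rewrite inE sz ?ltxx ?cell_weight_apex//.
  by move: lo; rewrite mem_others la eq_sym => /andP[].
exists l; first by move: lo; rewrite mem_others => /andP[].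
by rewrite inE sz ?ltxx.
Qed.

Lemma active_card j x : open_disk x -> active (cell_weight j x) = val j.
Proof.
by move=> ox; apply/setP => l; rewrite inE (cell_weight_open j ox).2.
Qed.

Lemma open_disk_disk (x : 'rV[R]_m) : open_disk x -> disk x.
Proof. by move=> /open_disk_l2norm/ltW/disk_l2norm. Qed.

Lemma cell_map_open j c x : open_disk x ->
  (skeleton m.+1 `\` skeleton m) (cell_map (j := j) (c, x)).
Proof.
move=> ox; have [cs _] := cell_weight_open j ox.
have zs := cell_mapP' c (open_disk_disk ox); split.
  exists (coset_repr c), (cell_weight j x), (apex j); split => //.
  by rewrite active_card// cell_card.
move=> [t [s [a [cs' zs']]]]; have [<- _] := coordinates_inj cs cs' zs zs'.
by rewrite active_card// cell_card ltnn.
Qed.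

Lemma cell_map_surj z : (skeleton m.+1 `\` skeleton m) z ->
  exists j c x, open_disk x /\ cell_map (j := j) (c, x) = z.
Proof.
move=> [[t [s [a [cs zs sm]]]] nz]; have [ws sa _ _ sch] := cs.
have cA : chain_set (active s) && (#|active s| == m.+1).
  apply/andP; split.
    have inA l : (l \in active s) = (s l < 1) by rewrite inE.
    by apply/chain_setP => l l'; rewrite !inA; exact: sch.
  rewrite eqn_leq sm ltnNge; apply/negP => sm'; apply: nz.
  by exists t, s, a.
pose j : cell m := exist _ (active s) cA.
have [|x ox xs] := @cell_weight_surj R n Sigma hSigma m j s a cs.
  by move=> l; rewrite inE.
exists j, (lcoset (cell_group j) t), x; split=> //.
apply: (@Z_unique t s) => //; rewrite -xs.
exact: cell_mapP (open_disk_disk ox).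
Qed.

Lemma skeletonS_sub : skeleton m `<=` skeleton m.+1.
Proof.
by move=> z [t [s [a [cs zs sm]]]]; exists t, s, a; split => //; exact: leqW.
Qed.

Lemma cell_map_disk j c x : disk x -> skeleton m.+1 (cell_map (j := j) (c, x)).
Proof.
move=> /disk_l2norm; rewrite le_eqVlt => /orP[/eqP x1|x1].
  by apply/skeletonS_sub/cell_map_sphere/unit_sphere_l2norm.
by case: (@cell_map_open j c x); first exact/open_disk_l2norm.
Qed.

Lemma cell_domain_compact j :
  compact ([set: coset_space (cell_group j)] `*` disk (R := R) (m := m)).
Proof.
apply: compact_setX; last exact: disk_compact.
by apply: coset_space_compact; exact: torus_compact.
Qed.

Lemma cell_map_compact j (P : set (coset_space (cell_group j) * 'rV[R]_m)) :
  closed P -> P `<=` [set: _] `*` disk (m := m) -> compact (@cell_map j @` P).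
Proof.
move=> cP PD; apply: continuous_compact.
  exact: continuous_subspaceW PD (@cell_map_continuous j).
exact: subclosed_compact cP (@cell_domain_compact j) PD.
Qed.

Lemma skeleton_succ : skeleton m.+1 = skeleton m `|`
  \bigcup_(j in [set: cell m]) (@cell_map j @` ([set: _] `*` disk (m := m))).
Proof.
apply/seteqP; split=> [z zm|z [/skeletonS_sub//|[j _ [[c x] [_ /= dx] <-]]]].
  have [zm'|zm'] := pselect (skeleton m z); [by left|right].
  have [j [c [x [ox <-]]]] := cell_map_surj (conj zm zm').
  by exists j => //; exists (c, x) => //; split => //; exact: open_disk_disk.
exact: cell_map_disk.
Qed.

(** For the final topology, a subset with closed traces is the union of its trace on the lower
    skeleton and of finitely many images of closed subsets of compact cells; these images are
    compact, hence closed in the Hausdorff space [Z]. *)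
Lemma skeleton_attach : compact (skeleton m) ->
  attach_equivariant_cells R actZ m (skeleton m) (skeleton m.+1).
Proof.
move=> cm; have closedm := compact_closed Z_hausdorff cm.
exists (cell m : finType), (fun j => cell_group j), (fun j => @cell_map j); split.
- move=> j; split.
  + exact: cell_map_continuous.
  + move=> g g' x dx; have ws := cell_weight_weight j dx.
    apply: (Z_unique ws (cell_mapP j (g * g')%g dx)).
    by rewrite f_act; apply: coordinates_act; exact: cell_mapP.
  + by move=> c x; exact: cell_map_sphere.
- exact: skeletonS_sub.
- split.
  + by move=> [j [c x]] /= ox; exact: cell_map_open.
  + move=> [j [c x]] [j' [c' x']] /set_mem/= ox /set_mem/= ox' zz'.
    have [cs _] := cell_weight_open j ox; have [cs' _] := cell_weight_open j' ox'.
    have zs := cell_mapP' c (open_disk_disk ox).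
    have zs' := cell_mapP' c' (open_disk_disk ox').
    rewrite zz' in zs; have [ss tt] := coordinates_inj cs cs' zs zs'.
    have jj' : j = j'.
      by apply: val_inj; rewrite -(active_card j ox) -(active_card j' ox') ss.
    subst j'; suff -> : c = c' by rewrite (cell_weight_inj ss).
    rewrite -(coset_reprK c) -(coset_reprK c'); apply/lcoset_eq => u au aNu.
    rewrite -[LHS]/(torus_fun (coset_repr c) (- u) * torus_fun (coset_repr c') u).
    by rewrite -tt//; have [_ <-] := torusP (coset_repr c); rewrite addNr torus_fun0.
  + move=> z /cell_map_surj[j [c [x [ox <-]]]].
    by exists (existT _ j (c, x)).
- move=> B BY; split.
  + move=> [F cF BE]; split.
      exists F => //; rewrite BE -setIA; congr (_ `&` _).
      by apply/setIidr; exact: skeletonS_sub.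
    move=> j.
    have dclosed : closed ([set: coset_space (cell_group j)] `*` disk (R := R) (m := m)).
      rewrite setTX; apply: closed_comp (@disk_closed R m) => q _; exact: cvg_snd.
    have /continuous_closedP/(_ F cF)/closed_subspaceP[V cV VF] := @cell_map_continuous j.
    rewrite (_ : [set p | _] = V `&` ([set: _] `*` disk (m := m))); first exact: closedI.
    rewrite VF; apply/seteqP; split=> -[c x] /=.
      by move=> [dx]; rewrite BE => -[].
    by move=> [Fz [_ dx]]; split=> //; rewrite BE; split => //; exact: cell_map_disk.
  + move=> [[F cF BA] cP].
    have BE : B = (B `&` skeleton m) `|` \bigcup_(j in [set: cell m])
        (@cell_map j @` [set p | disk p.2 /\ B (cell_map p)]).
      apply/seteqP; split=> [z Bz|z [[]//|[j _ [p [_ Bp] <-]]//]].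
      have [zm'|zm'] := pselect (skeleton m z); [by left|right].
      have [j [c [x [ox xz]]]] := cell_map_surj (conj (BY _ Bz) zm').
      exists j => //; exists (c, x) => //; split; first exact: open_disk_disk.
      by rewrite xz.
    exists B; last by apply/esym/setIidl.
    rewrite BE; apply: closedU; first by rewrite BA; exact: closedI.
    apply: compact_closed Z_hausdorff _; apply: finite_union_compact => j.
    by apply: cell_map_compact => [|p []]; first exact: cP.
Qed.

End Cells.

Lemma skeleton_compact m : compact (skeleton m).
Proof.
elim: m => [|m IH]; first by rewrite skeleton0; exact: compact0.
rewrite skeleton_succ; apply: compactU => //; apply: finite_union_compact => j.
apply: cell_map_compact => //.
rewrite setTX; apply: closed_comp (@disk_closed R m) => q _; exact: cvg_snd.
Qed.

Lemma blocks_finite_GCW : finite_GCW R actZ.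
Proof.
split=> //; exists (ncones hSigma), skeleton; split.
- exact: skeleton0.
- by move=> m _; apply: skeleton_attach; exact: skeleton_compact.
- exact: skeleton_top.
Qed.

End GCW.

(** * The equivariant homotopy equivalence with the union of the blocks *)

Section Retract.
Variables (R : realType) (k : base) (n : nat) (Sigma : set (set 'rV[R]_n)).
Hypothesis hSigma : rational_fan Sigma.

Local Notation X := (toric_variety k Sigma).
Local Notation T := (torus R k n).
Local Notation block := (@block R k n Sigma hSigma).
Local Notation deform := (@deform R k n Sigma hSigma).

Lemma block_act i t x : block i x -> block i (toric_act t x).
Proof.
move=> [xi x1]; have [ti tE] := act_ev t xi; split=> // u iu.
rewrite tE// modcM; have [/(_ u)[_ /modc_eq1 ->] _] := torusP t.
by rewrite mul1r; exact: x1.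
Qed.

Definition blocks : set X := [set x | exists i, block i x].

Definition blocks_act (t : T) (y : blocks) : blocks := SigSub (mem_set
  (let: ex_intro i yi := set_valP y in ex_intro _ i (block_act t yi) :
     blocks (toric_act t (set_val y)))).

Lemma blocks_val_continuous : continuous (set_val : blocks -> X).
Proof. exact: initial_continuous. Qed.

Lemma blocks_initial (F : set_system blocks) y : Filter F ->
  set_val @ F --> set_val y <-> F --> y.
Proof.
move=> FF; split=> Fy; first exact: initial_topology_cvg.
by move=> B /(blocks_val_continuous)/Fy.
Qed.

Lemma blocks_continuous_action : continuous_action blocks_act.
Proof.
have [a1 aM ac] := @toric_continuous_action R k n Sigma hSigma; split.
- by move=> y; apply: val_inj; exact: a1.
- by move=> g h y; apply: val_inj; exact: aM.
- apply: continuous_comp_initial.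
  have -> : set_val \o (fun p : T * blocks => blocks_act p.1 p.2) =
    (fun p : T * X => toric_act p.1 p.2) \o (fun p : T * blocks => (p.1, set_val p.2)).
    by [].
  case=> t y; apply: continuous_comp; last exact: ac.
  apply: (cvg_pair (G := nbhs t) (H := nbhs (set_val y))); first exact: cvg_fst.
  move=> B yB; have yB' : nbhs y (set_val @^-1` B) by exact: blocks_val_continuous.
  exact: (@cvg_snd _ _ (nbhs t) (nbhs y) _ (set_val @^-1` B) yB').
Qed.

Lemma blocks_GCW : finite_GCW R blocks_act.
Proof.
apply: (@blocks_finite_GCW R k n Sigma hSigma blocks blocks_act set_val) => //.
- exact: blocks_continuous_action.
- exact: blocks_initial.
- move=> x; split=> [[y <-]|xb]; first exact: (set_valP y).
  by exists (SigSub (mem_set (xb : blocks x))).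
Qed.

Lemma complete_GCW : complete_fan Sigma -> finite_GCW R (@toric_act R k n Sigma).
Proof.
move=> complete; apply: (@blocks_finite_GCW R k n Sigma hSigma X _ id) => //.
- exact: toric_continuous_action.
- by move=> x; split=> _; [exact: complete_block|exists x].
Qed.

Definition retract (x : X) : blocks := SigSub (mem_set (deform1_block hSigma x)).

(** Time is reversed because the homotopies have to end at the identity, where [deform] starts. The
    map [f] is the identity for the variety and the inclusion for the blocks. *)
Lemma retract_homotopy (V : topologicalType) (f : V -> X) : continuous f ->
  {within [set: V] `*` `[0, 1 : R], continuous (fun q => deform (f q.1, 1 - q.2))}.
Proof.
move=> fc; apply/subspace_continuousP => -[y p] [_ /=]; rewrite in_itv/= => p01.
set F := within _ _.
have FF : Filter F by exact: within_filter.
have c1 : (fun q => f q.1) @ F --> f y.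
  move=> B /fc yB; have n1 : nbhs (y, p) [set q | B (f q.1)].
    have yB' : nbhs y (f @^-1` B) by [].
    exact: (@cvg_fst _ _ (nbhs y) (nbhs p) _ (f @^-1` B) yB').
  by apply: filterS n1 => q Bq _.
have c2 : (fun q => 1 - q.2) @ F --> 1 - p.
  apply: cvgB; first exact: cvg_cst.
  move=> B pB; have n1 : nbhs (y, p) [set q | B q.2].
    by apply: (@cvg_snd _ _ (nbhs y) (nbhs p)).
  by apply: filterS n1 => q Bq _.
apply: (@cvg_deform R k n Sigma hSigma (f y) (1 - p)
  ((fun q => (f q.1, 1 - q.2)) @ F)) => //; last by lra.
rewrite /nbhs/=; apply: filterS (withinT _ _) => q [_ /=]; rewrite in_itv/= => ?.
by lra.
Qed.

Lemma blocks_equivalence :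
  equivariantly_homotopy_equivalent R (@toric_act R k n Sigma) blocks_act.
Proof.
have i01 p : p \in `[0, 1] -> 0 <= (1 : R) - p <= 1.
  by rewrite in_itv/= => ?; lra.
have o01 : 0 <= (1 : R) <= 1 by rewrite ler01 lexx.
split; [exact: toric_continuous_action|exact: blocks_continuous_action|].
exists retract, set_val; split.
- split; last by move=> t x; apply: val_inj; exact: deform_act.
  apply: continuous_comp_initial; apply: continuous_filter => x F FF Fx.
  apply: (@cvg_deform R k n Sigma hSigma x 1 ((fun q => (q, 1)) @ F)) => //.
    by apply: (@filterE _ F) => q.
  exact: cvg_cst.
- by split=> //; exact: blocks_val_continuous.
- exists (fun q => deform (q.1, 1 - q.2)); split.
  + by apply: (@retract_homotopy X id) => x; exact: cvg_id.
  + by move=> p /i01 p01 t x; exact: deform_act.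
  + by move=> x; rewrite subr0.
  + by move=> x; rewrite subrr deform0.
- have inb (q : blocks * R) : q.2 \in `[0, 1] -> blocks (deform (set_val q.1, 1 - q.2)).
    by move=> /i01 p01; have [i yi] := set_valP q.1; exists i; exact: deform_block.
  (* Staying inside the blocks is known for times in [0, 1] only; elsewhere any point of the blocks
     will do, as continuity is required within the strip. *)
  pose h (q : blocks * R) : blocks := if pselect (q.2 \in `[0, 1]) is left p01
    then SigSub (mem_set (inb q p01)) else q.1.
  have hE q : q.2 \in `[0, 1] -> set_val (h q) = deform (set_val q.1, 1 - q.2).
    by rewrite /h => p01; case: pselect.
  have vi : injective (set_val : blocks -> X) by exact: val_inj.
  exists h; split.
  + apply/subspace_continuousP => -[y p] yp; apply/blocks_initial; rewrite hE; last first.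
      by case: yp.
    have /subspace_continuousP/(_ _ yp) := retract_homotopy blocks_val_continuous.
    apply: (cvg_near (f := fun q => deform (set_val q.1, 1 - q.2))).
    by apply: filterS (withinT _ _) => q [_ /hE].
  + move=> p p01 t y; apply: vi; rewrite hE//.
    by rewrite -[RHS]/(toric_act t (set_val (h (y, p)))) hE//; apply: deform_act; exact: i01.
  + move=> y; apply: vi; rewrite hE ?subr0//.
    by rewrite in_itv/= lexx ler01.
  + move=> y; apply: vi; rewrite hE ?subrr ?deform0//.
Qed.

End Retract.

Theorem corollary2p2 (R : realType) (n : nat) (k : base)
    (Sigma : set (set 'rV[R]_n)) (hSigma : rational_fan Sigma) :
  (complete_fan Sigma -> finite_GCW R (@toric_act R k n Sigma)) /\
  (exists (Y : topologicalType) (actY : torus R k n -> Y -> Y),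
     finite_GCW R actY /\
     equivariantly_homotopy_equivalent R (@toric_act R k n Sigma) actY).
Proof.
split; first exact: complete_GCW.
exists (@blocks R k n Sigma hSigma : topologicalType), (@blocks_act R k n Sigma hSigma).
by split; [exact: blocks_GCW|exact: blocks_equivalence].
Qed.
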